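(* Let $R=\bigoplus_{m\in\mathbb{N}}R_m$ be a reduced graded $k$-algebra and let $\chi\in\mathcal{N}_{\mathbb{R}}(R)$ be a norm generated in degree $1$, with homogenization $\chi^{\mathrm{hom}}$. Then: (i) there exists $C>0$ such that $\chi(f)\le\chi^{\mathrm{hom}}(f)\le\chi(f)+C$ for all $f\in R$; (ii) the $k$-algebra $\mathrm{gr}_{\chi^{\mathrm{hom}}}R$ is finitely generated; (iii) if $\chi\in\mathcal{N}_\Lambda(R)$ for a subgroup $\Lambda\subset\mathbb{R}$, then $\chi^{\mathrm{hom}}\in\mathcal{N}_{\mathbb{Q}\Lambda}(R)$.
   Context: $k$ is an algebraically closed field (any characteristic). A norm on a $k$-vector space $V$ is a function $\chi\colon V\to\mathbb{R}\cup\{+\infty\}$ with $\chi(v)=+\infty$ iff $v=0$, $\chi(av)=\chi(v)$ for $a\in k^\times$, and $\chi(v+w)\ge\min\{\chi(v),\chi(w)\}$. For a graded $k$-algebra $R=\bigoplus_{m\in\mathbb{N}}R_m$, $\mathcal{N}_{\mathbb{R}}(R)$ is the set of vector space norms $\chi$ on $R$ that are superadditive ($\chi(fg)\ge\chi(f)+\chi(g)$), compatible with the grading ($\chi(\sum_m s_m)=\min_m\chi(s_m)$ for $s_m\in R_m$), and linearly bounded (there is $C>0$ with $|\chi|\le Cm$ on $R_m\setminus\{0\}$ for all $m\ge1$). For a subgroup $\Lambda\subset\mathbb{R}$, $\mathcal{N}_\Lambda(R)$ is the subset of norms with values in $\Lambda\cup\{+\infty\}$, and $\mathbb{Q}\Lambda\subset\mathbb{R}$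 is the $\mathbb{Q}$-vector subspace spanned by $\Lambda$. A norm $\chi\in\mathcal{N}_{\mathbb{R}}(R)$ is generated in degree $1$ if $R$ is finitely generated and generated in degree $1$ (i.e. $R$ is generated as a $k$-algebra by the finite-dimensional space $R_1$) and, for every $m\ge1$, $\chi|_{R_m}$ is the quotient norm of $S^m(\chi|_{R_1})$ under the surjection $S^mR_1\to R_m$. Concretely: given a basis $(s_i)$ of $R_1$ that is $\chi$-orthogonal (i.e. $\chi(\sum_i a_is_i)=\min_{a_i\ne0}\chi(s_i)$), any nonzero $s\in R_m$ can be written $s=\sum_{|\alpha|=m}c_\alpha\prod_is_i^{\alpha_i}$ with $c_\alpha\in k$ and $\chi(s)=\min_{c_\alpha\ne0}\sum_i\alpha_i\chi(s_i)$. For $R$ reduced, the homogenization of $\chi$ is the norm $\chi^{\mathrm{hom}}\in\mathcal{N}_{\mathbb{R}}(R)$ defined by $\chi^{\mathrm{hom}}(f):=\sup_{d\ge1}\frac1d\chi(f^d)=\lim_{d\to\infty}\frac1d\chi(f^d)$. The associated graded algebra of a norm $\chi$ is $\mathrm{gr}_\chi R=\bigoplus_{(m,\lambda)\in\mathbb{N}\times\mathbb{R}}\{s\in R_m:\chi(s)\ge\lambda\}/\{s\in R_m:\chi(s)>\lambda\}$. *)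

(* Defs.v *)
From HB Require Import structures.
From mathcomp Require Import all_boot all_order all_algebra.
From mathcomp Require Import finmap generic_quotient ring_quotient.
From mathcomp Require Import boolp classical_sets reals constructive_ereal ereal.
From mathcomp Require Import ring lra.

Set Implicit Arguments.
Unset Strict Implicit.
Unset Printing Implicit Defensive.

Import Order.TTheory GRing.Theory Num.Theory.

Local Open Scope ring_scope.

Definition reduced (A : nzRingType) : Prop :=
  forall (f : A) (n : nat), f ^+ n = 0 -> f = 0.

Definition alg_generated_by (k : fieldType) (A : algType k) (X : {pred A}) :
    Prop :=
  forall S : subalgClosed A, {subset X <= S} -> forall f, f \in S.

Definition finitely_generated_algebra (k : fieldType) (A : algType k) : Prop :=
  exists s : seq A, alg_generated_by (mem s).

Definition is_basis (k : fieldType) (V : lmodType k) (W : {pred V}) (n : nat)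
    (s : 'I_n -> V) : Prop :=
  [/\ forall i, s i \in W,
      forall v, v \in W -> exists a : 'I_n -> k, v = \sum_(i < n) a i *: s i
    & forall a : 'I_n -> k, \sum_(i < n) a i *: s i = 0 -> forall i, a i = 0].

Definition finite_dimensional (k : fieldType) (V : lmodType k) (W : {pred V}) :
    Prop :=
  exists (n : nat) (s : 'I_n -> V), is_basis W s.

Definition Qspan (RR : realType) (L : {pred RR}) : set RR :=
  [set x | exists s : seq (rat * RR),
     all (fun p => p.2 \in L) s /\ x = \sum_(p <- s) ratr p.1 * p.2].

Record grading (k : fieldType) (A : comAlgType k) := Grading {
  gcomp :> nat -> submodClosed A;
  gcomp1 : 1 \in gcomp 0;
  gcompM : forall m n f g,
    f \in gcomp m -> g \in gcomp n -> f * g \in gcomp (m + n);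
  gcomp_span : forall f, exists (N : nat) (s : nat -> A),
    (forall m, s m \in gcomp m) /\ f = \sum_(m < N) s m;
  gcomp_free : forall (N : nat) (s : nat -> A),
    (forall m, s m \in gcomp m) -> \sum_(m < N) s m = 0 ->
    forall m, (m < N)%N -> s m = 0
}.

Record is_vnorm (k : fieldType) (V : lmodType k) (RR : realType)
    (chi : V -> \bar RR) : Prop := IsVNorm {
  vnormNy : forall v, chi v != -oo%E;
  vnorm_eqy : forall v, chi v = +oo%E <-> v = 0;
  vnormZ : forall (a : k) v, a != 0 -> chi (a *: v) = chi v;
  vnormD : forall v w, (mine (chi v) (chi w) <= chi (v + w)%R)%E
}.

Definition superadditive (A : nzRingType) (RR : realType)
    (chi : A -> \bar RR) : Prop :=
  forall f g, (chi f + chi g <= chi (f * g)%R)%E.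

Definition grading_compatible (k : fieldType) (A : comAlgType k)
    (G : grading A) (RR : realType) (chi : A -> \bar RR) : Prop :=
  forall (N : nat) (s : nat -> A), (forall m, s m \in G m) ->
    chi (\sum_(m < N) s m) = \big[mine/+oo%E]_(m < N) chi (s m).

Definition linearly_bounded (k : fieldType) (A : comAlgType k)
    (G : grading A) (RR : realType) (chi : A -> \bar RR) : Prop :=
  exists C : RR, 0 < C /\
    forall m f, (1 <= m)%N -> f \in G m -> f != 0 ->
      (`|chi f| <= (C * m%:R)%:E)%E.

Record in_NR (k : fieldType) (A : comAlgType k) (G : grading A)
    (RR : realType) (chi : A -> \bar RR) : Prop := InNR {
  NR_vnorm : is_vnorm chi;
  NR_superadditive : superadditive chi;
  NR_grading : grading_compatible G chi;
  NR_bounded : linearly_bounded G chi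
}.

Definition in_N (k : fieldType) (A : comAlgType k) (G : grading A)
    (RR : realType) (L : set RR) (chi : A -> \bar RR) : Prop :=
  in_NR G chi /\
  forall f, chi f = +oo%E \/ exists2 x, L x & chi f = x%:E.

Definition is_orthogonal_basis (k : fieldType) (V : lmodType k)
    (RR : realType) (chi : V -> \bar RR) (W : {pred V}) (n : nat)
    (s : 'I_n -> V) : Prop :=
  is_basis W s /\
  forall a : 'I_n -> k,
    chi (\sum_(i < n) a i *: s i)
    = \big[mine/+oo%E]_(i < n | a i != 0) chi (s i).

(* The multi-indices of weight m in n variables are the functions
   alpha : {ffun 'I_n -> 'I_m.+1} with \sum_i alpha i = m. *)
Definition generated_in_degree_1 (k : fieldType) (A : comAlgType k)
    (G : grading A) (RR : realType) (chi : A -> \bar RR) : Prop :=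
  [/\ finite_dimensional (G 1%N),
      alg_generated_by (G 1%N)
    & forall (n : nat) (s : 'I_n -> A), is_orthogonal_basis chi (G 1%N) s ->
      forall (m : nat) (f : A), (1 <= m)%N -> f \in G m -> f != 0 ->
      exists c : {ffun 'I_n -> 'I_m.+1} -> k,
        f = \sum_(alpha : {ffun 'I_n -> 'I_m.+1} | \sum_i alpha i == m :> nat)
              c alpha *: \prod_i s i ^+ alpha i
        /\
        chi f = \big[mine/+oo%E]_(alpha : {ffun 'I_n -> 'I_m.+1} |
                    (\sum_i alpha i == m :> nat) && (c alpha != 0))
                  (\sum_i chi (s i) *+ alpha i)%E].

(* For superadditive chi the sup is also the limit, by Fekete's lemma. *)
Definition homogenization (A : nzRingType) (RR : realType)
    (chi : A -> \bar RR) (f : A) : \bar RR :=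
  ereal_sup [set ((d%:R^-1)%:E * chi (f ^+ d)%R)%E | d in [set d | (0 < d)%N]].

(* The structure needed on a function A -> R \cup {+oo} for its associated
   graded to be a unital k-algebra. A norm of in_NR satisfies all of it except
   perhaps seminorm1: superadditivity only gives chi 1 <= 0, and the class of 1
   lives in degree (0, 0) only if chi 1 = 0. Homogenization restores this. *)
Record alg_seminorm (k : fieldType) (A : comAlgType k) (RR : realType) :=
  AlgSeminorm {
    seminorm_val :> A -> \bar RR;
    seminorm0 : seminorm_val 0 = +oo%E;
    seminorm1 : seminorm_val 1 = 0%E;
    seminormZ : forall (a : k) f,
      (seminorm_val f <= seminorm_val (a *: f)%R)%E;
    seminormD : forall f g,
      (mine (seminorm_val f) (seminorm_val g) <= seminorm_val (f + g)%R)%E;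
    seminormM : superadditive seminorm_val
  }.

Section HomogenizationSeminorm.
Variables (k : fieldType) (A : comAlgType k) (RR : realType).
Variable chi : A -> \bar RR.
Hypotheses (chiV : is_vnorm chi) (chiM : superadditive chi).

Let chi0 : chi 0 = +oo%E. Proof. exact/(vnorm_eqy chiV). Qed.

Let chi_real f : exists c : RR, (c%:E <= chi f)%E.
Proof.
have := vnormNy chiV f; case: (chi f) => [r| |] // _; first by exists r.
by exists 0; rewrite leey.
Qed.

Let chiX f (c : RR) u : (0 < u)%N -> (c%:E <= chi f)%E ->
  ((u%:R * c)%:E <= chi (f ^+ u))%E.
Proof.
case: u => // u _ cf; elim: u => [|u IH]; first by rewrite expr1 mul1r.
rewrite exprS; apply: le_trans (chiM _ _).
by rewrite -[u.+2]add1n natrD mulrDl mul1r EFinD; exact: leeD.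
Qed.

Let chiMn f n : (chi f <= chi (f *+ n))%E.
Proof.
elim: n => [|n IH]; first by rewrite mulr0n chi0 leey.
by rewrite mulrS; apply: le_trans (vnormD chiV _ _); rewrite le_min lexx IH.
Qed.

Let chi_sum (I : Type) (r : seq I) (F : I -> A) (x : \bar RR) :
  (forall i, (x <= chi (F i))%E) -> (x <= chi (\sum_(i <- r) F i)%R)%E.
Proof.
move=> xF; elim/big_rec: _ => [|i f _ xf]; first by rewrite chi0 leey.
by apply: le_trans (vnormD chiV _ _); rewrite le_min xF xf.
Qed.

Let le_hom f d (c : RR) : (0 < d)%N -> ((d%:R * c)%:E <= chi (f ^+ d))%E ->
  (c%:E <= homogenization chi f)%E.
Proof.
move=> d0 h; have d0' : 0 < d%:R :> RR by rewrite ltr0n.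
apply: le_trans (ereal_sup_ubound _); last by exists d.
by rewrite lee_pdivlMl.
Qed.

Let lt_hom f (c : RR) : (c%:E < homogenization chi f)%E ->
  exists2 d, (0 < d)%N & ((d%:R * c)%:E <= chi (f ^+ d))%E.
Proof.
move=> /ereal_sup_gt[_ [d /= d0 <-]] h; exists d => //.
by rewrite EFinM -lee_pdivlMl ?ltr0n // ltW.
Qed.

Let hom_ge f : (chi f <= homogenization chi f)%E.
Proof.
by apply: ereal_sup_ubound; exists 1%N => //=; rewrite invr1 mul1e expr1.
Qed.

Let le_real (x y : \bar RR) :
  (forall c : RR, (c%:E < x)%E -> (c%:E <= y)%E) -> (x <= y)%E.
Proof.
move=> h; rewrite leNgt; apply/negP => yx.
case: x y yx h => [r| |] [s| |] //=.
- rewrite lte_fin => sr /(_ ((r + s) / 2)); rewrite !(lte_fin, lee_fin); lra.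
- by move=> _ /(_ (r - 1)); rewrite leeNy_eq lte_fin gtrBl ltr01 => /(_ isT).
- by move=> _ /(_ (s + 1) (ltry _)); rewrite lee_fin gerDl ler10.
- by move=> _ /(_ 0 (ltry _)).
Qed.

Lemma homogenization0 : homogenization chi 0 = +oo%E.
Proof. by apply/eqP; rewrite -leye_eq -chi0 hom_ge. Qed.

Lemma homogenization1 : homogenization chi 1 = 0%E.
Proof.
have [r chi1] : exists r : RR, chi 1 = r%:E.
  have := vnormNy chiV 1; case E : (chi 1) => [r| |] // _; first by exists r.
  by move/(vnorm_eqy chiV): E => /eqP; rewrite oner_eq0.
have r0 : r <= 0.
  by have := chiM 1 1; rewrite mulr1 chi1 -EFinD lee_fin; lra.
apply/eqP; rewrite eq_le; apply/andP; split.
  apply: ge_ereal_sup => _ [d /= d0 <-]; rewrite expr1n chi1 -EFinM lee_fin.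
  by rewrite mulr_ge0_le0 // invr_ge0.
apply: le_real => c; rewrite lte_fin => c0.
pose d := (Num.bound (r / c)).+1.
apply: (@le_hom _ d) => //; rewrite expr1n chi1 lee_fin.
have : r / c < d%:R.
  have rc : 0 <= r / c by rewrite mulr_le0 // invr_le0 ltW.
  by apply: lt_trans (archi_boundP rc) _; rewrite ltr_nat.
by rewrite ltr_ndivrMr // => /ltW.
Qed.

Lemma homogenizationZ (a : k) f :
  (homogenization chi f <= homogenization chi (a *: f)%R)%E.
Proof.
have [->|a0] := eqVneq a 0; first by rewrite scale0r homogenization0 leey.
apply: le_real => c /lt_hom[d d0 h]; apply: (le_hom d0).
by rewrite exprZn (vnormZ chiV) // expf_neq0.
Qed.

Lemma homogenizationM : superadditive (homogenization chi).
Proof.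
have key f g p q (a b : RR) : (0 < p)%N -> (0 < q)%N ->
    ((p%:R * a)%:E <= chi (f ^+ p))%E -> ((q%:R * b)%:E <= chi (g ^+ q))%E ->
    ((a + b)%:E <= homogenization chi (f * g))%E.
  move=> p0 q0 hf hg; apply: (@le_hom _ (p * q)); first by rewrite muln_gt0 p0.
  rewrite exprMn; apply: le_trans (chiM _ _).
  rewrite mulrDr EFinD; apply: leeD.
    have -> : (p * q)%:R * a = q%:R * (p%:R * a) by rewrite natrM; ring.
    by rewrite exprM; exact: chiX.
  have -> : (p * q)%:R * b = p%:R * (q%:R * b) by rewrite natrM; ring.
  by rewrite mulnC exprM; exact: chiX.
have split (x y : \bar RR) (c : RR) : x != -oo%E -> y != -oo%E ->
    (c%:E < x + y)%E -> exists a b, [/\ (a%:E < x)%E, (b%:E < y)%E & c = a + b].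
  case: x y => [x| |] [y| |] //= _ _; rewrite ?lte_fin => h.
  - exists (x - (x + y - c) / 2), (y - (x + y - c) / 2).
    by rewrite !lte_fin; split; lra.
  - by exists (x - 1), (c - (x - 1)); rewrite lte_fin !ltry; split => //; lra.
  - by exists (c - (y - 1)), (y - 1); rewrite lte_fin !ltry; split => //; lra.
  - by exists 0, c; rewrite !ltry add0r.
move=> f g; apply: le_real => c hc.
have homNy h : homogenization chi h != -oo%E.
  have [a /le_trans/(_ (hom_ge h))] := chi_real h.
  by case: (homogenization chi h).
have [a [b [/lt_hom[p p0 ha] /lt_hom[q q0 hb] ->]]] :=
  split _ _ _ (homNy f) (homNy g) hc.
exact: key ha hb.
Qed.

Lemma homogenizationD f g :
  (mine (homogenization chi f) (homogenization chi g)
    <= homogenization chi (f + g)%R)%E.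
Proof.
apply: le_real => c; rewrite lt_min => /andP[/lt_hom[p p0 hf] /lt_hom[q q0 hg]].
pose r := (p * q)%N; have r0 : (0 < r)%N by rewrite muln_gt0 p0.
have fr : ((r%:R * c)%:E <= chi (f ^+ r))%E.
  have -> : r%:R * c = q%:R * (p%:R * c) by rewrite natrM; ring.
  by rewrite exprM; exact: chiX.
have gr : ((r%:R * c)%:E <= chi (g ^+ r))%E.
  have -> : r%:R * c = p%:R * (q%:R * c) by rewrite natrM; ring.
  by rewrite /r mulnC exprM; exact: chiX.
have bound h : ((r%:R * c)%:E <= chi (h ^+ r))%E ->
    exists2 K : RR, 0 <= K &
      forall i, ((i%:R * c - K)%:E <= chi (h ^+ i))%E.
  move=> hr.
  have [K1 K10 hK1] : exists2 K : RR, 0 <= K &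
      forall v, (v < r)%N -> ((- K)%:E <= chi (h ^+ v))%E.
    elim: (r) => [|n [K K0 hK]]; first by exists 0.
    have [b hb] := chi_real (h ^+ n).
    exists (K + `|b|) => [|v]; first by rewrite addr_ge0.
    rewrite ltnS leq_eqVlt => /predU1P[->|/hK].
      by apply: le_trans hb; rewrite lee_fin; have := ler_norm (- b); rewrite normrN; lra.
    by apply: le_trans; rewrite lee_fin; have := normr_ge0 b; lra.
  exists (K1 + r%:R * `|c|) => [|i]; first by rewrite addr_ge0 // mulr_ge0.
  have vr : (i %% r < r)%N by rewrite ltn_mod.
  have vc : (i %% r)%:R * c <= r%:R * `|c|.
    apply: le_trans (ler_norm _) _; rewrite normrM ger0_norm //.
    by rewrite ler_wpM2r // ler_nat ltnW.
  rewrite {1 2}(divn_eq i r); case: (posnP (i %/ r)) => [->|u0].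
    rewrite mul0n add0n; apply: le_trans (hK1 _ vr); rewrite lee_fin; lra.
  rewrite exprD; apply: le_trans (chiM _ _).
  apply: le_trans (leeD (_ : ((i %/ r)%:R * (r%:R * c))%:E <= _)%E (hK1 _ vr)).
    by rewrite -EFinD lee_fin natrD natrM; lra.
  by rewrite mulnC exprM; exact: chiX.
have [K K0 hK] := bound f fr; have [L L0 hL] := bound g gr.
apply: le_real => a; rewrite lte_fin => ac.
pose n := (Num.bound ((K + L) / (c - a))).+1.
apply: (@le_hom _ n) => //.
have hn : (K + L) / (c - a) < n%:R.
  have h0 : 0 <= (K + L) / (c - a) by rewrite divr_ge0 //; lra.
  by apply: lt_trans (archi_boundP h0) _; rewrite ltr_nat.
have {}hn : n%:R * a <= n%:R * c - (K + L).
  by move: hn; rewrite ltr_pdivrMr ?subr_gt0 //; lra.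
rewrite exprDn; apply: chi_sum => i; apply: le_trans (chiMn _ _).
apply: le_trans (chiM _ _); apply: le_trans (leeD (hK _) (hL _)).
rewrite -EFinD lee_fin; apply: le_trans hn _.
have -> : n%:R * c = (n - i)%:R * c + i%:R * c.
  by rewrite -mulrDl -natrD subnK // -ltnS.
lra.
Qed.

Definition homogenization_seminorm : alg_seminorm A RR :=
  AlgSeminorm homogenization0 homogenization1 homogenizationZ homogenizationD
    homogenizationM.

End HomogenizationSeminorm.

(* The monoid algebra A[K]: finitely supported families of elements of A indexed
   by the additive monoid K, with the convolution product. The operations are
   locked to keep conversion from unfolding them. *)
Definition monoid_algebra (K : nmodType) (A : comNzRingType) : Type :=
  {fsfun K -> A with 0}.

Section MonoidAlgebra.
Variables (K : nmodType) (A : comNzRingType).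
Local Notation MA := (monoid_algebra K A).
Implicit Types a b c : MA.

HB.instance Definition _ := Choice.on MA.

Definition ma_coef a : K -> A := a.

Lemma ma_coefP a b : (forall x, ma_coef a x = ma_coef b x) -> a = b.
Proof. by move=> h; apply/fsfunP. Qed.

Fact ma_key : unit. Proof. exact: tt. Qed.

Definition ma_zero : MA := locked_with ma_key [fsfun].
Definition ma_monom (x : K) (s : A) : MA :=
  locked_with ma_key [fsfun y in [fset x]%fset => s].
Definition ma_one : MA := ma_monom 0 1.
Definition ma_opp a : MA :=
  locked_with ma_key [fsfun x in finsupp a => - a x].
Definition ma_add a b : MA :=
  locked_with ma_key
    [fsfun x in (finsupp a `|` finsupp b)%fset => a x + b x].
Definition ma_mul a b : MA :=
  locked_with ma_key
    [fsfun z in [fset (x + y)%R | x in finsupp a, y in finsupp b]%fset =>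
      \sum_(x <- finsupp a) \sum_(y <- finsupp b | x + y == z) a x * b y].

Lemma ma_zeroE x : ma_coef ma_zero x = 0.
Proof. by rewrite /ma_zero locked_withE /ma_coef fsfun0E. Qed.

Lemma ma_monomE x s y : ma_coef (ma_monom x s) y = s *+ (y == x).
Proof. by rewrite /ma_monom locked_withE /ma_coef fsfun_fun inE; case: eqP. Qed.

Lemma ma_oppE a x : ma_coef (ma_opp a) x = - ma_coef a x.
Proof.
rewrite /ma_opp locked_withE /ma_coef fsfun_fun.
by case: finsuppP => //; rewrite oppr0.
Qed.

Lemma ma_addE a b x : ma_coef (ma_add a b) x = ma_coef a x + ma_coef b x.
Proof.
rewrite /ma_add locked_withE /ma_coef fsfun_fun inE.
by case: (finsuppP a); case: (finsuppP b) => //=; rewrite ?addr0.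
Qed.

Lemma ma_sum_supp a (D : {fset K}) (F : K -> A -> A) :
    (finsupp a `<=` D)%fset -> (forall x, F x 0 = 0) ->
  \sum_(x <- finsupp a) F x (a x) = \sum_(x <- D) F x (a x).
Proof.
move=> aD F0; apply: big_fset_incl => // x _ xa.
by rewrite fsfun_dflt.
Qed.

Lemma ma_mulEw a b (D E : {fset K}) z :
    (finsupp a `<=` D)%fset -> (finsupp b `<=` E)%fset ->
  ma_coef (ma_mul a b) z
  = \sum_(x <- D) \sum_(y <- E) (ma_coef a x * ma_coef b y) *+ (x + y == z).
Proof.
move=> aD bE; rewrite /ma_mul locked_withE /ma_coef fsfun_fun.
transitivity (\sum_(x <- finsupp a) \sum_(y <- finsupp b)
    (a x * b y) *+ (x + y == z)).
  case: ifPn => [_|zab].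
    by apply: eq_bigr => x _; rewrite big_mkcond; apply: eq_bigr => y _; case: eqP.
  rewrite big_seq big1 // => x xa; rewrite big_seq big1 // => y yb.
  case: eqP => // xyz; case/negP: zab; apply/imfset2P.
  by exists x => //; exists y.
rewrite (@ma_sum_supp a D (fun x s => \sum_(y <- finsupp b) (s * b y) *+ (x + y == z))) //.
  apply: eq_bigr => x _.
  apply: (@ma_sum_supp b E (fun y s => (a x * s) *+ (x + y == z))) => // y.
  by rewrite mulr0 mul0rn.
by move=> x; rewrite big1 // => y _; rewrite mul0r mul0rn.
Qed.

Lemma ma_mulE a b z :
  ma_coef (ma_mul a b) z
  = \sum_(x <- finsupp a) \sum_(y <- finsupp b)
      (ma_coef a x * ma_coef b y) *+ (x + y == z).
Proof. exact: ma_mulEw. Qed.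

Fact ma_addA : associative ma_add.
Proof. by move=> a b c; apply: ma_coefP => x; rewrite !ma_addE addrA. Qed.

Fact ma_addC : commutative ma_add.
Proof. by move=> a b; apply: ma_coefP => x; rewrite !ma_addE addrC. Qed.

Fact ma_add0 : left_id ma_zero ma_add.
Proof. by move=> a; apply: ma_coefP => x; rewrite ma_addE ma_zeroE add0r. Qed.

Fact ma_addN : left_inverse ma_zero ma_opp ma_add.
Proof.
by move=> a; apply: ma_coefP => x; rewrite ma_addE ma_oppE ma_zeroE addNr.
Qed.

HB.instance Definition _ :=
  GRing.isZmodule.Build MA ma_addA ma_addC ma_add0 ma_addN.

Lemma ma_sum_delta (D : {fset K}) x (F : K -> A) : x \in D ->
  \sum_(w <- D) F w *+ (x == w) = F x.
Proof.
move=> xD; rewrite (big_fsetD1 x) //= eqxx big_seq big1 ?addr0 // => w.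
by rewrite !inE eq_sym => /andP[/negPf ->].
Qed.

Fact ma_mulC : commutative ma_mul.
Proof.
move=> a b; apply: ma_coefP => z; rewrite !ma_mulE exchange_big /=.
by apply: eq_bigr => y _; apply: eq_bigr => x _; rewrite mulrC addrC.
Qed.

Lemma ma_supp_mul a b :
  (finsupp (ma_mul a b)
     `<=` [fset (x + y)%R | x in finsupp a, y in finsupp b])%fset.
Proof. by rewrite /ma_mul locked_withE; exact: finsupp_sub. Qed.

Lemma ma_mul3E a b c z :
  ma_coef (ma_mul (ma_mul a b) c) z =
  \sum_(x <- finsupp a) \sum_(y <- finsupp b) \sum_(t <- finsupp c)
    (ma_coef a x * ma_coef b y * ma_coef c t) *+ (x + y + t == z).
Proof.
set D := [fset (x + y)%R | x in finsupp a, y in finsupp b]%fset.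
rewrite (ma_mulEw z (ma_supp_mul a b) (fsubset_refl _)) -/D.
under eq_bigr => w _ do under eq_bigr => t _ do
  rewrite ma_mulE mulr_suml -sumrMnl.
under eq_bigr => w _ do under eq_bigr => t _ do under eq_bigr => x _ do
  rewrite mulr_suml -sumrMnl.
under eq_bigr => w _ do rewrite exchange_big.
rewrite exchange_big /= big_seq [RHS]big_seq; apply: eq_bigr => x xa.
under eq_bigr => w _ do rewrite exchange_big.
rewrite exchange_big /= big_seq [RHS]big_seq; apply: eq_bigr => y yb.
rewrite exchange_big /=; apply: eq_bigr => t _.
under eq_bigr => w _ do rewrite mulrnAl mulrnAC.
rewrite (@ma_sum_delta D (x + y)
  (fun w => (ma_coef a x * ma_coef b y * ma_coef c t) *+ (w + t == z))) //.
by apply/imfset2P; exists x => //; exists y.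
Qed.

Fact ma_mulA : associative ma_mul.
Proof.
move=> a b c; apply: ma_coefP => z; rewrite ma_mulC !ma_mul3E.
under eq_bigr => y _ do rewrite exchange_big.
rewrite exchange_big /=; apply: eq_bigr => x _.
apply: eq_bigr => y _; apply: eq_bigr => t _.
by rewrite mulrC mulrA [y + t + x]addrC addrA.
Qed.

Fact ma_mul1 : left_id ma_one ma_mul.
Proof.
move=> a; apply: ma_coefP => z.
have s1 : (finsupp ma_one `<=` [fset 0])%fset.
  by rewrite /ma_one /ma_monom locked_withE; exact: finsupp_sub.
rewrite (ma_mulEw z s1 (fsubset_refl _)) big_seq_fset1 ma_monomE eqxx mulr1n.
under eq_bigr => y _ do rewrite mul1r add0r eq_sym.
have [za|za] := boolP (z \in finsupp a); first exact: ma_sum_delta.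
rewrite big_seq big1 => [|y ya]; first by rewrite /ma_coef fsfun_dflt.
by case: eqP => // zy; rewrite zy ya in za.
Qed.

Fact ma_mulDl : left_distributive ma_mul +%R.
Proof.
move=> a b c; apply: ma_coefP => z.
pose D := (finsupp a `|` finsupp b `|` finsupp (a + b)%R)%fset.
have aD : (finsupp a `<=` D)%fset by rewrite /D -fsetUA fsubsetUl.
have bD : (finsupp b `<=` D)%fset by rewrite /D fsetUAC fsubsetUr.
have abD : (finsupp (a + b)%R `<=` D)%fset by rewrite /D fsubsetUr.
rewrite [RHS]ma_addE (ma_mulEw z aD (fsubset_refl _)).
rewrite (ma_mulEw z bD (fsubset_refl _)) (ma_mulEw z abD (fsubset_refl _)).
rewrite -big_split; apply: eq_bigr => x _ /=.
rewrite -big_split; apply: eq_bigr => y _ /=.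
by rewrite ma_addE mulrDl mulrnDl.
Qed.

Fact ma_one_neq0 : ma_one != 0.
Proof.
apply/eqP => /(congr1 (fun a => ma_coef a 0)).
by rewrite ma_monomE ma_zeroE eqxx => /eqP; rewrite oner_eq0.
Qed.

HB.instance Definition _ := GRing.Zmodule_isComNzRing.Build MA
  ma_mulA ma_mulC ma_mul1 ma_mulDl ma_one_neq0.

Lemma ma_coef0 x : ma_coef (0 : MA) x = 0.
Proof. exact: ma_zeroE. Qed.

Lemma ma_coef1 x : ma_coef (1 : MA) x = (x == 0)%:R.
Proof. exact: ma_monomE. Qed.

Lemma ma_coefB a b x : ma_coef (a - b) x = ma_coef a x - ma_coef b x.
Proof. by rewrite [LHS]ma_addE ma_oppE. Qed.

Lemma ma_coefD a b x : ma_coef (a + b) x = ma_coef a x + ma_coef b x.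
Proof. exact: ma_addE. Qed.

Lemma ma_coefM a b z : ma_coef (a * b) z =
  \sum_(x <- finsupp a) \sum_(y <- finsupp b)
    (ma_coef a x * ma_coef b y) *+ (x + y == z).
Proof. exact: ma_mulE. Qed.

Lemma ma_monomM x y s t :
  ma_monom x s * ma_monom y t = ma_monom (x + y) (s * t).
Proof.
apply: ma_coefP => z.
have sx u r : (finsupp (ma_monom u r) `<=` [fset u])%fset.
  by rewrite /ma_monom locked_withE; exact: finsupp_sub.
rewrite (ma_mulEw z (sx _ _) (sx _ _)) !big_seq_fset1 !ma_monomE !eqxx.
by rewrite !mulr1n eq_sym.
Qed.

End MonoidAlgebra.

(* The index x stands for (m, lambda). *)
Definition filt_ge (k : fieldType) (A : comAlgType k) (G : grading A)
    (RR : realType) (chi : A -> \bar RR) (x : nat * RR) : {pred A} :=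
  [pred s | (s \in G x.1) && (x.2%:E <= chi s)%E].

Definition filt_gt (k : fieldType) (A : comAlgType k) (G : grading A)
    (RR : realType) (chi : A -> \bar RR) (x : nat * RR) : {pred A} :=
  [pred s | (s \in G x.1) && (x.2%:E < chi s)%E].

(* \bigoplus_x (filt_ge x / filt_gt x) is realized as the quotient
   (\bigoplus_x filt_ge x) / (\bigoplus_x filt_gt x): the first direct sum is a
   subring of the monoid algebra A[nat * RR], the second one an ideal of it. *)
Definition dsum_ge (k : fieldType) (A : comAlgType k) (G : grading A)
    (RR : realType) (chi : alg_seminorm A RR) :
    {pred monoid_algebra (nat * RR)%type A} :=
  [pred a | `[< forall x, ma_coef a x \in filt_ge G chi x >]].

Section Gr.
Variables (k : fieldType) (A : comAlgType k) (G : grading A) (RR : realType).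
Variable chi : alg_seminorm A RR.
Local Notation K := (nat * RR)%type.
Local Notation MA := (monoid_algebra K A).

Let seminormN f : (chi f <= chi (- f)%R)%E.
Proof. by rewrite -scaleN1r; exact: seminormZ. Qed.

Lemma filt_ge0 x : 0 \in filt_ge G chi x.
Proof. by rewrite inE rpred0 seminorm0 leey. Qed.

Lemma filt_geD x f g : f \in filt_ge G chi x -> g \in filt_ge G chi x ->
  f + g \in filt_ge G chi x.
Proof.
rewrite !inE => /andP[fG fx] /andP[gG gx]; rewrite rpredD //=.
by apply: le_trans (seminormD _ _ _); rewrite le_min fx.
Qed.

Lemma filt_geN x f : f \in filt_ge G chi x -> - f \in filt_ge G chi x.
Proof.
rewrite !inE => /andP[fG fx]; rewrite -{1}scaleN1r rpredZ //=.
exact: le_trans (seminormN _).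
Qed.

Lemma filt_geM x y f g : f \in filt_ge G chi x -> g \in filt_ge G chi y ->
  f * g \in filt_ge G chi (x + y).
Proof.
rewrite !inE => /andP[fG fx] /andP[gG gx]; rewrite gcompM //=.
by rewrite EFinD; apply: le_trans (seminormM _ _ _); exact: leeD.
Qed.

Lemma filt_gt0 x : 0 \in filt_gt G chi x.
Proof. by rewrite inE rpred0 seminorm0 ltry. Qed.

Lemma filt_gtD x f g : f \in filt_gt G chi x -> g \in filt_gt G chi x ->
  f + g \in filt_gt G chi x.
Proof.
rewrite !inE => /andP[fG fx] /andP[gG gx]; rewrite rpredD //=.
by apply: lt_le_trans (seminormD _ _ _); rewrite lt_min fx.
Qed.

Lemma filt_gtN x f : f \in filt_gt G chi x -> - f \in filt_gt G chi x.
Proof.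
rewrite !inE => /andP[fG fx]; rewrite -{1}scaleN1r rpredZ //=.
exact: lt_le_trans (seminormN _).
Qed.

Lemma filt_gtM x y f g : f \in filt_ge G chi x -> g \in filt_gt G chi y ->
  f * g \in filt_gt G chi (x + y).
Proof.
rewrite !inE => /andP[fG fx] /andP[gG gx]; rewrite gcompM //=.
rewrite EFinD; apply: lt_le_trans (seminormM _ _ _).
move: fx gx; case: (chi f) => [r| |] //; case: (chi g) => [t| |] //=.
- by rewrite lee_fin !lte_fin; exact: ler_ltD.
- by rewrite !ltry.
- by rewrite !ltry.
- by rewrite !ltry.
Qed.

Lemma dsum_geP a :
  reflect (forall x, ma_coef a x \in filt_ge G chi x) (a \in dsum_ge G chi).
Proof. exact: asboolP. Qed.

Fact dsum_ge_subring : subring_closed (dsum_ge G chi).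
Proof.
split=> [|a b /dsum_geP ha /dsum_geP hb|a b /dsum_geP ha /dsum_geP hb];
    apply/dsum_geP => x.
- rewrite ma_coef1; case: eqP => [->|_]; last exact: filt_ge0.
  by rewrite inE gcomp1 seminorm1 lexx.
- by rewrite ma_coefB filt_geD // filt_geN.
- rewrite ma_coefM; elim/big_ind: _ => [|f g|y _]; [exact: filt_ge0|exact: filt_geD|].
  elim/big_ind: _ => [|f g|t _]; [exact: filt_ge0|exact: filt_geD|].
  by case: eqP => [<-|_]; [rewrite mulr1n filt_geM|exact: filt_ge0].
Qed.

HB.instance Definition _ :=
  GRing.isSubringClosed.Build MA (dsum_ge G chi) dsum_ge_subring.

Record dsum_ge_type := DsumGe {
  dsum_val :> MA;
  dsum_valP : dsum_val \in dsum_ge G chi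
}.

HB.instance Definition _ := [isSub for dsum_val].
HB.instance Definition _ := [Choice of dsum_ge_type by <:].
HB.instance Definition _ :=
  [SubChoice_isSubComNzRing of dsum_ge_type by <:].

Lemma dsum_val0 : dsum_val 0 = 0. Proof. by []. Qed.
Lemma dsum_val1 : dsum_val 1 = 1. Proof. by []. Qed.
Lemma dsum_valB (a b : dsum_ge_type) : dsum_val (a - b) = dsum_val a - dsum_val b.
Proof. by []. Qed.
Lemma dsum_valD (a b : dsum_ge_type) : dsum_val (a + b) = dsum_val a + dsum_val b.
Proof. by []. Qed.
Lemma dsum_valM (a b : dsum_ge_type) : dsum_val (a * b) = dsum_val a * dsum_val b.
Proof. by []. Qed.

Definition dsum_gt : {pred dsum_ge_type} :=
  [pred a | `[< forall x, ma_coef (dsum_val a) x \in filt_gt G chi x >]].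

Lemma dsum_gtP (a : dsum_ge_type) :
  reflect (forall x, ma_coef (dsum_val a) x \in filt_gt G chi x) (a \in dsum_gt).
Proof. exact: asboolP. Qed.

Fact dsum_gt_zmod : zmod_closed dsum_gt.
Proof.
split=> [|a b /dsum_gtP ha /dsum_gtP hb]; apply/dsum_gtP => x.
  by rewrite dsum_val0 ma_coef0 filt_gt0.
by rewrite dsum_valB ma_coefB filt_gtD // filt_gtN.
Qed.

Fact dsum_gt_proper :
  1 \notin dsum_gt /\ forall a, {in dsum_gt, forall b, a * b \in dsum_gt}.
Proof.
split=> [|a b /dsum_gtP hb].
  apply/negP => /dsum_gtP/(_ 0).
  by rewrite dsum_val1 ma_coef1 eqxx inE seminorm1 ltxx andbF.
apply/dsum_gtP => x; rewrite dsum_valM ma_coefM.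
have /dsum_geP ha := dsum_valP a.
elim/big_ind: _ => [|f g|y _]; [exact: filt_gt0|exact: filt_gtD|].
elim/big_ind: _ => [|f g|t _]; [exact: filt_gt0|exact: filt_gtD|].
by case: eqP => [<-|_]; [rewrite mulr1n filt_gtM|exact: filt_gt0].
Qed.

HB.instance Definition _ :=
  GRing.isZmodClosed.Build dsum_ge_type dsum_gt dsum_gt_zmod.
HB.instance Definition _ :=
  isProperIdeal.Build dsum_ge_type dsum_gt dsum_gt_proper.

Definition gr : Type := {ideal_quot dsum_gt}.

HB.instance Definition _ := GRing.ComNzRing.on gr.

Local Open Scope quotient_scope.

Definition ma_scale (c : k) (a : MA) : MA :=
  [fsfun x in finsupp a => c *: a x].

Lemma ma_scaleE c a x : ma_coef (ma_scale c a) x = c *: ma_coef a x.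
Proof.
by rewrite /ma_coef fsfun_fun; case: finsuppP => //; rewrite scaler0.
Qed.

Lemma filt_geZ x c f : f \in filt_ge G chi x -> c *: f \in filt_ge G chi x.
Proof.
rewrite !inE => /andP[fG fx]; rewrite rpredZ //=.
exact: le_trans (seminormZ _ _ _).
Qed.

Lemma filt_gtZ x c f : f \in filt_gt G chi x -> c *: f \in filt_gt G chi x.
Proof.
rewrite !inE => /andP[fG fx]; rewrite rpredZ //=.
exact: lt_le_trans (seminormZ _ _ _).
Qed.

Fact dsum_scale_subproof c (a : dsum_ge_type) :
  ma_scale c a \in dsum_ge G chi.
Proof.
apply/dsum_geP => x; rewrite ma_scaleE filt_geZ //.
exact: (dsum_geP _ (dsum_valP a)).
Qed.

Definition dsum_scale c (a : dsum_ge_type) : dsum_ge_type :=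
  DsumGe (dsum_scale_subproof c a).

Definition gr_scale (c : k) (u : gr) : gr := \pi_gr (dsum_scale c (repr u)).

Lemma gr_eqP (a b : dsum_ge_type) :
  reflect (\pi_gr a = \pi_gr b) (a - b \in dsum_gt).
Proof. by rewrite Quotient.idealrBE; exact: eqP. Qed.

Lemma gr_scale_pi c a : gr_scale c (\pi_gr a) = \pi_gr (dsum_scale c a).
Proof.
apply/gr_eqP/dsum_gtP => x.
have /gr_eqP/dsum_gtP/(_ x) : \pi_gr (repr (\pi_gr a)) = \pi_gr a by rewrite reprK.
rewrite !dsum_valB !ma_coefB !ma_scaleE -scalerBr.
exact: filt_gtZ.
Qed.

Let dsum_eq (a b : dsum_ge_type) :
  (forall x, ma_coef (dsum_val a) x = ma_coef (dsum_val b) x) -> a = b.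
Proof. by move=> h; apply: val_inj; apply: ma_coefP. Qed.

Let gr_ind (P : gr -> Prop) : (forall a, P (\pi_gr a)) -> forall u, P u.
Proof. by move=> h u; rewrite -[u]reprK. Qed.

Let pi_grD a b : \pi_gr (a + b) = \pi_gr a + \pi_gr b.
Proof. by rewrite !piE. Qed.

Let pi_grM a b : \pi_gr (a * b) = \pi_gr a * \pi_gr b.
Proof. by rewrite !piE. Qed.

Fact gr_scaleA c d u : gr_scale c (gr_scale d u) = gr_scale (c * d) u.
Proof.
elim/gr_ind: u => a; rewrite !gr_scale_pi; congr (\pi_gr _).
by apply: dsum_eq => x; rewrite !ma_scaleE scalerA.
Qed.

Fact gr_scale1 : left_id 1 gr_scale.
Proof.
elim/gr_ind => a; rewrite gr_scale_pi; congr (\pi_gr _).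
by apply: dsum_eq => x; rewrite ma_scaleE scale1r.
Qed.

Fact gr_scaleDr : right_distributive gr_scale +%R.
Proof.
move=> c; elim/gr_ind => a; elim/gr_ind => b.
rewrite -pi_grD !gr_scale_pi -pi_grD; congr (\pi_gr _).
by apply: dsum_eq => x; rewrite !(dsum_valD, ma_coefD, ma_scaleE) scalerDr.
Qed.

Fact gr_scaleDl u : {morph gr_scale^~ u : c d / c + d}.
Proof.
move=> c d; elim/gr_ind: u => a; rewrite !gr_scale_pi -pi_grD.
congr (\pi_gr _).
by apply: dsum_eq => x; rewrite !(dsum_valD, ma_coefD, ma_scaleE) scalerDl.
Qed.

HB.instance Definition _ := GRing.Zmodule_isLmodule.Build k gr
  gr_scaleA gr_scale1 gr_scaleDr gr_scaleDl.

Fact gr_scaleAl (c : k) (u v : gr) : c *: (u * v) = (c *: u) * v.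
Proof.
change (gr_scale c (u * v) = gr_scale c u * v).
elim/gr_ind: u => a; elim/gr_ind: v => b.
rewrite -pi_grM !gr_scale_pi -pi_grM; congr (\pi_gr _).
apply: dsum_eq => z; rewrite ma_scaleE.
have sa : (finsupp (ma_scale c a) `<=` finsupp (dsum_val a))%fset.
  exact: finsupp_sub.
rewrite !dsum_valM [in LHS]ma_coefM scaler_sumr.
rewrite [RHS](_ : _ = ma_coef (ma_mul (ma_scale c a) b) z) //.
rewrite (ma_mulEw z sa (fsubset_refl _)).
apply: eq_bigr => x _; rewrite scaler_sumr; apply: eq_bigr => y _.
by rewrite ma_scaleE -scalerAl scalerMnr.
Qed.

HB.instance Definition _ := GRing.Lmodule_isLalgebra.Build k gr gr_scaleAl.
HB.instance Definition _ := GRing.Lalgebra_isComAlgebra.Build k gr.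

End Gr.

(* Main.v *)
(** Let x_1, ..., x_n be a chi-orthogonal basis of R_1, and write gr for the
    associated graded algebra of chi^hom. Everything follows once gr is known to
    be a Noetherian module over k[x]: (ii) is then clear; approximating
    f in R_m by combinations of finitely many homogeneous generators leaves an
    error of larger chi^hom, so (i) follows because R_m is finite dimensional;
    and (iii) follows by comparing two powers of f approximated through the
    same generator.

    Since R is reduced, chi^hom is the minimum of the spectral seminorms of the
    quotients of R by finitely many homogeneous primes, and gr embeds in the
    product of their associated graded algebras; so fix a prime P and its
    spectral seminorm sigma. Let D = k[RR] be the group algebra of the real
    numbers, with its valuation, and map D[x] to the Rees-like algebra of the
    finite sums of f T^lambda modulo P. Noether normalization of the relations
    between symbols gives linear forms Y such that k[Y] embeds in gr_sigma; by
    a Nakayama argument over the valuation ring of D, the image of D[x] is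
    finite over D[Y], up to scalars of valuation 0. If the powers of h grow
    like mu, the characteristic polynomial of h over D[Y] yields, because D[Y] is
    completely integrally closed up to D, an equation s h^N = sum a_i h^i with s
    in D of valuation 0 and a_i of Gauss valuation at least (N - i) mu. Taking
    residues, gr_sigma is a reduced, torsion-free, integral k[Y]-algebra of
    finite rank, and such an algebra has a common denominator: bound the degree
    in each variable Y_i separately, using that integrality bounds the
    denominators of all powers while reducedness prevents negative degrees. *)

Require Import Defs.
From HB Require Import structures.
From mathcomp Require Import all_boot all_order all_algebra.
From mathcomp Require Import finmap generic_quotient ring_quotient.
From mathcomp Require Import boolp classical_sets reals constructive_ereal ereal.
From mathcomp Require Import perm ring lra zify.
From mathcomp.multinomials Require Import -(notations) mpoly.

Set Implicit Arguments.
Unset Strict Implicit.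
Unset Printing Implicit Defensive.

Import Order.TTheory GRing.Theory Num.Theory.
Local Open Scope ring_scope.

Local Notation "''X_' i" := (mpolyX _ (mnm1 i))
  (at level 8, i at level 2, format "''X_' i") : ring_scope.

(** * Linear dependence over a domain *)

(** The valuation ring of D = k[RR] is not Noetherian: finiteness over it has to come from
    determinants, and since an element of valuation 0 need not be a unit of D, such scalars are
    carried along until residues are taken.

    The algebra gr_sigma is reduced but need not be a domain, and in positive characteristic the
    extensions involved may be inseparable, so trace forms cannot bound denominators; counting
    degrees of numerators replaces them.

    Two filtrations of the Rees-like algebra have to be compared, one given by sigma and one by the
    Gauss valuation on D[x]. They agree only asymptotically. For this reason every estimate bounds
    the j-th power below by j mu - C with C independent of j: such bounds survive sums, products and
    roots, and C disappears when one divides by j. *)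

Lemma dep_domain (W : idomainType) m n (u : 'I_m -> 'I_n -> W) : (n < m)%N ->
  exists z : 'I_m -> W, (exists i, z i != 0) /\
    forall j, \sum_i z i * u i j = 0.
Proof.
elim: n m u => [|n IH] m u nm.
  by exists (fun=> 1); split=> [|[]//]; exists (Ordinal nm); exact: oner_neq0.
have [z0|/existsNP[i0 /eqP ui0]] := pselect (forall i, u i ord_max = 0).
  have [z [zn0 zu]] := IH m (fun i j => u i (widen_ord (leqnSn n) j)) (ltnW nm).
  exists z; split=> // j; have [jn|jn] := ltnP j n.
    have -> : j = widen_ord (leqnSn n) (Ordinal jn) by exact: val_inj.
    exact: zu.
  have -> : j = ord_max by apply: val_inj => /=; have := ltn_ord j; lia.
  by rewrite big1 // => i _; rewrite z0 mulr0.
case: m u nm i0 ui0 => [//|m] u nm i0 ui0.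
(* Division-free elimination: each other vector times the pivot [a], minus a multiple of [u i0], has
   last entry 0; the coefficient of [u i0] in the final relation is then forced. *)
pose a := u i0 ord_max.
have [z [[i1 zn0] zu]] := IH m (fun i j =>
  a * u (lift i0 i) (widen_ord (leqnSn n) j)
  - u (lift i0 i) ord_max * u i0 (widen_ord (leqnSn n) j)) nm.
exists (fun i => if unlift i0 i is Some i' then a * z i'
                 else - \sum_i' z i' * u (lift i0 i') ord_max).
split=> [|j].
  by exists (lift i0 i1); rewrite liftK mulf_neq0.
rewrite (bigD1_ord i0) //= unlift_none.
rewrite [X in _ + X](eq_bigr (fun i => a * z i * u (lift i0 i) j)) => [|i _]; last by rewrite liftK.
have [jn|jn] := ltnP j n.
  have -> : j = widen_ord (leqnSn n) (Ordinal jn) by exact: val_inj.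
  rewrite -[RHS](zu (Ordinal jn)) mulNr mulr_suml -sumrN -big_split /=.
  by apply: eq_bigr => i _; ring.
have -> : j = ord_max by apply: val_inj => /=; have := ltn_ord j; lia.
rewrite mulNr mulr_suml -sumrN -big_split /=.
by apply: big1 => i _; rewrite /a; ring.
Qed.

Lemma dep_domain_fin (W : idomainType) (I J : finType) (u : I -> J -> W) : (#|J| < #|I|)%N ->
  exists z : I -> W, (exists i, z i != 0) /\ forall j, \sum_i z i * u i j = 0.
Proof.
move=> JI; have [z [[i zi] zu]] :=
  dep_domain (fun (i : 'I_#|I|) (j : 'I_#|J|) => u (enum_val i) (enum_val j)) JI.
exists (fun i => z (enum_rank i)); split=> [|j].
  by exists (enum_val i); rewrite enum_valK.
rewrite -[RHS](zu (enum_rank j)) (reindex (@enum_val I I)) /=; last first.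
  by exists enum_rank => i' _; rewrite ?enum_valK ?enum_rankK.
by apply: eq_bigr => i' _; rewrite enum_valK enum_rankK.
Qed.

Section MaxIndependent.
Variables (P : idomainType) (M : comNzRingType) (th : {rmorphism P -> M}).

(** Besides U = 0, the case needed later is U = [pspan th e] with scalars from a smaller ring: rank
    over W modulo a span over {poly W}. *)
Definition pindep_mod (U : M -> Prop) N (e : 'I_N -> M) := forall p : 'I_N -> P,
  U (\sum_i th (p i) * e i) -> forall i, p i = 0.

Definition pindep := pindep_mod (fun u => u = 0).
Arguments pindep : clear implicits.

Definition pspan N (e : 'I_N -> M) (u : M) :=
  exists p : 'I_N -> P, u = \sum_i th (p i) * e i.

(** Take an independent family of maximal length. Adjoining u creates a relation, and its
    coefficient at u is nonzero because the family itself is independent. *)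
Lemma max_indep_mod (U S : M -> Prop) R :
    (forall u : 'I_R -> M, (forall i, S (u i)) -> ~ pindep_mod U u) ->
  exists N (e : 'I_N -> M), [/\ forall i, S (e i), pindep_mod U e &
    forall u, S u -> exists2 q, q != 0 & exists p : 'I_N -> P,
      U (th q * u - \sum_i th (p i) * e i)].
Proof.
move=> hR.
pose Q n := `[< exists e : 'I_n -> M, (forall i, S (e i)) /\ pindep_mod U e >].
have Q0 : exists n, Q n.
  by exists 0%N; apply/asboolP; exists (fun=> 0); split=> [[]//|p _ []].
have QR n : Q n -> (n <= R)%N.
  move=> /asboolP[e [eS ei]]; rewrite leqNgt; apply/negP => Rn.
  apply: (hR (fun i => e (widen_ord (ltnW Rn) i))) => [i|p hp i]; first exact: eS.
  pose p' (j : 'I_n) := if @insub nat (fun l => l < R)%N 'I_R j is Some i' then p i' else 0.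
  have p'E l (lR : (l < R)%N) (ln : (l < n)%N) : p' (Ordinal ln) = p (Ordinal lR).
    by rewrite /p' insubT.
  have p'0 (j : 'I_n) : (R <= j)%N -> p' j = 0.
    by move=> Rj; rewrite /p' insubF // ltnNge Rj.
  have <- : p' (widen_ord (ltnW Rn) i) = p i.
    by move: {+}i => -[i' iR]; rewrite -p'E ?(ltn_trans iR Rn) // => iN; congr (p' _); apply: val_inj.
  apply: ei; suff -> : \sum_i th (p' i) * e i = \sum_i th (p i) * e (widen_ord (ltnW Rn) i) by [].
  rewrite (bigID (fun j : 'I_n => (j < R)%N)) /= [X in _ + X]big1 ?addr0 => [|j].
    rewrite (big_ord_narrow (ltnW Rn)); apply: eq_bigr => -[j jR] _ /=.
    by rewrite -(p'E _ _ (leq_trans jR (ltnW Rn))); congr (th (p' _) * _); apply: val_inj.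
  by rewrite -leqNgt => /p'0 ->; rewrite rmorph0 mul0r.
have [N /asboolP[e [eS ei]] Nmax] := ex_maxnP Q0 QR.
exists N, e; split=> // u uS; apply: contrapT => hu.
suff : Q N.+1 by move=> /Nmax; rewrite ltnn.
apply/asboolP; exists (fun i => if unlift ord_max i is Some j then e j else u).
split=> [i|p]; first by case: unliftP.
rewrite big_ord_recr /= unlift_none.
rewrite (eq_bigr (fun i => th (p (lift ord_max i)) * e i)) => [hp|i _]; last first.
  rewrite (_ : widen_ord _ i = lift ord_max i) /= ?liftK //.
  by apply: val_inj; rewrite /= /bump leqNgt ltn_ord.
have pm : p ord_max = 0.
  apply: contrapT => /eqP pm; apply: hu; exists (p ord_max) => //.
  exists (fun i => - p (lift ord_max i)).
  under eq_bigr => i _ do rewrite rmorphN mulNr.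
  by rewrite sumrN opprK addrC.
move: hp; rewrite pm rmorph0 mul0r addr0 => hp i.
by case: (unliftP ord_max i) => [j ->|-> //]; exact: (ei _ hp).
Qed.

Lemma max_indep (S : M -> Prop) R :
    (forall u : 'I_R -> M, (forall i, S (u i)) -> ~ pindep R u) ->
  exists N (e : 'I_N -> M), [/\ forall i, S (e i), pindep N e &
    forall u, S u -> exists2 q, q != 0 & pspan e (th q * u)].
Proof.
move=> /max_indep_mod[N [e [eS ei hu]]]; exists N, e; split=> // u /hu[q q0 [p]].
by move=> /subr0_eq h; exists q => //; exists p.
Qed.

Lemma pspan_dep t (g : 'I_t -> M) (m : nat) (u : 'I_m -> M) : (t < m)%N ->
  (forall i, pspan g (u i)) -> ~ pindep m u.
Proof.
move=> tm /choice[p hp] ui.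
have [z [[i zi] zp]] := dep_domain p tm.
have := ui z; rewrite (_ : \sum_i _ = 0) => [/(_ erefl i)/eqP|]; first by rewrite (negPf zi).
under eq_bigr => j _ do rewrite hp mulr_sumr.
rewrite exchange_big big1 //= => l _.
under eq_bigr => j _ do rewrite mulrA -rmorphM.
by rewrite -mulr_suml -rmorph_sum /= zp rmorph0 mul0r.
Qed.

Lemma pspanD N (e : 'I_N -> M) u v : pspan e u -> pspan e v -> pspan e (u + v).
Proof.
move=> [p ->] [q ->]; exists (fun i => p i + q i).
by rewrite -big_split; apply: eq_bigr => i _; rewrite rmorphD mulrDl.
Qed.

Lemma pspan0 N (e : 'I_N -> M) : pspan e 0.
Proof. by exists (fun=> 0); rewrite big1 // => i _; rewrite rmorph0 mul0r. Qed.

Lemma pspanM N (e : 'I_N -> M) q u : pspan e u -> pspan e (th q * u).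
Proof.
move=> [p ->]; exists (fun i => q * p i).
by rewrite mulr_sumr; apply: eq_bigr => i _; rewrite rmorphM mulrA.
Qed.

Lemma pspan_sum N (e : 'I_N -> M) (I : Type) (r : seq I) (Q : pred I) F :
  (forall i, Q i -> pspan e (F i)) -> pspan e (\sum_(i <- r | Q i) F i).
Proof.
by move=> h; elim/big_ind: _ => //; [exact: pspan0|exact: pspanD].
Qed.

Lemma pspan_id N (e : 'I_N -> M) i : pspan e (e i).
Proof.
exists (fun j => (j == i)%:R); rewrite (bigD1 i) //= eqxx rmorph1 mul1r.
by rewrite big1 ?addr0 // => j /negPf ->; rewrite rmorph0 mul0r.
Qed.

End MaxIndependent.

(** * Noetherian modules over commuting operators *)

Section Operators.
Variables (k : fieldType) (V : lmodType k) (X : nat -> V -> V).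
Implicit Types (U E : V -> Prop) (n : nat).

(** A submodule over k[X_0, ..., X_(n-1)], the variables acting as operators. Since n is a mere
    parameter, Hilbert's theorem can be proved by induction on it without changing V. *)
Record opsub n U : Prop := OpSub {
  opsub0 : U 0;
  opsubD : forall u v, U u -> U v -> U (u + v);
  opsubZ : forall (c : k) u, U u -> U (c *: u);
  opsubX : forall i u, (i < n)%N -> U u -> U (X i u)
}.

Definition opspan n E (v : V) := forall U, opsub n U -> (forall e, E e -> U e) -> U v.

Definition opfg n U := exists s : seq V,
  (forall e, e \in s -> U e) /\ forall u, U u -> opspan n (fun e => e \in s) u.

Lemma opspan_sub n E : opsub n (opspan n E).
Proof.
split=> [U Us _|u v hu hv U Us EU|c u hu U Us EU|i u ilt hu U Us EU].
- exact: opsub0 Us.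
- by apply: (opsubD Us); [exact: hu|exact: hv].
- by apply: (opsubZ Us); exact: hu.
- by apply: (opsubX Us) => //; exact: hu.
Qed.

Lemma opspan_in n E e : E e -> opspan n E e.
Proof. by move=> Ee U _; exact. Qed.

Lemma opspan_mono n E E' v : (forall e, E e -> opspan n E' e) ->
  opspan n E v -> opspan n E' v.
Proof. by move=> h /(_ _ (opspan_sub n E')); exact. Qed.

Lemma opsubB n U u v : opsub n U -> U u -> U v -> U (u - v).
Proof. by move=> Us hu hv; rewrite -scaleN1r; apply: (opsubD Us) => //; exact: opsubZ Us _ _ hv. Qed.

Hypothesis XD : forall i u v, X i (u + v) = X i u + X i v.
Hypothesis XZ : forall i (c : k) u, X i (c *: u) = c *: X i u.
Hypothesis XC : forall i j u, X i (X j u) = X j (X i u).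

Lemma op0 i : X i 0 = 0.
Proof. by rewrite -(scale0r (0 : V)) XZ !scale0r. Qed.

Lemma iter_opD i n u v : iter n (X i) (u + v) = iter n (X i) u + iter n (X i) v.
Proof. by elim: n => //= n ->; rewrite XD. Qed.

Lemma iter_opZ i n c u : iter n (X i) (c *: u) = c *: iter n (X i) u.
Proof. by elim: n => //= n ->; rewrite XZ. Qed.

Lemma iter_opC i j n u : iter n (X i) (X j u) = X j (iter n (X i) u).
Proof. by elim: n => //= n ->; rewrite XC. Qed.

Lemma op_sum i (I : Type) (r : seq I) (P : pred I) (F : I -> V) :
  X i (\sum_(j <- r | P j) F j) = \sum_(j <- r | P j) X i (F j).
Proof. by apply: (big_morph (X i)) => //; exact: op0. Qed.

(** Subspaces of a finite-dimensional space: one element of U with a nonzero coefficient at the head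
    of s clears that coefficient in all others, which leaves them in the span of the tail. *)
Lemma opnoeth0 (s : seq V) U : opsub 0 U ->
  (forall u, U u -> opspan 0 (fun e => e \in s) u) -> opfg 0 U.
Proof.
elim: s U => [|x s IH] U Us hU.
  exists [::]; split=> // u /hU h W Ws _; apply: (h _ Ws) => e; by rewrite in_nil.
pose U0 v := U v /\ opspan 0 (fun e => e \in s) v.
have U0s : opsub 0 U0.
  have S := opspan_sub 0 (fun e => e \in s).
  split=> //.
  - by split; [exact: opsub0 Us|exact: opsub0 S].
  - by move=> u v [? ?] [? ?]; split; [exact: (opsubD Us)|exact: (opsubD S)].
  - by move=> c u [? ?]; split; [exact: (opsubZ Us)|exact: (opsubZ S)].
have [t [tU tspan]] := IH U0 U0s (fun u h => h.2).
pose W u := exists c, opspan 0 (fun e => e \in s) (u - c *: x).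
have dec u : U u -> W u.
  have S := opspan_sub 0 (fun e => e \in s).
  move=> /hU/(_ W); apply; first split=> //.
  - by exists 0; rewrite scale0r subr0; exact: opsub0 S.
  - move=> a b [c hc] [d hd]; exists (c + d).
    by rewrite scalerDl opprD addrACA; exact: (opsubD S).
  - by move=> c a [d hd]; exists (c * d); rewrite -scalerA -scalerBr; exact: (opsubZ S).
  move=> e; rewrite inE => /predU1P[->|es].
    by exists 1; rewrite scale1r subrr; exact: opsub0 S.
  by exists 0; rewrite scale0r subr0; exact: opspan_in.
have [h|] := pselect (forall u, U u -> U0 u).
  exists t; split=> [e /tU[]//|u /h]; exact: tspan.
move=> /existsNP[u0 /not_implyP[u0U u0n]].
have [c0 hc0] := dec _ u0U.
have c0n : c0 != 0.
  by apply/eqP => c00; apply: u0n; split=> //; move: hc0; rewrite c00 scale0r subr0.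
exists (u0 :: t); split=> [e|u uU].
  by rewrite inE => /predU1P[->//|/tU[]].
have [c hc] := dec _ uU.
have -> : u = (c / c0) *: u0 + (u - (c / c0) *: u0) by rewrite addrC subrK.
have S := opspan_sub 0 (fun e => e \in u0 :: t).
apply: (opsubD S).
  by apply: (opsubZ S); apply: opspan_in; rewrite inE eqxx.
apply: (@opspan_mono _ (fun e => e \in t)).
  by move=> e et; apply: opspan_in; rewrite inE et orbT.
apply: tspan; split; first by apply: (opsubB Us) => //; exact: (opsubZ Us).
have -> : u - (c / c0) *: u0 = (u - c *: x) - (c / c0) *: (u0 - c0 *: x).
  by rewrite scalerBr scalerA divfK // opprB addrA addrNK.
have S' := opspan_sub 0 (fun e => e \in s).
by apply: (opsubB S') => //; exact: (opsubZ S').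
Qed.

Lemma opspanS_expand n (s : seq V) v : opspan n.+1 (fun e => e \in s) v ->
  exists N (w : nat -> V), (forall i, opspan n (fun e => e \in s) (w i)) /\
    v = \sum_(i < N) iter i (X n) (w i).
Proof.
have S := opspan_sub n (fun e => e \in s).
pose W v := exists N (w : nat -> V), (forall i, opspan n (fun e => e \in s) (w i)) /\
    v = \sum_(i < N) iter i (X n) (w i).
move=> /(_ W); apply; first split.
- by exists 0%N, (fun=> 0); split=> [_|]; [exact: opsub0 S|rewrite big_ord0].
- move=> u u' [N [w [hw ->]]] [N' [w' [hw' ->]]].
  exists (maxn N N'), (fun i => (if (i < N)%N then w i else 0) + (if (i < N')%N then w' i else 0)).
  split=> [i|].
    by apply: (opsubD S); case: ifP => _ //; exact: opsub0 S.
  under [RHS]eq_bigr => i _ do rewrite iter_opD.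
  have it0 i : iter i (X n) 0 = 0 by elim: i => //= i ->; rewrite op0.
  rewrite big_split /=; congr (_ + _).
    rewrite (big_ord_widen _ (fun i => iter i (X n) (w i)) (leq_maxl N N')) big_mkcond.
    by apply: eq_bigr => i _; case: ifP.
  rewrite (big_ord_widen _ (fun i => iter i (X n) (w' i)) (leq_maxr N N')) big_mkcond.
  by apply: eq_bigr => i _; case: ifP.
- move=> c u [N [w [hw ->]]]; exists N, (fun i => c *: w i); split=> [i|].
    exact: (opsubZ S).
  by rewrite scaler_sumr; apply: eq_bigr => i _; rewrite iter_opZ.
- move=> i u; rewrite ltnS leq_eqVlt => /predU1P[->|ilt] [N [w [hw ->]]].
    exists N.+1, (fun i => if i is i'.+1 then w i' else 0); split=> [[|j]//|].
      exact: opsub0 S.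
    by rewrite big_ord_recl /= add0r op_sum.
  exists N, (fun j => X i (w j)); split=> [j|]; first exact: (opsubX S).
  by rewrite op_sum; apply: eq_bigr => j _; rewrite iter_opC.
move=> e es; exists 1%N, (fun=> e); rewrite big_ord1; split=> // i.
exact: opspan_in.
Qed.

(* Hilbert's basis theorem: [lead j] consists of the leading coefficients, as
   polynomials in the operator X n, of the elements of U of degree j. *)
Theorem opnoeth n (s : seq V) U : opsub n U ->
  (forall u, U u -> opspan n (fun e => e \in s) u) -> opfg n U.
Proof.
elim: n U => [|n IH] U Us hU; first exact: opnoeth0 hU.
pose V0 := opspan n (fun e => e \in s).
have S : opsub n V0 := opspan_sub n _.
pose Xn i v := iter i (X n) v.
pose lead j v := V0 v /\ exists w : nat -> V, (forall i, V0 (w i)) /\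
  U (Xn j v + \sum_(i < j) Xn i (w i)).
have lead_sub j : opsub n (lead j).
  split.
  - split; first exact: opsub0 S.
    exists (fun=> 0); split=> [_|]; first exact: opsub0 S.
    have it0 i : Xn i 0 = 0 by rewrite /Xn; elim: i => //= i ->; rewrite op0.
    by rewrite it0 big1 ?addr0 => [|i _]; [exact: opsub0 Us|rewrite it0].
  - move=> u v [u0 [w [hw hu]]] [v0 [w' [hw' hv]]]; split; first exact: (opsubD S).
    exists (fun i => w i + w' i); split=> [i|]; first exact: (opsubD S).
    rewrite /Xn iter_opD; under eq_bigr => i _ do rewrite iter_opD.
    by rewrite big_split addrACA; exact: (opsubD Us).
  - move=> c u [u0 [w [hw hu]]]; split; first exact: (opsubZ S).
    exists (fun i => c *: w i); split=> [i|]; first exact: (opsubZ S).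
    rewrite /Xn iter_opZ; under eq_bigr => i _ do rewrite iter_opZ.
    by rewrite -scaler_sumr -scalerDr; exact: (opsubZ Us).
  - move=> i u ilt [u0 [w [hw hu]]]; split; first exact: (opsubX S).
    exists (fun j => X i (w j)); split=> [j'|]; first exact: (opsubX S).
    rewrite /Xn iter_opC; under eq_bigr => j' _ do rewrite iter_opC.
    by rewrite -op_sum -XD; apply: (opsubX Us) => //; exact: ltnW.
have leadS j v : lead j v -> lead j.+1 v.
  move=> [v0 [w [hw hv]]]; split=> //.
  exists (fun i => if i is i'.+1 then w i' else 0); split=> [[|i]//|].
    exact: opsub0 S.
  rewrite big_ord_recl /= add0r -op_sum -XD.
  exact: (opsubX Us).
have lead_le i j v : (i <= j)%N -> lead i v -> lead j v.
  by move=> /subnK <-; elim: (j - i)%N => //= m IHm h; exact/leadS/IHm.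
pose lead_all v := exists j, lead j v.
have lead_all_sub : opsub n lead_all.
  split.
  - by exists 0%N; exact: opsub0 (lead_sub _).
  - move=> u v [i hu] [j hv]; exists (maxn i j); apply: (opsubD (lead_sub _)).
      exact: lead_le (leq_maxl _ _) hu.
    exact: lead_le (leq_maxr _ _) hv.
  - by move=> c u [i hu]; exists i; exact: (opsubZ (lead_sub _)).
  - by move=> i u il [j hu]; exists j; exact: (opsubX (lead_sub _)).
have [t [tl tspan]] := IH lead_all lead_all_sub (fun v h => let: ex_intro _ h' := h in h'.1).
(* The sets [lead j] increase with j, so the finitely many generators of their union occur at a
   common level J, after which nothing new appears. *)
have [J leadJ] : exists J, forall v, v \in t -> lead J v.
  elim: (t) tl => [|x t' IHt] h; first by exists 0%N.
  have [|J hJ] := IHt; first by move=> e et; apply: h; rewrite inE et orbT.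
  have [j hj] := h x (mem_head _ _).
  exists (maxn j J) => v; rewrite inE => /predU1P[->|/hJ].
    exact: lead_le (leq_maxl _ _) hj.
  exact: lead_le (leq_maxr _ _).
have lead_stab j v : lead j v -> lead J v.
  move=> h; have /tspan : lead_all v by exists j.
  by apply=> //; exact: lead_sub.
have /choice[g hg] : forall j, exists s : seq V, (forall e, e \in s -> lead j e) /\
    forall u, lead j u -> opspan n (fun e => e \in s) u.
  by move=> j; exact: (IH _ (lead_sub j) (fun v h => h.1)).
have /choice[lift hlift] : forall p : nat * V, exists u, lead p.1 p.2 ->
    U u /\ exists w : nat -> V, (forall i, V0 (w i)) /\
      u = Xn p.1 p.2 + \sum_(i < p.1) Xn i (w i).
  move=> [j v]; have [h|h] := pselect (lead j v); last by exists 0.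
  case: (h) => _ [w [hw hv]]; exists (Xn j v + \sum_(i < j) Xn i (w i)) => _.
  by split=> //; exists w.
pose E := flatten [seq [seq lift (j, e) | e <- g j] | j <- iota 0 J.+1].
have ES := opspan_sub n.+1 (fun e => e \in E).
exists E; split=> [e /flatten_mapP[j _ /mapP[e' /(proj1 (hg j)) h ->]]|].
  by case: (hlift (j, e') h).
have low j v : lead j v -> exists u, [/\ opspan n.+1 (fun e => e \in E) u, U u &
    exists w : nat -> V, (forall i, V0 (w i)) /\ u = Xn j v + \sum_(i < j) Xn i (w i)].
  pose W i u := exists z, [/\ opspan n.+1 (fun e => e \in E) z, U z &
      exists w : nat -> V, (forall i, V0 (w i)) /\ z = Xn i u + \sum_(i' < i) Xn i' (w i')].
  have base i u : (i <= J)%N -> lead i u -> W i u.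
    move=> iJ /(proj2 (hg i))/(_ (W i)); apply; first split.
    - exists 0; split; [exact: opsub0 ES|exact: opsub0 Us|].
      exists (fun=> 0); split=> [_|]; first exact: opsub0 S.
      have it0 l : Xn l 0 = 0 by rewrite /Xn; elim: l => //= l ->; rewrite op0.
      by rewrite it0 big1 ?addr0 // => l _; rewrite it0.
    - move=> a b [z [zE zU [w [hw zw]]]] [z' [zE' zU' [w' [hw' zw']]]].
      exists (z + z'); split; [exact: (opsubD ES)|exact: (opsubD Us)|].
      exists (fun i => w i + w' i); split=> [l|]; first exact: (opsubD S).
      rewrite /Xn iter_opD; under eq_bigr => l _ do rewrite iter_opD.
      by rewrite big_split zw zw' addrACA.
    - move=> c a [z [zE zU [w [hw zw]]]].
      exists (c *: z); split; [exact: (opsubZ ES)|exact: (opsubZ Us)|].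
      exists (fun i => c *: w i); split=> [l|]; first exact: (opsubZ S).
      rewrite /Xn iter_opZ; under eq_bigr => l _ do rewrite iter_opZ.
      by rewrite -scaler_sumr -scalerDr zw.
    - move=> l a ll [z [zE zU [w [hw zw]]]].
      exists (X l z); split; [by apply: (opsubX ES) => //; exact: ltnW|by apply: (opsubX Us) => //; exact: ltnW|].
      exists (fun j => X l (w j)); split=> [j'|]; first exact: (opsubX S).
      rewrite /Xn iter_opC; under eq_bigr => j' _ do rewrite iter_opC.
      by rewrite -op_sum -XD zw.
    move=> e eg; have [hU' hw] := hlift (i, e) (proj1 (hg i) _ eg).
    exists (lift (i, e)); split=> //; apply: opspan_in; apply/flatten_mapP; exists i.
      by rewrite mem_iota add0n ltnS.
    by apply/mapP; exists e.
  (* Above level J, realize the leading coefficient in degree J and multiply by a power of the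
     operator X n. *)
  have [jJ|Jj] := leqP j J; first exact: base.
  move=> /lead_stab /(base J _ (leqnn J))[z [zE zU [w [hw zw]]]].
  have {Jj} -> : j = (j - J + J)%N by rewrite subnK // ltnW.
  elim: (j - J)%N => [|m [z' [zE' zU' [w' [hw' zw']]]]]; first by exists z; split=> //; exists w.
  exists (X n z'); split; [exact: (opsubX ES)|exact: (opsubX Us)|].
  exists (fun i => if i is i'.+1 then w' i' else 0); split=> [[|i]//|].
    exact: opsub0 S.
  by rewrite addSn big_ord_recl /= add0r -op_sum -XD zw'.
move=> u uU; have [N [w [hw uw]]] := opspanS_expand (hU _ uU).
rewrite -/V0 in hw; elim: N w hw u uU uw => [|N IHN] w hw u uU uw.
  by rewrite uw big_ord0; exact: opsub0 ES.
have [|z [zE zU [w' [hw' zw]]]] := low N (w N).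
  by split=> //; exists w; split=> //; move: uU; rewrite uw big_ord_recr /= addrC.
rewrite -(subrK z u); apply: (opsubD ES) => //.
apply: (IHN (fun i => w i - w' i)) => [i||]; first exact: (opsubB S).
  exact: (opsubB Us).
rewrite uw zw big_ord_recr /= [X in X - _]addrC opprD addrACA subrr add0r -sumrB.
apply: eq_bigr => i _; by rewrite /Xn iter_opD -[- w' i]scaleN1r iter_opZ scaleN1r.
Qed.

End Operators.

(** * Common denominators of reduced integral extensions *)

Section SizeBound.
Variable W : idomainType.
Implicit Types p q : {poly W}.

(** The bound is an integer and holds for p = 0 whatever its sign: degrees of fractions will be
    negative. *)
Definition size_le (n : int) p := p != 0 -> (size p)%:Z <= n.

Lemma size_le0 n : size_le n 0.
Proof. by move/eqP. Qed.

Lemma size_leW m n p : m <= n -> size_le m p -> size_le n p.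
Proof. by move=> mn h /h; lia. Qed.

Lemma size_leD n p q : size_le n p -> size_le n q -> size_le n (p + q).
Proof.
move=> hp hq; have [->|p0] := eqVneq p 0; first by rewrite add0r.
have [->|q0] := eqVneq q 0; first by rewrite addr0.
by move=> _; have := size_polyD p q; have := hp p0; have := hq q0; lia.
Qed.

Lemma size_le_sum n (I : Type) (r : seq I) (P : pred I) F :
  (forall i, P i -> size_le n (F i)) -> size_le n (\sum_(i <- r | P i) F i).
Proof.
move=> h; elim/big_ind: _ => //; [exact: size_le0|by move=> p q; exact: size_leD].
Qed.

Lemma size_leM m n p q : size_le m p -> size_le n q -> size_le (m + n - 1) (p * q).
Proof.
move=> hp hq; rewrite /size_le mulf_eq0 negb_or => /andP[p0 q0].
rewrite size_mul //; have := hp p0; have := hq q0.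
have : (0 < size p)%N by rewrite size_poly_gt0.
by lia.
Qed.

Lemma size_leP n p : size_le n p <-> (forall i : nat, n <= i%:Z -> p`_i = 0).
Proof.
split=> [h i ni|h p0].
  have [->|p0] := eqVneq p 0; first by rewrite coef0.
  by apply/leq_sizeP: (leqnn i); have := h p0; lia.
have sp : (0 < size p)%N by rewrite size_poly_gt0.
rewrite leNgt; apply/negP => np.
have : lead_coef p = 0 by rewrite /lead_coef h //; lia.
by move/eqP; rewrite lead_coef_eq0 (negPf p0).
Qed.

End SizeBound.

Section Direction.
Variables (W : idomainType) (M : comNzRingType) (th : {rmorphism {poly W} -> M}).
Hypothesis tf : forall q u, th q * u = 0 -> q = 0 \/ u = 0.
Hypothesis red : forall (u : M) n, u ^+ n = 0 -> u = 0.
Hypothesis integ : forall u, exists N (a : 'I_N -> {poly W}),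
  u ^+ N = \sum_i th (a i) * u ^+ i.
Variables (r : nat) (e : 'I_r -> M).
Hypothesis ei : pindep th e.
Hypothesis es : forall u, exists2 q : {poly W}, q != 0 & pspan th e (th q * u).

(* [dle n u]: in the coordinates of u along e, the degree of the numerators
   exceeds that of the common denominator by at most n. *)
Definition dle (n : int) (u : M) := exists (q : {poly W}) (p : 'I_r -> {poly W}),
  [/\ q != 0, th q * u = \sum_j th (p j) * e j &
      forall j, size_le ((size q)%:Z + n) (p j)].

Lemma coord_inj (p p' : 'I_r -> {poly W}) :
  \sum_j th (p j) * e j = \sum_j th (p' j) * e j -> forall j, p j = p' j.
Proof.
move=> /eqP; rewrite -subr_eq0 -sumrB => /eqP h j; apply/eqP; rewrite -subr_eq0.
apply/eqP; apply: (ei (p := fun j => p j - p' j)); rewrite -[RHS]h.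
by apply: eq_bigr => l _; rewrite rmorphB mulrBl.
Qed.

Lemma common_den (I : finType) (u : I -> M) : exists q : {poly W}, [/\ q != 0 &
  forall i, pspan th e (th q * u i)].
Proof.
have /choice[q hq] : forall i, exists q : {poly W}, q != 0 /\ pspan th e (th q * u i).
  by move=> i; have [q ? ?] := es (u i); exists q.
exists (\prod_i q i); split=> [|i]; first by rewrite prodf_seq_neq0; apply/allP => i _; exact: (proj1 (hq i)).
rewrite (bigD1 i) //= [q i * _]mulrC rmorphM -mulrA; apply: pspanM; exact: (proj2 (hq i)).
Qed.

(** Only the structure constants matter: [c] is a common denominator of the products of the e_i, and
    [a] bounds the sizes of their numerators. *)
Lemma dle_mul : exists a : nat, forall n m u v, dle n u -> dle m v -> dle (n + m + a%:Z) (u * v).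
Proof.
have [c [c0 hc]] := common_den (fun ij : 'I_r * 'I_r => e ij.1 * e ij.2).
have /choice[t ht] := hc.
pose a := \max_ij \max_l size (t ij l).
have ta ij l : size_le a%:Z (t ij l).
  move=> _; rewrite lez_nat; apply: leq_trans (leq_bigmax ij).
  exact: (leq_bigmax l).
exists a => n m u v [q [p [q0 hu pn]]] [q' [p' [q'0 hv p'm]]].
exists (q * q' * c), (fun l => \sum_i \sum_j p i * p' j * t (i, j) l); split.
- by rewrite !mulf_neq0.
- transitivity (th c * ((th q * u) * (th q' * v))); first by rewrite !rmorphM; ring.
  rewrite hu hv mulr_suml mulr_sumr.
  under [RHS]eq_bigr => l _ do rewrite rmorph_sum mulr_suml.
  rewrite exchange_big /=; apply: eq_bigr => i _.
  under [RHS]eq_bigr => l _ do rewrite rmorph_sum mulr_suml.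
  rewrite exchange_big /= mulr_sumr mulr_sumr; apply: eq_bigr => j _.
  transitivity (th (p i * p' j) * (th c * (e i * e j))); first by rewrite rmorphM; ring.
  rewrite (ht (i, j)) mulr_sumr; apply: eq_bigr => l _.
  by rewrite [in RHS]rmorphM mulrA.
- move=> l; apply: size_le_sum => i _; apply: size_le_sum => j _.
  apply: size_leW (size_leM (size_leM (pn i) (p'm j)) (ta (i, j) l)).
  rewrite !size_mul ?mulf_neq0 //.
  have : (0 < size c)%N by rewrite size_poly_gt0.
  have : (0 < size q)%N by rewrite size_poly_gt0.
  have : (0 < size q')%N by rewrite size_poly_gt0.
  lia.
Qed.

(** An integral equation expresses every power through the first N ones without introducing
    denominators. *)
Lemma pow_den u : exists2 c : {poly W}, c != 0 & forall l, pspan th e (th c * u ^+ l).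
Proof.
have [N [a ha]] := integ u.
have [c [c0 hc]] := common_den (fun i : 'I_N => u ^+ i).
exists c => // l; elim/ltn_ind: l => l IH.
have [lN|Nl] := ltnP l N; first exact: (hc (Ordinal lN)).
rewrite -(subnKC Nl) exprD ha mulr_suml mulr_sumr; apply: pspan_sum => i _.
have -> : th c * (th (a i) * u ^+ i * u ^+ (l - N)) = th (a i) * (th c * u ^+ (i + (l - N))).
  by rewrite exprD; ring.
by apply: pspanM; apply: IH; have := ltn_ord i; lia.
Qed.

(* Since u is integral, the denominators of its powers stay bounded, while a
   very negative degree would go to -oo along the powers. *)
Lemma dle_neg0 (a : nat) :
    (forall n m u v, dle n u -> dle m v -> dle (n + m + a%:Z) (u * v)) ->
  forall u, dle (- a%:Z - 1) u -> u = 0.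
Proof.
move=> ha u hu; have [c c0 hc] := pow_den u.
have hpow l : dle (- a%:Z - l.+1%:Z) (u ^+ l.+1).
  elim: l => [|l IH]; first by rewrite expr1.
  rewrite exprS (_ : - a%:Z - l.+2%:Z = - a%:Z - 1 + (- a%:Z - l.+1%:Z) + a%:Z); last by lia.
  exact: ha.
(* At this exponent the numerators fall short of the denominator q by more than the size of c. In c
   p_j = q b_j this leaves no room for a nonzero b_j. *)
apply: (red (n := (size c).+1)).
have [q [p [q0 hq hp]]] := hpow (size c); have [b hb] := hc (size c).+1.
have E j : c * p j = q * b j.
  apply: (coord_inj (p := fun j => c * p j) (p' := fun j => q * b j)).
  transitivity (th c * (th q * u ^+ (size c).+1)).
    by rewrite hq mulr_sumr; apply: eq_bigr => i _; rewrite rmorphM mulrA.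
  transitivity (th q * (th c * u ^+ (size c).+1)); first by ring.
  by rewrite hb mulr_sumr; apply: eq_bigr => i _; rewrite rmorphM mulrA.
have b0 j : b j = 0.
  apply: contrapT => /eqP bj.
  have pj : p j != 0.
    by apply/eqP => pj; have /eqP := E j; rewrite pj mulr0 eq_sym mulf_eq0 (negPf q0) (negPf bj).
  have := congr1 (fun x : {poly W} => size x) (E j); rewrite !size_mul //.
  have := hp j pj; have : (0 < size q)%N by rewrite size_poly_gt0.
  have : (0 < size (b j))%N by rewrite size_poly_gt0.
  lia.
have : th c * u ^+ (size c).+1 = 0.
  by rewrite hb big1 // => j _; rewrite b0 rmorph0 mul0r.
by case/tf => [/eqP|//]; rewrite (negPf c0).
Qed.

(** A count of unknowns. To r a + 1 vectors v, with numerators of size at most B, add the r (B + 1)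
    elements X^l e_j with l <= B. Making a combination over W have degree at most - a - 1 means
    killing B + a + 1 coefficients in each of the r coordinates, one condition fewer than there are
    vectors. The resulting nontrivial combination vanishes by [dle_neg0], which is impossible if v
    is independent modulo the span of e. *)
Lemma dle_bound : exists S : nat, forall v : 'I_S -> M,
  ~ pindep_mod (th \o polyC) (pspan th e) v.
Proof.
have [a ha] := dle_mul; have neg := dle_neg0 ha.
exists (r * a).+1 => v vi.
have [q' [q'0 hq']] := common_den v.
(* The extra factor keeps the indices of the B + a + 1 top coefficients positive, so that no
   subtraction of natural numbers truncates. *)
pose q : {poly W} := q' * 'X^(a.+1).
have q0 : q != 0 by rewrite mulf_neq0 // -size_poly_gt0 size_polyXn.
have /choice[p hp] : forall l, pspan th e (th q * v l).
  by move=> l; rewrite /q [q' * _]mulrC rmorphM -mulrA; exact: pspanM.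
have qa : (a.+1 < size q)%N.
  rewrite size_mul // ?size_polyXn; last by rewrite -size_poly_gt0 size_polyXn.
  have : (0 < size q')%N by rewrite size_poly_gt0.
  by lia.
clearbody q.
pose B := \max_l \max_j size (p l j).
have pB l j : (size (p l j) <= B)%N.
  by apply: leq_trans (leq_bigmax l); exact: (leq_bigmax j).
pose I := ('I_(r * a).+1 + 'I_r * 'I_B.+1)%type.
pose J := ('I_r * 'I_(B + a).+1)%type.
pose num (i : I) (j : 'I_r) : {poly W} := match i with
  | inl l => p l j
  | inr jl => if jl.1 == j then 'X^(jl.2) * q else 0 end.
pose vec (i : I) : M := match i with inl l => v l | inr jl => th 'X^(jl.2) * e jl.1 end.
have numE i : th q * vec i = \sum_j th (num i j) * e j.
  case: i => [l|[j l]] /=; first exact: hp.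
  rewrite (bigD1 j) //= eqxx big1 ?addr0 => [|j' /negPf j'j].
    by rewrite rmorphM -mulrA mulrCA.
  by rewrite [j == j']eq_sym j'j rmorph0 mul0r.
have card : (#|{: J}| < #|{: I}|)%N.
  rewrite card_sum !card_prod !card_ord; lia.
have [z [[i zi] hz]] := dep_domain_fin
  (fun (i : I) (j : J) => (num i j.1)`_(size q + B - j.2.+1)) card.
have num_top i' j : size_le ((size q)%:Z + B%:Z) (num i' j).
  case: i' => [l|[j' l]] /=.
    by move=> _; have := pB l j; lia.
  case: eqP => _; last exact: size_le0.
  move=> _; rewrite mulrC size_mulXn // -PoszD lez_nat addnC leq_add2l -ltnS.
  exact: ltn_ord.
have u0 : \sum_i' th (z i')%:P * vec i' = 0.
  apply: neg; exists q, (fun j => \sum_i' (z i')%:P * num i' j); split=> [//||j1].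
    rewrite mulr_sumr; under [RHS]eq_bigr => j0 _ do rewrite rmorph_sum mulr_suml.
    rewrite exchange_big; apply: eq_bigr => i' _ /=.
    rewrite mulrCA numE mulr_sumr; apply: eq_bigr => j _.
    by rewrite rmorphM mulrA.
  apply/size_leP => s hs; rewrite coef_sum.
  have [sB|sB] := leqP (size q + B) s.
    apply: big1 => i' _; rewrite coefCM.
    have /size_leP -> := num_top i' j1; first by rewrite mulr0.
    lia.
  have lt : (size q + B - s.+1 < (B + a).+1)%N by lia.
  rewrite -[RHS](hz (j1, Ordinal lt)); apply: eq_bigr => i' _.
  rewrite coefCM /=; congr (_ * _`_ _).
  by rewrite subnSK // subKn // ltnW.
have zl l : z (inl l) = 0.
  apply: (vi (fun l => z (inl l))).
  have : \sum_l th (z (inl l))%:P * v l = - \sum_jl th (z (inr jl))%:P * vec (inr jl).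
    by apply/eqP; rewrite -addr_eq0; move: u0; rewrite big_sumType /= => ->.
  move=> -> /=; rewrite -sumrN; apply: pspan_sum => -[j0 l'] _ /=.
  rewrite -mulrN -mulrN mulrA -rmorphM mulrN.
  have -> : - (th ((z (inr (j0, l')))%:P * 'X^l') * e j0) = th (- ((z (inr (j0, l')))%:P * 'X^l')) * e j0.
    by rewrite rmorphN mulNr.
  exact/pspanM/pspan_id.
have zr j l : z (inr (j, l)) = 0.
  move: u0; rewrite big_sumType /= big1 ?add0r => [|l' _]; last by rewrite zl rmorph0 mul0r.
  rewrite (eq_bigr (fun jl => th (z (inr (jl.1, jl.2)))%:P * (th 'X^(jl.2) * e jl.1))) => [|[]//].
  rewrite -(pair_bigA _ (fun j l => th (z (inr (j, l)))%:P * (th 'X^l * e j))) /=.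
  under eq_bigr => j' _.
    under eq_bigr => l' _ do rewrite mulrA -rmorphM.
    rewrite -mulr_suml -rmorph_sum; over.
  move=> /ei/(_ j)/(congr1 (fun x : {poly W} => x`_l)).
  rewrite coef0 coef_sum (bigD1 l) //= coefCM coefXn eqxx mulr1 big1 ?addr0 // => l' l'l.
  rewrite coefCM coefXn; case: eqP => [h|]; last by rewrite mulr0.
  by case/eqP: l'l; apply: val_inj.
by case: i zi => [l|[j l]]; rewrite ?zl ?zr eqxx.
Qed.

(** The denominators of all elements are bounded in the distinguished variable; only the factor z,
    free of that variable, depends on u. Here [c] is a common denominator of a maximal family that
    is independent over W modulo the span of e. *)
Lemma direction_den : exists2 c : {poly W}, c != 0 &
  forall u, exists2 z : W, z != 0 & pspan th e (th (z%:P * c) * u).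
Proof.
have [S hS] := dle_bound.
have [t [v [_ vi hv]]] := @max_indep_mod _ _ (th \o polyC) (pspan th e) (fun=> True) S (fun u _ => hS u).
have [c [c0 hc]] := common_den v.
exists c => // u; have [z z0 [p hp]] := hv u I; exists z => //.
rewrite -[th _ * u](subrK (\sum_i th c * ((th \o polyC) (p i) * v i))) /=.
apply: pspanD.
  rewrite -mulr_sumr rmorphM -mulrA mulrCA -mulrBr.
  exact: pspanM.
by apply: pspan_sum => i _; rewrite mulrCA; exact: pspanM.
Qed.

End Direction.

(** * Polynomials viewed in one distinguished variable *)

Section MpolyMisc.

Lemma mpoly_rmorph_ext n (R : nzRingType) (S : comNzRingType) (f g : {rmorphism mpoly n R -> S}) :
  (forall c, f (mpolyC n c) = g (mpolyC n c)) -> (forall i, f 'X_i = g 'X_i) ->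
  forall p, f p = g p.
Proof.
move=> fgC fgX p; rewrite (mpolyE p) !rmorph_sum; apply: eq_bigr => m _.
rewrite -mul_mpolyC !rmorphM fgC mpolyXE_id !rmorph_prod; congr (_ * _).
by apply: eq_bigr => i _; rewrite !rmorphXn fgX.
Qed.

Lemma mpoly_eval n (R S : comNzRingType) (f : {rmorphism R -> S}) (h : 'I_n -> S) :
  {g : {rmorphism mpoly n R -> S} | forall c, g (mpolyC n c) = f c & forall i, g 'X_i = h i}.
Proof.
by exists (mmap f h) => [c|i]; rewrite /= ?mmapC ?mmapX ?mmap1U.
Qed.

Variables (k : idomainType) (d : nat) (i : 'I_d.+1).
Local Notation Z := (mpoly d.+1 k).
Local Notation W := (mpoly d k).

Definition free_var (p : Z) := forall m, m \in msupp p -> m i = 0%N.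

Lemma free_varC c : free_var (mpolyC _ c).
Proof. by move=> m; rewrite msuppC; case: eqP => // _; rewrite inE => /eqP ->; rewrite mnm0E. Qed.

Lemma free_varD p q : free_var p -> free_var q -> free_var (p + q).
Proof. by move=> hp hq m /msuppD_le; rewrite mem_cat => /orP[/hp|/hq]. Qed.

Lemma free_varM p q : free_var p -> free_var q -> free_var (p * q).
Proof.
move=> hp hq m /msuppM_le /allpairsP[[m1 m2] /= [/hp h1 /hq h2 ->]].
by rewrite mnmDE h1 h2.
Qed.

Lemma free_varX j : free_var 'X_(lift i j).
Proof.
by move=> m /mem_msuppXP <-; rewrite mnm1E eq_sym (negPf (neq_lift i j)).
Qed.

Definition insert_var : {rmorphism W -> Z} :=
  s2val (mpoly_eval (@mpolyC d.+1 k) (fun j => 'X_(lift i j))).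

Lemma insert_varC c : insert_var (mpolyC _ c) = mpolyC _ c.
Proof. exact: (s2valP (mpoly_eval (@mpolyC d.+1 k) (fun j => 'X_(lift i j)))). Qed.

Lemma insert_varX j : insert_var 'X_j = 'X_(lift i j).
Proof. exact: (s2valP' (mpoly_eval (@mpolyC d.+1 k) (fun j => 'X_(lift i j)))). Qed.

Lemma insert_var_free z : free_var (insert_var z).
Proof.
have fv1 : free_var 1 by have := @free_varC 1; rewrite mpolyC1.
rewrite (mpolyE z) rmorph_sum; elim/big_ind: _ => [|p q|m _].
- by have := @free_varC 0; rewrite mpolyC0.
- exact: free_varD.
- rewrite -mul_mpolyC rmorphM insert_varC; apply: free_varM; first exact: free_varC.
  rewrite mpolyXE_id rmorph_prod; elim/big_ind: _ => [|p q|j _]; [exact: fv1|exact: free_varM|].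
  rewrite rmorphXn insert_varX; elim: (m j) => [|l IH]; first exact: fv1.
  by rewrite exprS; apply: free_varM => //; exact: free_varX.
Qed.

Lemma of_main_var_ex : {g : {rmorphism {poly W} -> Z} |
  forall z, g z%:P = insert_var z & g 'X = 'X_i}.
Proof.
exists (horner_eval ('X_i : Z) \o map_poly insert_var) => [z|] /=.
  by rewrite /horner_eval map_polyC hornerC.
by rewrite /horner_eval map_polyX hornerX.
Qed.

Definition of_main_var : {rmorphism {poly W} -> Z} := s2val of_main_var_ex.

Lemma of_main_varC z : of_main_var z%:P = insert_var z.
Proof. exact: (s2valP of_main_var_ex). Qed.

Lemma of_main_varX : of_main_var 'X = 'X_i.
Proof. exact: (s2valP' of_main_var_ex). Qed.

Let to_main_var_ex := mpoly_eval (polyC \o @mpolyC d k : {rmorphism k -> {poly W}})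
  (fun l => if unlift i l is Some j then ('X_j : W)%:P else 'X).

Definition to_main_var : {rmorphism Z -> {poly W}} := s2val to_main_var_ex.

Lemma to_main_varC c : to_main_var (mpolyC _ c) = (mpolyC _ c)%:P.
Proof. exact: (s2valP to_main_var_ex). Qed.

Lemma to_main_varX l :
  to_main_var 'X_l = if unlift i l is Some j then ('X_j : W)%:P else 'X.
Proof. exact: (s2valP' to_main_var_ex). Qed.

Lemma to_main_varK : cancel to_main_var of_main_var.
Proof.
move=> p; apply: (@mpoly_rmorph_ext _ _ _ (of_main_var \o to_main_var) idfun) => [c|l] /=.
  by rewrite to_main_varC of_main_varC insert_varC.
rewrite to_main_varX; case: unliftP => [j ->|->].
  by rewrite of_main_varC insert_varX.
exact: of_main_varX.
Qed.

Lemma of_main_varK : cancel of_main_var to_main_var.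
Proof.
have h z : to_main_var (insert_var z) = z%:P.
  apply: (@mpoly_rmorph_ext _ _ _ (to_main_var \o insert_var) polyC) => [c|l] /=.
    by rewrite insert_varC to_main_varC.
  by rewrite insert_varX to_main_varX liftK.
elim/poly_ind => [|p c IH]; first by rewrite !rmorph0.
by rewrite 2!rmorphD 2!rmorphM IH of_main_varC h of_main_varX to_main_varX unlift_none.
Qed.

End MpolyMisc.

(** The multiplier z does not involve X_i, so comparing i-th exponents of leading monomials, for
    each i in turn, shows that the leading monomial of q divides that of p. Subtracting the leading
    quotient preserves the hypothesis, and the monomial order is well founded. *)
Lemma mpoly_dvd_free (k : fieldType) d (q p : mpoly d k) : q != 0 ->
    (forall i, exists z p' : mpoly d k,
      [/\ z != 0, (forall m, m \in msupp z -> m i = 0%N) & z * p = q * p']) ->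
  exists a, p = q * a.
Proof.
move=> q0; move Em : (mlead p) => m0.
elim/(well_founded_ind (@ltom_wf d)): m0 p Em => m0 IH p Em hp.
have [->|p0] := eqVneq p 0; first by exists 0; rewrite mulr0.
have qp : lem (mlead q) (mlead p).
  apply/mnm_lepP => i; have [z [p' [z0 zi zp]]] := hp i.
  have p'0 : p' != 0 by apply/eqP => p'0; move/eqP: zp; rewrite p'0 mulr0 mulf_eq0 (negPf z0) (negPf p0).
  have := congr1 (fun x => mlead x i) zp; rewrite !mleadM // !mnmDE (zi _ (mlead_supp z0)) add0n => ->.
  exact: leq_addr.
pose m1 := mnm_sub (mlead p) (mlead q).
pose c := mcoeff (mlead p) p / mcoeff (mlead q) q.
pose t : mpoly d k := c *: mpolyX k m1.
have cq : c * mcoeff (mlead q) q = mcoeff (mlead p) p.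
  by rewrite /c divfK // mleadc_eq0.
have c0 : c != 0 by rewrite /c mulf_neq0 ?invr_eq0 ?mleadc_eq0.
have t0 : t != 0 by rewrite scaler_eq0 (negPf c0) -msupp_eq0 msuppX.
have lt : mlead t = m1 by rewrite mleadZ_proper ?mleadXm // mcoeffX eqxx mulr1.
have lqt : mlead (q * t) = mlead p by rewrite mleadM // lt addmC submK.
have [E|pn] := eqVneq (p - q * t) 0; first by exists t; apply/eqP; rewrite -subr_eq0 E.
have [||a ha] := IH (mlead (p - q * t)) _ (p - q * t) erefl.
- rewrite -Em; rewrite lt_neqAle; apply/andP; split; last first.
    by apply: le_trans (mleadB_le _ _) _; rewrite lqt joinxx.
  apply/eqP => h; have := mleadc_eq0 (p - q * t); rewrite (negPf pn) h mcoeffB.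
  rewrite -[X in mcoeff X (q * t)]lqt mleadM // mleadcM lt.
  by rewrite mcoeffZ mcoeffX eqxx mulr1 mulrC cq subrr eqxx.
- move=> i; have [z [p' [z0 zi zp]]] := hp i; exists z, (p' - z * t); split=> //.
  by rewrite mulrBr zp mulrBr; congr (_ - _); ring.
by exists (t + a); rewrite mulrDr -ha addrC subrK.
Qed.

Section ReducedIntegral.
Variables (k : fieldType) (d : nat) (M : comNzRingType) (th : {rmorphism mpoly d k -> M}).
Hypothesis tf : forall q u, th q * u = 0 -> q = 0 \/ u = 0.
Hypothesis red : forall (u : M) n, u ^+ n = 0 -> u = 0.
Hypothesis integ : forall u, exists N (a : 'I_N -> mpoly d k),
  u ^+ N = \sum_i th (a i) * u ^+ i.
Variable R : nat.
Hypothesis rank : forall u : 'I_R -> M, ~ pindep th u.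

Lemma main_var_den r (e : 'I_r -> M) i :
    pindep th e -> (forall u, exists2 q, q != 0 & pspan th e (th q * u)) ->
  exists2 c, c != 0 & forall u, exists z, [/\ z != 0,
    (forall m, m \in msupp z -> m i = 0%N) & pspan th e (th (z * c) * u)].
Proof.
case: d th tf integ i => [|d'] th' tf' integ' i; first by case: i.
move=> ei es; pose g := of_main_var k i; pose thi := th' \o g.
have span_g u : pspan thi e u -> pspan th' e u.
  by move=> [p ->]; exists (fun j => g (p j)).
have span_h u : pspan th' e u -> pspan thi e u.
  move=> [p ->]; exists (fun j => to_main_var k i (p j)).
  by apply: eq_bigr => j _; rewrite /thi /= to_main_varK.
have g0 p : g p = 0 -> p = 0 by move=> h; rewrite -[p](of_main_varK i) -/g h rmorph0.
have [|u|p hp j|u|c c0 hc] := @direction_den _ _ thi _ red _ r e _ _.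
- by move=> q u /tf'[/g0|]; [left|right].
- have [N [a ha]] := integ' u; exists N, (fun j => to_main_var k i (a j)).
  by rewrite ha; apply: eq_bigr => j _; rewrite /thi /= to_main_varK.
- exact/g0/(ei (fun j => g (p j))).
- have [q q0 hq] := es u; exists (to_main_var k i q).
    by apply: contra_neq q0 => q0; rewrite -[q](to_main_varK i) q0 rmorph0.
  by apply: span_h; rewrite /thi /= to_main_varK.
exists (g c) => [|u]; first by apply: contra_neq c0; exact: g0.
have [z z0 hz] := hc u; exists (g z%:P); split.
- by apply: contra_neq z0 => /g0/eqP; rewrite polyC_eq0 => /eqP.
- by rewrite /g of_main_varC; exact: insert_var_free.
- by rewrite -rmorphM; exact: span_g.
Qed.

(** The product of the denominators of the separate directions works: the coordinates p / q of c u
    admit, for each i, a denominator free of X_i, and then [mpoly_dvd_free] makes q divide p. *)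
Theorem finite_den : exists r (e : 'I_r -> M), pindep th e /\
  exists2 c, c != 0 & forall u, pspan th e (th c * u).
Proof.
have [r [e [_ ei es']]] := @max_indep _ _ th (fun=> True) R (fun u _ => @rank u).
have es u := es' u I.
exists r, e; split=> //.
have /choice[c hc] : forall i, exists c, c != 0 /\ forall u, exists z, [/\ z != 0,
    (forall m, m \in msupp z -> m i = 0%N) & pspan th e (th (z * c) * u)].
  by move=> i; have [c ? ?] := main_var_den i ei es; exists c.
exists (\prod_i c i) => [|u].
  by rewrite prodf_seq_neq0; apply/allP => i _; exact: (proj1 (hc i)).
set u' := th _ * u; have [q q0 [p hp]] := es u'.
have cinj (a b : 'I_r -> mpoly d k) :
    \sum_j th (a j) * e j = \sum_j th (b j) * e j -> forall j, a j = b j.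
  move=> /eqP; rewrite -subr_eq0 -sumrB => /eqP h j; apply/eqP; rewrite -subr_eq0.
  apply/eqP; apply: (ei (fun j => a j - b j)); rewrite -[RHS]h.
  by apply: eq_bigr => l _; rewrite rmorphB mulrBl.
have /choice[a ha] : forall j, exists a, p j = q * a.
  move=> j; apply: mpoly_dvd_free => // i.
  have [z [z0 zi hz]] := (proj2 (hc i)) u.
  have [p' hp'] : pspan th e (th z * u').
    rewrite /u' (bigD1 i) //= mulrA -rmorphM mulrA [X in th X]mulrC rmorphM -mulrA.
    exact: pspanM.
  exists z, (p' j); split=> //.
  apply: (cinj (fun j => z * p j) (fun j => q * p' j)).
  transitivity (th z * (th q * u')).
    by rewrite hp mulr_sumr; apply: eq_bigr => l _; rewrite rmorphM mulrA.
  rewrite mulrCA hp' mulr_sumr; apply: eq_bigr => l _.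
  by rewrite rmorphM mulrA.
exists a; apply/eqP; rewrite -subr_eq0; apply/eqP.
have : th q * (u' - \sum_j th (a j) * e j) = 0.
  rewrite mulrBr hp mulr_sumr -sumrB big1 // => j _.
  by rewrite ha rmorphM mulrA subrr.
by case/tf => // /eqP; rewrite (negPf q0).
Qed.

End ReducedIntegral.

(** * Valuations and Gauss valuations *)

Lemma seq_max disp (T : orderType disp) (s : seq T) (Q : T -> Prop) :
  (exists2 x, x \in s & Q x) ->
  exists x, [/\ x \in s, Q x & forall y, y \in s -> Q y -> (y <= x)%O].
Proof.
elim: s => [[]//|z s IH [x]]; rewrite inE => xs Qx.
have [h|h] := pselect (exists2 x, x \in s & Q x); last first.
  have {xs} xz : x = z by case/predU1P: xs => // xs; case: h; exists x.
  exists x; split=> // [|y]; first by rewrite inE xz eqxx.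
  by rewrite inE => /predU1P[->|ys Qy]; [rewrite xz|case: h; exists y].
have [m [ms Qm mmax]] := IH h.
have [Qz|Qz] := pselect (Q z); last first.
  exists m; split=> // [|y]; first by rewrite inE ms orbT.
  by rewrite inE => /predU1P[-> //|]; exact: mmax.
have [zm|mz] := leP z m.
  exists m; split=> // [|y]; first by rewrite inE ms orbT.
  by rewrite inE => /predU1P[-> //|]; exact: mmax.
exists z; split=> // [|y]; first exact: mem_head.
by rewrite inE => /predU1P[-> //|ys Qy]; apply: le_trans (mmax _ ys Qy) (ltW mz).
Qed.

Section Valuations.
Variable RR : realType.
Implicit Types l m : RR.

(* A rank-one valuation v, presented by the sets {a | v a >= l}. *)
Record valfilt (A : idomainType) := Valfilt {
  vf :> RR -> A -> Prop;
  vf0 : forall l, vf l 0;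
  vfD : forall l a b, vf l a -> vf l b -> vf l (a + b);
  vfM : forall l m a b, vf l a -> vf m b -> vf (l + m) (a * b);
  vfW : forall l m a, l <= m -> vf m a -> vf l a;
  vf_ex : forall a, a != 0 -> exists l, vf l a /\ ~ (exists m, l < m /\ vf m a);
  vf_exM : forall l m a b,
    vf l a /\ ~ (exists m, l < m /\ vf m a) ->
    vf m b /\ ~ (exists l, m < l /\ vf l b) ->
    ~ (exists l', l + m < l' /\ vf l' (a * b))
}.

Section Theory.
Variables (A : idomainType) (v : valfilt A).
Implicit Types a b : A.

(** [vgt l a] and [vex l a] encode v(a) > l and v(a) = l. Zero satisfies every [vgt] and no
    [vex]. *)
Definition vgt l a := exists m, l < m /\ v m a.
Definition vex l a := v l a /\ ~ vgt l a.

Lemma vgtW l a : vgt l a -> v l a.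
Proof. by move=> [m [/ltW lm]]; exact: vfW. Qed.

Lemma vex_or l a : v l a -> vex l a \/ vgt l a.
Proof. by move=> h; have [|] := pselect (vgt l a); [right|left]. Qed.

Lemma vgt0 l : vgt l 0.
Proof. by exists (l + 1); split; [rewrite ltrDl|exact: vf0]. Qed.

Lemma vgtD l a b : vgt l a -> vgt l b -> vgt l (a + b).
Proof.
move=> [m [lm ha]] [m' [lm' hb]]; exists (Num.min m m'); split; first by rewrite lt_min lm.
by apply: vfD; [apply: vfW ha|apply: vfW hb]; rewrite ge_min lexx ?orbT.
Qed.

Lemma vgtM l m a b : v l a -> vgt m b -> vgt (l + m) (a * b).
Proof. by move=> ha [m' [mm' hb]]; exists (l + m'); split; [lra|exact: vfM]. Qed.

Lemma vgtMr l m a b : vgt l a -> v m b -> vgt (l + m) (a * b).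
Proof. by move=> ha hb; rewrite addrC mulrC; exact: vgtM. Qed.

Lemma vexM l m a b : vex l a -> vex m b -> vex (l + m) (a * b).
Proof. by move=> ha hb; split; [apply: vfM; [case: ha|case: hb]|exact: vf_exM ha hb]. Qed.

Lemma vex_neq0 l a : vex l a -> a != 0.
Proof. by move=> [_ h]; apply/eqP => a0; apply: h; rewrite a0; exact: vgt0. Qed.

Lemma vex_le l m a : vex l a -> v m a -> m <= l.
Proof. by move=> [_ h] hm; rewrite leNgt; apply/negP => lm; apply: h; exists m. Qed.

Lemma vex_uniq l m a : vex l a -> vex m a -> l = m.
Proof.
move=> hl hm; apply/eqP; rewrite eq_le.
by rewrite (vex_le hm (proj1 hl)) (vex_le hl (proj1 hm)).
Qed.

Lemma vex1 : vex 0 1.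
Proof.
have [l hl] := vf_ex v (oner_neq0 A); have := vexM hl hl; rewrite mulr1 => h.
by have := vex_uniq hl h => l0; rewrite (_ : 0 = l) //; lra.
Qed.

Lemma vexX n l a : vex l a -> vex (n%:R * l) (a ^+ n).
Proof.
move=> h; elim: n => [|n IH]; first by rewrite mul0r; exact: vex1.
by rewrite exprS -natr1 mulrDl mul1r addrC; exact: vexM.
Qed.

Lemma vfX n l a : v l a -> v (n%:R * l) (a ^+ n).
Proof.
move=> h; elim: n => [|n IH]; first by rewrite mul0r; exact: (proj1 vex1).
by rewrite exprS -natr1 mulrDl mul1r addrC; exact: vfM.
Qed.

Lemma vexN1 : vex 0 (-1).
Proof.
have [l hl] : exists l, vex l (-1) by apply: vf_ex; rewrite oppr_eq0 oner_neq0.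
have := vexM hl hl; rewrite mulrNN mulr1 => h.
by have := vex_uniq vex1 h => l0; rewrite (_ : 0 = l) //; lra.
Qed.

Lemma vfN l a : v l a -> v l (- a).
Proof. by move=> h; rewrite -mulN1r -[l]add0r; apply: vfM => //; exact: (proj1 vexN1). Qed.

Lemma vgtN l a : vgt l a -> vgt l (- a).
Proof. by move=> [m [lm h]]; exists m; split=> //; exact: vfN. Qed.

Lemma vfB l a b : v l a -> v l b -> v l (a - b).
Proof. by move=> ha hb; apply: vfD => //; exact: vfN. Qed.

Lemma vf_sum l (I : Type) (r : seq I) (P : pred I) F :
  (forall i, P i -> v l (F i)) -> v l (\sum_(i <- r | P i) F i).
Proof.
by move=> h; elim/big_ind: _ => // [|a b]; [exact: vf0|exact: vfD].
Qed.

Lemma vgt_sum l (I : Type) (r : seq I) (P : pred I) F :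
  (forall i, P i -> vgt l (F i)) -> vgt l (\sum_(i <- r | P i) F i).
Proof.
by move=> h; elim/big_ind: _ => // [|a b]; [exact: vgt0|exact: vgtD].
Qed.

Lemma vf_prod (I : Type) (r : seq I) (L : I -> RR) (F : I -> A) :
  (forall i, v (L i) (F i)) -> v (\sum_(i <- r) L i) (\prod_(i <- r) F i).
Proof.
move=> h; elim/big_rec2: _ => [|i a l _ hl]; first exact: (proj1 vex1).
exact: vfM.
Qed.

Lemma vf_prod_const (I : finType) l (F : I -> A) :
  (forall i, v l (F i)) -> v (#|I|%:R * l) (\prod_i F i).
Proof.
move=> h; have := vf_prod (index_enum I) (L := fun=> l) h.
by rewrite big_const mulr_natl -[l *+ _]addr0 -iter_addr cardT enumT.
Qed.

Lemma vexD l a b : vex l a -> vgt l b -> vex l (a + b).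
Proof.
move=> [h n] hb; split; first by apply: vfD => //; exact: vgtW.
by move=> hab; apply: n; rewrite -(addrK b a); apply: vgtD => //; exact: vgtN.
Qed.

Lemma vf_det n l (B : 'M[A]_n) : (forall i j, v l (B i j)) -> v (n%:R * l) (\det B).
Proof.
move=> h; apply: vf_sum => s _; rewrite -[_ * l]add0r; apply: vfM.
  move: (nat_of_bool _) => b; rewrite -[X in v X](mulr0 b%:R).
  exact: vfX (proj1 vexN1).
by rewrite -[n in n%:R]card_ord; exact: vf_prod_const.
Qed.

Lemma vf_bound (s : seq A) : exists l, forall a, a \in s -> v l a.
Proof.
elim: s => [|a s [l hl]]; first by exists 0.
have [m hm] : exists m, v m a.
  have [->|a0] := eqVneq a 0; first by exists 0; exact: vf0.
  by have [m []] := vf_ex v a0; exists m.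
exists (Num.min l m) => b; rewrite inE => /predU1P[->|/hl h].
  by apply: vfW hm; rewrite ge_min lexx orbT.
by apply: vfW h; rewrite ge_min lexx.
Qed.

Lemma vf_boundf (I : finType) (F : I -> A) : exists l, forall i, v l (F i).
Proof.
have [l hl] := vf_bound [seq F i | i <- enum I].
by exists l => i; apply: hl; apply: map_f; rewrite mem_enum.
Qed.

End Theory.

Section GaussPoly.
Variables (A : idomainType) (v : valfilt A) (w : RR).
Implicit Types p q : {poly A}.

(** The Gauss valuation in which the variable has valuation [w]. *)
Definition pvf l p := forall i, v (l - w * i%:R) p`_i.

Lemma pvf_ex p : p != 0 -> exists l,
  pvf l p /\ exists i, vex v (l - w * i%:R) p`_i.
Proof.
move=> p0.
have hmin (s : seq nat) : (exists2 i, i \in s & p`_i != 0) -> exists l,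
    (forall i, i \in s -> v (l - w * i%:R) p`_i) /\ exists i, vex v (l - w * i%:R) p`_i.
  elim: s => [[]//|j s IH hs].
  have [h|h] := pselect (exists2 i, i \in s & p`_i != 0); last first.
    have pj : p`_j != 0.
      by case: hs => i; rewrite inE => /predU1P[-> //|si pi]; case: h; exists i.
    have [l hl] := vf_ex v pj; exists (l + w * j%:R); split=> [i|]; last by exists j; rewrite addrK.
    rewrite inE => /predU1P[->|si]; first by rewrite addrK; case: hl.
    have [->|pi] := eqVneq p`_i 0; first exact: vf0.
    by case: h; exists i.
  have [l [hl [i0 hi0]]] := IH h.
  have [pj|pj] := eqVneq p`_j 0.
    exists l; split; last by exists i0.
    by move=> i; rewrite inE => /predU1P[->|/hl//]; rewrite pj; exact: vf0.
  have [m hm] := vf_ex v pj.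
  have [lm|ml] := lerP l (m + w * j%:R).
    exists l; split; last by exists i0.
    move=> i; rewrite inE => /predU1P[->|/hl//].
    by apply: vfW (proj1 hm); lra.
  exists (m + w * j%:R); split; last by exists j; rewrite addrK.
  move=> i; rewrite inE => /predU1P[->|/hl h']; first by rewrite addrK; case: hm.
  by apply: vfW h'; lra.
have [|l [hl h]] := hmin (iota 0 (size p)).
  exists (size p).-1; last by rewrite -/(lead_coef p) lead_coef_eq0.
  by rewrite mem_iota add0n prednK ?leqnn // size_poly_gt0.
exists l; split=> // i; have [ip|ip] := ltnP i (size p); first by apply: hl; rewrite mem_iota.
by rewrite nth_default //; exact: vf0.
Qed.

Lemma pvf_gt p l : ~ (exists i, vex v (l - w * i%:R) p`_i) -> pvf l p ->
  exists m, l < m /\ pvf m p.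
Proof.
have [->|p0] := eqVneq p 0.
  by move=> _ _; exists (l + 1); split=> [|i]; rewrite ?ltrDl // coef0; exact: vf0.
have [m [pm [i him]]] := pvf_ex p0.
move=> n hl; exists m; split=> //.
have lm : l <= m by have := vex_le him (hl i); lra.
rewrite lt_neqAle lm andbT; apply/eqP => E; apply: n; exists i; by rewrite E.
Qed.

(** Gauss's lemma: let i0 and j0 be the largest indices where the minimum is attained. In the
    coefficient of index i0 + j0 all other products have larger valuation. *)
Lemma pvf_exM l m p q :
  (exists i, vex v (l - w * i%:R) p`_i) -> pvf l p ->
  (exists i, vex v (m - w * i%:R) q`_i) -> pvf m q ->
  exists i, vex v (l + m - w * i%:R) (p * q)`_i.
Proof.
have top (l' : RR) (p' : {poly A}) : (exists i, vex v (l' - w * i%:R) p'`_i) ->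
    exists i, vex v (l' - w * i%:R) p'`_i /\ forall j, vex v (l' - w * j%:R) p'`_j -> (j <= i)%N.
  move=> [i hi]; have [|x [_ Qx hx]] := @seq_max _ _ (iota 0 (size p')) (fun i => vex v (l' - w * i%:R) p'`_i).
    exists i => //; rewrite mem_iota add0n ltnNge; apply/negP => /(nth_default 0) p0.
    by have := vex_neq0 hi; rewrite p0 eqxx.
  exists x; split=> // j hj; apply: hx => //.
  rewrite mem_iota add0n ltnNge; apply/negP => /(nth_default 0) p0.
  by have := vex_neq0 hj; rewrite p0 eqxx.
move=> /top[i0 [hi0 mi0]] hp /top[j0 [hj0 mj0]] hq; exists (i0 + j0)%N.
rewrite coefM (bigD1 (inord i0)) //= inordK ?ltnS ?leq_addr // addKn.
have shift (i j : nat) : (i + j = i0 + j0)%N ->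
    l + m - w * (i0 + j0)%:R = (l - w * i%:R) + (m - w * j%:R).
  by move=> <-; rewrite natrD; ring.
apply: vexD; first by rewrite (shift i0 j0) //; exact: vexM.
apply: vgt_sum => i ii0.
have iN : (i <= i0 + j0)%N by rewrite -ltnS.
rewrite (shift i (i0 + j0 - i)%N) ?subnKC //.
have [ilt|ige] := ltnP i i0.
  apply: vgtM; first exact: hp.
  by have [/mj0|//] := vex_or (hq (i0 + j0 - i)%N); lia.
apply: vgtMr; last exact: hq.
have [/mi0 ile|//] := vex_or (hp i).
case/eqP: ii0; apply: val_inj; rewrite /= inordK ?ltnS ?leq_addr //; lia.
Qed.

Definition gauss_poly : valfilt {poly A}.
Proof.
apply: (@Valfilt _ pvf).
- by move=> l i; rewrite coef0; exact: vf0.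
- by move=> l p q hp hq i; rewrite coefD; exact: vfD.
- move=> l m p q hp hq i; rewrite coefM; apply: vf_sum => j _.
  have -> : l + m - w * i%:R = (l - w * j%:R) + (m - w * (i - j)%:R).
    have ji : (j <= i)%N by rewrite -ltnS.
    by rewrite natrB //; ring.
  exact: vfM.
- by move=> l m p lm hp i; apply: vfW (hp i); lra.
- move=> p p0; have [l [hl [i hi]]] := pvf_ex p0; exists l; split=> // -[m [lm hm]].
  by have := vex_le hi (hm i); lra.
- move=> l m p q [hp np] [hq nq] [l' [ll' h]].
  have [||i hi] := @pvf_exM l m p q _ hp _ hq.
  + by apply: contrapT => n; apply: np; exact: pvf_gt.
  + by apply: contrapT => n; apply: nq; exact: pvf_gt.
  by have := vex_le hi (h i); lra.
Defined.

End GaussPoly.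

Section GaussMpoly.
Variables (A : idomainType) (v : valfilt A) (d : nat).
Implicit Types p q : mpoly d A.

Definition mvf l p := forall i, v l (mcoeff i p).

Lemma mvf_ex p : p != 0 -> exists l, mvf l p /\ exists i, vex v l (mcoeff i p).
Proof.
move=> p0.
have hmin (s : seq (multinom d)) : (exists2 i, i \in s & mcoeff i p != 0) -> exists l,
    (forall i, i \in s -> v l (mcoeff i p)) /\ exists i, vex v l (mcoeff i p).
  elim: s => [[]//|j s IH hs].
  have [h|h] := pselect (exists2 i, i \in s & mcoeff i p != 0); last first.
    have pj : mcoeff j p != 0.
      by case: hs => i; rewrite inE => /predU1P[-> //|si pi]; case: h; exists i.
    have [l hl] := vf_ex v pj; exists l; split=> [i|]; last by exists j.
    rewrite inE => /predU1P[->|si]; first by case: hl.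
    have [->|pi] := eqVneq (mcoeff i p) 0; first exact: vf0.
    by case: h; exists i.
  have [l [hl [i0 hi0]]] := IH h.
  have [pj|pj] := eqVneq (mcoeff j p) 0.
    exists l; split; last by exists i0.
    by move=> i; rewrite inE => /predU1P[->|/hl//]; rewrite pj; exact: vf0.
  have [m hm] := vf_ex v pj.
  have [lm|ml] := lerP l m.
    exists l; split; last by exists i0.
    move=> i; rewrite inE => /predU1P[->|/hl//].
    by apply: vfW (proj1 hm).
  exists m; split; last by exists j.
  move=> i; rewrite inE => /predU1P[->|/hl h']; first by case: hm.
  by apply: vfW h'; exact: ltW.
have [|l [hl h]] := hmin (msupp p).
  by exists (mlead p); [exact: mlead_supp|rewrite mleadc_eq0].
exists l; split=> // i; have [mp|/memN_msupp_eq0 ->] := boolP (i \in msupp p); first exact: hl.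
exact: vf0.
Qed.

Lemma mvf_gt p l : ~ (exists i, vex v l (mcoeff i p)) -> mvf l p ->
  exists m, l < m /\ mvf m p.
Proof.
have [->|p0] := eqVneq p 0.
  by move=> _ _; exists (l + 1); split=> [|i]; rewrite ?ltrDl // mcoeff0; exact: vf0.
have [m [pm [i him]]] := mvf_ex p0.
move=> n hl; exists m; split=> //.
have lm : l <= m by have := vex_le him (hl i).
rewrite lt_neqAle lm andbT; apply/eqP => E; apply: n; exists i; by rewrite E.
Qed.

(** Gauss's lemma again, with the largest monomials for the monomial order in place of the largest
    indices. *)
Lemma mvf_exM l m p q :
  (exists i, vex v l (mcoeff i p)) -> mvf l p ->
  (exists i, vex v m (mcoeff i q)) -> mvf m q ->
  exists i, vex v (l + m) (mcoeff i (p * q)).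
Proof.
have top (l' : RR) (p' : mpoly d A) : (exists i, vex v l' (mcoeff i p')) ->
    exists i, vex v l' (mcoeff i p') /\ forall j, vex v l' (mcoeff j p') -> (j <= i)%O.
  move=> [i hi]; have [|x [_ Qx hx]] := @seq_max _ _ (msupp p') (fun i => vex v l' (mcoeff i p')).
    by exists i => //; rewrite mcoeff_msupp; exact: vex_neq0 hi.
  exists x; split=> // j hj; apply: hx => //.
  by rewrite mcoeff_msupp; exact: vex_neq0 hj.
move=> /top[i0 [hi0 mi0]] hp /top[j0 [hj0 mj0]] hq; exists (mnm_add i0 j0).
set M := mnm_add i0 j0.
have bi : (mdeg i0 < (mdeg M).+1)%N by rewrite /M mdegD ltnS leq_addr.
have bj : (mdeg j0 < (mdeg M).+1)%N by rewrite /M mdegD ltnS leq_addl.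
rewrite mcoeffM (bigD1 (BMultinom bi, BMultinom bj)) //=.
apply: vexD; first exact: vexM.
apply: vgt_sum => -[k1 k2] /andP[/eqP kM kn] /=.
have [k1i|k1i] := leP (k1 : multinom d) i0; last first.
  apply: vgtMr; last exact: hq.
  by have [/mi0 h|//] := vex_or (hp k1); move: k1i; rewrite ltNge h.
apply: vgtM; first exact: hp.
have [/mj0 k2j|//] := vex_or (hq k2).
exfalso.
have [E|k1n] := eqVneq (k1 : multinom d) i0.
  have aux (x y : multinom d) : mnm_add i0 j0 = mnm_add x y -> x = i0 -> y = j0.
    by move=> h xi; move: h; rewrite xi => /addmI.
  have E2 := aux _ _ kM E.
  by case/eqP: kn; congr (_, _); apply: val_inj.
have k1lt : ((k1 : multinom d) < i0)%O by rewrite lt_neqAle k1n.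
have aux (x y : multinom d) : mnm_add i0 j0 = mnm_add x y -> (x < i0)%O -> ~ (y <= j0)%O.
  by move=> h xi yj; have := ltmc_le_add xi yj; rewrite -h ltxx.
exact: aux kM k1lt k2j.
Qed.

Definition gauss_mpoly : valfilt (mpoly d A).
Proof.
apply: (@Valfilt _ mvf).
- by move=> l i; rewrite mcoeff0; exact: vf0.
- by move=> l p q hp hq i; rewrite mcoeffD; exact: vfD.
- by move=> l m p q hp hq i; rewrite mcoeffM; apply: vf_sum => j _; exact: vfM.
- by move=> l m p lm hp i; apply: vfW (hp i).
- move=> p p0; have [l [hl [i hi]]] := mvf_ex p0; exists l; split=> // -[m [lm hm]].
  by have := vex_le hi (hm i); lra.
- move=> l m p q [hp np] [hq nq] [l' [ll' h]].
  have [||i hi] := @mvf_exM l m p q _ hp _ hq.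
  + by apply: contrapT => n; apply: np; exact: mvf_gt.
  + by apply: contrapT => n; apply: nq; exact: mvf_gt.
  by have := vex_le hi (h i); lra.
Defined.

Lemma gauss_mpolyC l a : v l a -> gauss_mpoly l (mpolyC d a).
Proof.
move=> h m; rewrite mcoeffC; case: eqP => _; first by rewrite mulr1.
by rewrite mulr0; exact: vf0.
Qed.

Lemma gauss_mpolyX (m : multinom d) : gauss_mpoly 0 (mpolyX A m).
Proof.
move=> m'; rewrite mcoeffX; case: eqP => _; [exact: (proj1 (vex1 v))|exact: vf0].
Qed.

Lemma vex_mpolyC l a : vex v l a -> vex gauss_mpoly l (mpolyC d a).
Proof.
move=> h; split; first exact: gauss_mpolyC (proj1 h).
move=> [m [lm /(_ mnm0)]]; rewrite mcoeffC eqxx mulr1 => hm.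
by have := vex_le h hm; lra.
Qed.

End GaussMpoly.

End Valuations.

(** * Complete integral closedness and integral equations *)

Section CompletelyIntegrallyClosed.

(* P is completely integrally closed up to the nonzero scalars of D: if all the
   powers of a / b have a common denominator c, then b divides a. *)
Definition cic (D P : idomainType) (io : {rmorphism D -> P}) :=
  forall c a b : P, c != 0 -> b != 0 ->
    (forall j, exists s e, s != 0 /\ io s * c * a ^+ j = b ^+ j * e) ->
  exists s e, s != 0 /\ io s * a = b * e.

(** The fraction a / b may be replaced by u a / b - t: in the binomial expansion the same c serves,
    once the scalars of the powers up to j are multiplied together. This allows a leading term to be
    subtracted in a descent. *)
Lemma cic_shift (D P : idomainType) (io : {rmorphism D -> P}) (c a b : P) u t :
    (forall j, exists s e, s != 0 /\ io s * c * a ^+ j = b ^+ j * e) ->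
  forall j, exists s e, s != 0 /\ io s * c * (io u * a - b * t) ^+ j = b ^+ j * e.
Proof.
move=> H j; have /choice[s /choice[e he]] := H.
pose S i := (\prod_(l < j.+1 | l != i) s l).
exists (\prod_(l < j.+1) s l).
exists (\sum_(i < j.+1) (io (S (rev_ord i) * u ^+ (j - i)) * e (j - i)%N * (- t) ^+ i) *+ 'C(j, i)).
split; first by rewrite prodf_seq_neq0; apply/allP => l _; case: (he l).
rewrite exprDn !mulr_sumr; apply: eq_bigr => i _; rewrite !mulrnAr; congr (_ *+ _).
have ij : (i <= j)%N by rewrite -ltnS.
rewrite -mulrN !exprMn -(rmorphXn io).
have -> : \prod_(l < j.+1) s l = s (j - i)%N * S (rev_ord i).
  by rewrite (bigD1 (rev_ord i)) //= subSS.
have -> : b ^+ j = b ^+ (j - i) * b ^+ i by rewrite -exprD subnK.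
rewrite !rmorphM.
transitivity ((io (s (j - i)%N) * c * a ^+ (j - i)) * (io (S (rev_ord i)) * io (u ^+ (j - i)) * b ^+ i * (- t) ^+ i)).
  by ring.
by rewrite (proj2 (he _)); ring.
Qed.

(** Division of a by b along the monomial order. As D is not a field, a is first multiplied by the
    leading coefficient of b. *)
Lemma cic_mpoly (D : idomainType) d : cic (@mpolyC d D).
Proof.
move=> c a b c0 b0; move Em : (mlead a) => m0.
elim/(well_founded_ind (@ltom_wf d)): m0 a Em => m0 IH a Em H.
have [->|a0] := eqVneq a 0.
  by exists 1, 0; rewrite oner_neq0 !mulr0.
have ba : lem (mlead b) (mlead a).
  apply/mnm_lepP => i; rewrite leqNgt; apply/negP => ab.
  (* If the i-th exponent of a were below that of b, each power would lose at least 1, and this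
     power would lose more than c can supply. *)
  have [s [e [s0 he]]] := H (mlead c i).+1.
  have sC : mpolyC d s != 0 by rewrite mpolyC_eq0.
  have aX : a ^+ (mlead c i).+1 != 0 by rewrite expf_neq0.
  have bX : b ^+ (mlead c i).+1 != 0 by rewrite expf_neq0.
  have e0 : e != 0.
    by apply: contra_neq (mulf_neq0 (mulf_neq0 sC c0) aX) => e0; rewrite he e0 mulr0.
  have := congr1 (fun x => mlead x i) he.
  rewrite /= !mleadM ?mulf_neq0 // mleadC !mnmDE mnm0E add0n.
  rewrite !mleadX_proper ?mulmnE; try by apply/lregP; rewrite mleadc_eq0.
  move: ab; move: (mlead a i) (mlead b i) (mlead c i) (mlead e i) => x y z t.
  nia.
pose u := mcoeff (mlead b) b; pose t := mcoeff (mlead a) a *: mpolyX D (mnm_sub (mlead a) (mlead b)).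
have u0 : u != 0 by rewrite mleadc_eq0.
have at0 : mcoeff (mlead a) a != 0 by rewrite mleadc_eq0.
have t0 : t != 0 by rewrite -msupp_eq0 msuppMCX.
have lt : mlead t = mnm_sub (mlead a) (mlead b).
  by rewrite mleadZ_proper ?mleadXm // mcoeffX eqxx mulr1.
have lbt : mlead (b * t) = mlead a by rewrite mleadM // lt addmC submK.
have uC : mpolyC d u != 0 by rewrite mpolyC_eq0.
have lua : mlead (mpolyC d u * a) = mlead a by rewrite mleadM // mleadC add0m.
have [E|an] := eqVneq (mpolyC d u * a - b * t) 0.
  by exists u, t; split=> //; apply/eqP; rewrite -subr_eq0 E.
have [||s [e [s0 he]]] := IH (mlead (mpolyC d u * a - b * t)) _ (mpolyC d u * a - b * t) erefl.
- rewrite -Em lt_neqAle; apply/andP; split; last first.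
    by apply: le_trans (mleadB_le _ _) _; rewrite lbt lua joinxx.
  apply/eqP => h; have := mleadc_eq0 (mpolyC d u * a - b * t); rewrite (negPf an) h mcoeffB.
  rewrite -[X in mcoeff X (b * t)]lbt mleadM // mleadcM lt.
  by rewrite mcoeffCM mcoeffZ mcoeffX eqxx mulr1 subrr eqxx.
- exact: cic_shift.
exists (s * u), (e + mpolyC d s * t); split; first by rewrite mulf_neq0.
by rewrite rmorphM -mulrA mulrDr -he /=; ring.
Qed.

(** The same descent on the degree in the new variable; the leading coefficients inherit the
    hypothesis and can be divided because P satisfies [cic]. *)
Lemma cic_poly (D P : idomainType) (io : {rmorphism D -> P}) :
  injective io -> cic io -> cic (polyC \o io).
Proof.
move=> io_inj hP c a b c0 b0; have [n] := ubnP (size a).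
elim: n a => // n IH a; rewrite ltnS => an H.
have ioC s : s != 0 -> (io s)%:P != 0.
  by move=> s0; rewrite polyC_eq0 -(rmorph0 io) (inj_eq io_inj).
have [->|a0] := eqVneq a 0.
  by exists 1, 0; rewrite oner_neq0 !mulr0.
have szX (p : {poly P}) j : p != 0 -> (size (p ^+ j)).-1 = ((size p).-1 * j)%N.
  by move=> p0; rewrite size_exp.
have ba : (size b <= size a)%N.
  rewrite leqNgt; apply/negP => ab.
  have [s [e [s0 he]]] := H (size c).
  have aX : a ^+ (size c) != 0 by rewrite expf_neq0.
  have bX : b ^+ (size c) != 0 by rewrite expf_neq0.
  have e0 : e != 0.
    by apply: contra_neq (mulf_neq0 (mulf_neq0 (ioC _ s0) c0) aX) => e0; rewrite he e0 mulr0.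
  have := congr1 (fun x : {poly P} => (size x).-1) he.
  rewrite /= !size_mul ?mulf_neq0 ?ioC // size_polyC.
  have -> : io s != 0 by rewrite -polyC_eq0 ioC.
  have := szX a (size c) a0; have := szX b (size c) b0.
  have : (0 < size a)%N by rewrite size_poly_gt0.
  have : (0 < size c)%N by rewrite size_poly_gt0.
  have : (0 < size e)%N by rewrite size_poly_gt0.
  have : (0 < size (a ^+ size c))%N by rewrite size_poly_gt0.
  have : (0 < size (b ^+ size c))%N by rewrite size_poly_gt0.
  move: ab; move: (size a) (size b) (size c) (size e) (size (a ^+ _)) (size (b ^+ _)) => x y z t ax bx.
  nia.
have [s1 [e1 [s10 he1]]] : exists s e, s != 0 /\ io s * lead_coef a = lead_coef b * e.
  apply: (hP (lead_coef c)); rewrite ?lead_coef_eq0 // => j.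
  have [s [e [s0 he]]] := H j; exists s, (lead_coef e); split=> //.
  have := congr1 lead_coef he; rewrite /= !lead_coefM lead_coefC.
  by rewrite !lead_coef_exp.
pose t : {poly P} := e1 *: 'X^(size a - size b).
have sa : (0 < size a)%N by rewrite size_poly_gt0.
have sb : (0 < size b)%N by rewrite size_poly_gt0.
have E : (size ((polyC \o io) s1 * a - b * t)%R <= (size a).-1)%N.
  apply/leq_sizeP => i ia; rewrite coefB /= coefCM /t -scalerAr coefZ coefMXn.
  have -> : (i < size a - size b)%N = false by lia.
  have [ai|ia'] := leqP (size a) i.
    rewrite (nth_default 0 ai) (@nth_default _ 0 b) ?mulr0 ?subrr //.
    by apply: leq_trans (leq_sub2r _ ai); rewrite subKn.
  have -> : i = (size a).-1 by lia.
  have -> : ((size a).-1 - (size a - size b))%N = (size b).-1 by lia.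
  by rewrite -!/(lead_coef _) he1 mulrC subrr.
have [||s [e [s0 he]]] := IH ((polyC \o io) s1 * a - b * t).
- by apply: leq_ltn_trans E _; rewrite prednK.
- exact: cic_shift.
exists (s * s1), (e + (io s)%:P * t); split; first by rewrite mulf_neq0.
by rewrite /= rmorphM polyCM -mulrA mulrDr -he /=; ring.
Qed.

End CompletelyIntegrallyClosed.

Section CharPoly.
Variables (RR : realType) (D P : idomainType) (io : {rmorphism D -> P}).
Variables (vD : valfilt RR D) (v : valfilt RR P) (Om : comNzRingType) (eta : {rmorphism P -> Om}).
Hypothesis io_inj : injective io.
Hypothesis vio : forall l s, vex vD l s -> vex v l (io s).
Hypothesis P_cic : cic (polyC \o io).
Hypothesis Om_domain : forall a b : Om, a * b = 0 -> a = 0 \/ b = 0.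
Hypothesis eta0 : forall p, eta p = 0 -> p = 0.
Variables (n : nat) (e : 'I_n.+1 -> Om).
Hypothesis ei : pindep eta e.

Lemma vf_cancel l m a b : vex v m a -> v (m + l) (a * b) -> v l b.
Proof.
move=> ha hab; have [->|b0] := eqVneq b 0; first exact: vf0.
have [l' hl'] := vf_ex v b0; have := vexM ha hl' => h.
by apply: vfW (proj1 hl'); have := vex_le h hab; lra.
Qed.

Lemma vf_lim (A : idomainType) (u : valfilt RR A) l a :
  (forall eps, 0 < eps -> u (l - eps) a) -> u l a.
Proof.
move=> h; have [->|a0] := eqVneq a 0; first exact: vf0.
have [m hm] := vf_ex u a0; have [lm|ml] := lerP l m; first exact: vfW (proj1 hm).
have := vex_le hm (h ((l - m) / 2) _); lra.
Qed.

(* The lattice of the w which, up to a scalar s of valuation 0, have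
   coordinates of valuation at least l. *)
Definition lat (l : RR) (w : Om) := exists s (p : 'I_n.+1 -> P),
  [/\ vex vD 0 s, eta (io s) * w = \sum_i eta (p i) * e i & forall i, v l (p i)].

Lemma coords_inj (p p' : 'I_n.+1 -> P) :
  \sum_j eta (p j) * e j = \sum_j eta (p' j) * e j -> forall j, p j = p' j.
Proof.
move=> /eqP; rewrite -subr_eq0 -sumrB => /eqP h j; apply/eqP; rewrite -subr_eq0.
apply/eqP; apply: (ei (p := fun j => p j - p' j)); rewrite -[RHS]h.
by apply: eq_bigr => l _; rewrite rmorphB mulrBl.
Qed.

Lemma lat_common (I : finType) l (w : I -> Om) : (forall i, lat l (w i)) ->
  exists s (B : I -> 'I_n.+1 -> P), [/\ vex vD 0 s,
    forall i, eta (io s) * w i = \sum_j eta (B i j) * e j & forall i j, v l (B i j)].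
Proof.
move=> /choice[s /choice[B hB]].
exists (\prod_i s i), (fun i j => io (\prod_(i' | i' != i) s i') * B i j).
have vprod (Q : pred I) : vex vD 0 (\prod_(i | Q i) s i).
  elim/big_ind: _ => [|a b ha hb|i _]; [exact: vex1| |by case: (hB i)].
  by rewrite -[0]addr0; exact: vexM.
split=> [|i|i j]; first exact: vprod.
  rewrite (bigD1 i) //= [s i * _]mulrC !rmorphM -mulrA; case: (hB i) => _ -> _.
  rewrite mulr_sumr; apply: eq_bigr => j _.
  by rewrite [in RHS]rmorphM mulrA.
rewrite -[l]add0r; apply: vfM; last by case: (hB i).
exact: (proj1 (vio (vprod _))).
Qed.

Variables (c : P) (h : Om).
Hypothesis c0 : c != 0.
Hypothesis h_lat : forall j i, exists l, lat l (eta c * h ^+ j * e i).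

(** The multiplier q is there for torsion-freeness of gr, where the growth of q h is known and a
    bound for the equation of h itself is wanted. *)
Definition growth (q : P) (mu : RR) := forall mu', mu' < mu -> exists C, forall j i,
  lat (j%:R * mu' - C) (eta (c * q ^+ j) * h ^+ j * e i).

Lemma horner_char_poly (R : comNzRingType) m (M : 'M[R]_m) x : (char_poly M).[x] = \det (x%:M - M).
Proof.
rewrite /char_poly -/(horner_eval x _) -det_map_mx; congr (\det _).
apply/matrixP => i j; rewrite !mxE /= /horner_eval !hornerE /=.
by case: eqP => _; rewrite ?mulr1n ?mulr0n ?hornerX ?horner0.
Qed.

Lemma coef_comp_scaleX (R : comNzRingType) (p : {poly R}) a i :
  (p \Po (a%:P * 'X))`_i = a ^+ i * p`_i.
Proof.
rewrite comp_polyE coef_sum.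
rewrite (eq_bigr (fun j : 'I_(size p) => (p`_j * a ^+ j) * (i == j)%:R)) => [|j _]; last first.
  by rewrite exprMn -rmorphXn coefZ coefCM coefXn mulrA.
have [ip|ip] := ltnP i (size p); last first.
  rewrite nth_default // mulr0 big1 // => j _.
  by case: eqP => [E|]; [have := ltn_ord j; rewrite -E ltnNge ip|rewrite mulr0].
rewrite (bigD1 (Ordinal ip)) //= eqxx mulr1 big1 ?addr0 1?mulrC // => j /negPf jn.
by case: eqP => [E|]; [case/eqP: jn; apply: val_inj|rewrite mulr0].
Qed.

Lemma det_expr (R : comNzRingType) m (M : 'M[R]_m.+1) j : \det (M ^+ j) = (\det M) ^+ j.
Proof. by elim: j => [|j IH]; rewrite ?expr0 ?det1 // !exprS det_mulmx IH. Qed.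

(** The equation is the characteristic polynomial of h, whose coefficients a priori have
    denominators. With A the matrix of c' h, G = det (c' X - A) equals c'^(n+1) times that
    polynomial. The powers of G / c'^(n+1) are, up to scalars, determinants over P[X] divided by
    c^(n+1), so [P_cic] gives the quotient G1. Its Gauss valuation is bounded by taking valuations
    in the same determinants and dividing by j. *)
Theorem integral_equation : exists s g (a : 'I_n.+1 -> P), [/\ vex vD g s,
    eta (io s) * h ^+ n.+1 = \sum_i eta (a i) * h ^+ i &
    forall q mu, vex v 0 q -> growth q mu -> forall i : 'I_n.+1, v (g + (n.+1 - i)%:R * mu) (a i)].
Proof.
have /choice[s /choice[B hB]] : forall j, exists s (B : 'M[P]_n.+1), vex vD 0 s /\
    forall i, eta (io s) * (eta c * h ^+ j * e i) = \sum_l eta (B i l) * e l.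
  move=> j; have /choice[l hl] := h_lat j.
  have [s [p [s0 hp _]]] : exists s (p : 'I_n.+1 -> 'I_n.+1 -> P), [/\ vex vD 0 s,
      forall i, eta (io s) * (eta c * h ^+ j * e i) = \sum_l eta (p i l) * e l & True].
    have [l0 hl0] : exists l0, forall i, l0 <= l i.
      exists (- \sum_i `|l i|) => i; rewrite lerNl (bigD1 i) //=.
      apply: le_trans (_ : `|l i| <= _); first by rewrite -normrN ler_norm.
      by rewrite lerDl sumr_ge0.
    have [i|s [p [? ? ?]]] := @lat_common _ l0 (fun i => eta c * h ^+ j * e i); last by exists s, p.
    have [s [p [? ? hv]]] := hl i; exists s, p; split=> // i'.
    exact: vfW (hv i').
  exists s, (\matrix_(i, l) p i l); split=> // i.
  by rewrite hp; apply: eq_bigr => l' _; rewrite mxE.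
have s0 j : vex vD 0 (s j) by case: (hB j).
have sn0 j : s j != 0 by exact: vex_neq0 (s0 j).
(* Absorbing the scalar s_1 into c gives c' h an exact matrix over P. *)
pose c' := c * io (s 1%N); pose A := B 1%N.
have c'0 : c' != 0 by rewrite mulf_neq0 // -(rmorph0 io) (inj_eq io_inj).
have hA i : eta c' * h * e i = \sum_l eta (A i l) * e l.
  by rewrite -(proj2 (hB 1%N)) expr1 /c' rmorphM; ring.
have hAj j i : eta (c' ^+ j) * h ^+ j * e i = \sum_l eta ((A ^+ j) i l) * e l.
  elim: j i => [|j IH] i.
    rewrite !expr0 rmorph1 !mul1r (bigD1 i) //= mxE eqxx rmorph1 mul1r big1 ?addr0 // => l.
    by rewrite eq_sym mxE => /negPf ->; rewrite rmorph0 mul0r.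
  transitivity ((eta (c' ^+ j) * h ^+ j) * (eta c' * h * e i)).
    by rewrite !exprS rmorphM; ring.
  rewrite hA mulr_sumr.
  transitivity (\sum_l eta (A i l) * \sum_l' eta ((A ^+ j) l l') * e l').
    by apply: eq_bigr => l _; rewrite -IH; ring.
  under eq_bigr => l _ do rewrite mulr_sumr.
  rewrite exchange_big /=; apply: eq_bigr => l' _.
  rewrite exprS -mulmxE mxE rmorph_sum mulr_suml; apply: eq_bigr => l _.
  by rewrite rmorphM mulrA.
have BA j : (c' ^+ j) *: B j = (io (s j) * c) *: (A ^+ j).
  apply/matrixP => i l; rewrite !mxE.
  apply: (coords_inj (p := fun l => c' ^+ j * B j i l) (p' := fun l => io (s j) * c * (A ^+ j) i l)).
  transitivity (eta (c' ^+ j) * (eta (io (s j)) * (eta c * h ^+ j * e i))).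
    rewrite (proj2 (hB j)) mulr_sumr; apply: eq_bigr => l' _.
    by rewrite rmorphM mulrA.
  transitivity (eta (io (s j) * c) * (eta (c' ^+ j) * h ^+ j * e i)).
    by rewrite rmorphM; ring.
  rewrite hAj mulr_sumr; apply: eq_bigr => l' _.
  by rewrite [in RHS]rmorphM mulrA.
clearbody c'.
pose S j (i : 'I_j.+1) := \prod_(l < j.+1 | l != i) s l.
pose SS j := \prod_(l < j.+1) s l.
have SE j (i : 'I_j.+1) : SS j = s i * S j i by rewrite /SS (bigD1 i).
have Sex j (i : 'I_j.+1) : vex vD 0 (S j i).
  rewrite /S; elim/big_ind: _ => [|a b ha hb|l _]; [exact: vex1| |exact: s0].
  by rewrite -[0]addr0; exact: vexM.
have SSex j : vex vD 0 (SS j).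
  by rewrite (SE _ ord0) -[0]addr0; apply: vexM.
pose x : {poly P} := c'%:P * 'X.
pose EE : 'M[{poly P}]_n.+1 := x%:M - map_mx polyC A.
pose G := char_poly A \Po x.
have GE : G = \det EE.
  rewrite /G /char_poly -[_ \Po x]/(comp_poly x _) -det_map_mx; congr (\det _).
  apply/matrixP => i j; rewrite !mxE /= rmorphB /= comp_polyC; congr (_ - _).
  by case: eqP => _; rewrite ?mulr1n ?mulr0n ?comp_polyX ?comp_poly0.
(* The matrix of [SS j] c (X - h)^j, expanded binomially. The denominator c appears once, not j
   times. *)
pose Bx j : 'M[{poly P}]_n.+1 := \sum_(i < j.+1)
  ((-1) ^+ i * 'X^(j - i) * (io (S j i))%:P) *: map_mx polyC (B i) *+ 'C(j, i).
have BxE j : (c' ^+ j)%:P *: Bx j = (io (SS j) * c)%:P *: (EE ^+ j).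
  rewrite /EE exprDn_comm; last first.
    by rewrite /GRing.comm -!mulmxE mul_scalar_mx scalar_mxC mul_scalar_mx.
  rewrite /Bx !scaler_sumr; apply: eq_bigr => i _; rewrite -!scalerMnr; congr (_ *+ _).
  have ij : (i <= j)%N by rewrite -ltnS.
  rewrite [(- map_mx polyC A) ^+ _]exprNn -[x%:M ^+ _]rmorphXn /= -!mulmxE.

  have -> : (-1 : 'M[{poly P}]_n.+1) ^+ i = ((-1) ^+ i)%:M by rewrite -(rmorphN1 (scalar_mx)) -rmorphXn.
  have -> : (map_mx polyC A) ^+ i = map_mx polyC (A ^+ i).
    by elim: (nat_of_ord i) => [|l IH]; rewrite ?expr0 ?map_mx1 // !exprS -!mulmxE map_mxM IH.
  rewrite -?mulmxE !mul_scalar_mx !scalerA.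
  have -> : (c' ^+ j)%:P * ((-1) ^+ i * 'X^(j - i) * (io (S j i))%:P) =
      ((-1) ^+ i * x ^+ (j - i) * (io (S j i))%:P) * (c' ^+ i)%:P.
    have -> : (c' ^+ j)%:P = (c' ^+ (j - i))%:P * (c' ^+ i)%:P by rewrite -polyCM -exprD subnK.
    have -> : x ^+ (j - i) = (c' ^+ (j - i))%:P * 'X^(j - i) by rewrite /x exprMn rmorphXn.
    move: ((c' ^+ (j - i))%:P) ((c' ^+ i)%:P) ((-1) ^+ i) ('X^(j - i)) ((io (S j i))%:P) => t1 t2 t3 t4 t5.
    by ring.
  have mapZ t (T : 'M[P]_n.+1) : map_mx polyC (t *: T) = t%:P *: map_mx polyC T.
    by apply/matrixP => i1 i2; rewrite !mxE polyCM.
  have := congr1 (map_mx polyC) (BA i); rewrite !mapZ => BAi.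
  transitivity (((-1) ^+ i * x ^+ (j - i) * (io (S j i))%:P) *: ((c' ^+ i)%:P *: map_mx polyC (B i))).
    by rewrite scalerA.
  rewrite BAi scalerA; congr (_ *: _).
  by rewrite (SE j i) rmorphM !polyCM; ring.
have dE j : (c'%:P ^+ n.+1) ^+ j * \det (Bx j) = ((io (SS j) * c)%:P) ^+ n.+1 * G ^+ j.
  rewrite GE -det_expr -detZ -BxE detZ; congr (_ * _).
  by rewrite -!exprM mulnC exprM -rmorphXn.
(* By [dE], c^(n+1) is a common denominator, up to scalars, of all powers of G / c'^(n+1). *)
have [s1 [G1 [s10 hG1]]] : exists s1 G1, s1 != 0 /\ (polyC \o io) s1 * G = (c'%:P ^+ n.+1) * G1.
  apply: (P_cic (c := (c ^+ n.+1)%:P)).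
  - by rewrite polyC_eq0 expf_neq0.
  - by rewrite expf_neq0 // polyC_eq0.
  - move=> j; exists (SS j ^+ n.+1), (\det (Bx j)); split.
      by rewrite expf_neq0 //; exact: vex_neq0 (SSex j).
    by rewrite dE /= polyCM exprMn !rmorphXn /=.
have G1coef i : c' ^+ n.+1 * G1`_i = io s1 * (c' ^+ i * (char_poly A)`_i).
  have := congr1 (fun p : {poly P} => p`_i) hG1.
  by rewrite /= -rmorphXn !coefCM coef_comp_scaleX => ->.
have szA : size (char_poly A) = n.+2 by exact: size_char_poly.
have cc0 : c' ^+ n.+1 != 0 by rewrite expf_neq0.
have G1top : G1`_n.+1 = io s1.
  apply: (mulfI cc0); rewrite G1coef.
  have -> : (char_poly A)`_n.+1 = 1.
    by have /monicP := char_poly_monic A; rewrite /lead_coef szA.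
  by rewrite mulr1 mulrC.
have G1big i : (n.+1 < i)%N -> G1`_i = 0.
  move=> ni; apply: (mulfI cc0); rewrite G1coef nth_default ?mulr0 // szA //.
have [g hg] := vf_ex vD s10.
exists s1, g, (fun i => - G1`_i); split=> //.
- have root : (map_poly eta (char_poly A)).[eta c' * h] = 0.
    rewrite map_char_poly horner_char_poly.
    (* Determinant trick: the column of the e_i is in the kernel, so the determinant kills e_0,
       which is nonzero in the domain Om. *)
    have hv : ((eta c' * h)%:M - map_mx eta A) *m (\col_i e i) = 0.
      apply/matrixP => i j; rewrite mulmxBl mul_scalar_mx !mxE hA.
      by apply/eqP; rewrite subr_eq0; apply/eqP/eq_bigr => l _; rewrite !mxE.
    have := congr1 (mulmx (\adj ((eta c' * h)%:M - map_mx eta A))) hv.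
    rewrite mulmx0 mulmxA mul_adj_mx mul_scalar_mx => /matrixP/(_ ord0 ord0).
    rewrite !mxE => /Om_domain[//|e0].
    suff /(_ ord0)/eqP : forall j : 'I_n.+1, (j == ord0)%:R = 0 :> P by rewrite eqxx oner_eq0.
    apply: ei; rewrite (bigD1 ord0) //= e0 mulr0 add0r big1 // => j /negPf ->.
    by rewrite rmorph0 mul0r.
  have : eta (c' ^+ n.+1) * (\sum_(i < n.+2) eta G1`_i * h ^+ i) = 0.
    transitivity (eta (io s1) * (map_poly eta (char_poly A)).[eta c' * h]); last by rewrite root mulr0.
    rewrite [map_poly _ _]/map_poly horner_poly szA !mulr_sumr.
    apply: eq_bigr => i _.
    rewrite mulrA -rmorphM G1coef !rmorphM [eta (c' ^+ i)]rmorphXn exprMn.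
    by rewrite !mulrA -[_ * _ * eta _]mulrA [eta c' ^+ i * _]mulrC !mulrA.
  case/Om_domain => [/eta0/eqP|]; first by rewrite (negPf cc0).
  rewrite big_ord_recr /= G1top => /eqP; rewrite addrC addr_eq0 => /eqP ->.
  by rewrite -sumrN; apply: eq_bigr => i _; rewrite rmorphN mulNr.
- move=> q mu hq hgr i; apply: vfN; apply: vf_lim => eps eps0.
  (* Chosen so that (n+1-i) mu' = (n+1-i) mu - eps. *)
  pose mu' := mu - eps / (n.+1 - i)%:R.
  have ni : 0 < (n.+1 - i)%:R :> RR by rewrite ltr0n subn_gt0.
  have mumu : mu' < mu by rewrite /mu' ltrBlDr ltrDl divr_gt0.
  have [C hC] := hgr mu' mumu.
  have hBv j i' l : v (j%:R * mu' - C) (B j i' l).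
    have [s' [p [s'0 hp hpv]]] := hC j i'.
    have E : io s' * q ^+ j * B j i' l = io (s j) * p l.
      apply: (coords_inj (p := fun l => io s' * q ^+ j * B j i' l) (p' := fun l => io (s j) * p l)).
      transitivity (eta (io s' * q ^+ j) * (eta (io (s j)) * (eta c * h ^+ j * e i'))).
        rewrite (proj2 (hB j)) mulr_sumr; apply: eq_bigr => l' _.
        by rewrite [in LHS]rmorphM mulrA.
      transitivity (eta (io (s j)) * (eta (io s') * (eta (c * q ^+ j) * h ^+ j * e i'))).
        by rewrite !rmorphM; ring.
      by rewrite hp mulr_sumr; apply: eq_bigr => l' _; rewrite [in RHS]rmorphM mulrA.
    have exq : vex v 0 (io s' * q ^+ j).
      by rewrite -[0]addr0; apply: vexM; [exact: vio|rewrite -[0](mulr0 j%:R); exact: vexX].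
    apply: (vf_cancel exq); rewrite E; apply: vfM => //.
    exact: (proj1 (vio (s0 j))).
  (* Giving X the valuation mu' balances X^(j-i) against h^i: every term of [Bx j] has valuation at
     least j mu' - C. *)
  pose gv := gauss_poly v mu'.
  have hBx j i' l : gv (j%:R * mu' - C) (Bx j i' l).
    rewrite /Bx summxE; apply: vf_sum => i1 _.
    rewrite mulmxnE -[_ *+ 'C(_, _)]mulr_natl -[X in gv X]add0r; apply: vfM.
      elim: 'C(_, _) => [|m IH]; first exact: vf0.
      by rewrite -natr1; apply: vfD => //; exact: (proj1 (vex1 gv)).
    rewrite !mxE -mulrA -polyCM -mulrA -[X in gv X]add0r; apply: vfM.
      by rewrite -[X in gv X](mulr0 i1%:R); apply: vfX; exact: (proj1 (vexN1 gv)).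
    move=> m; rewrite coefXnM; case: ltnP => mj; first exact: vf0.
    rewrite coefC; case: eqP => [mE|_]; last exact: vf0.
    have {mE} mE : m = (j - i1)%N by lia.
    have i1j : (i1 <= j)%N by rewrite -ltnS.
    have -> : j%:R * mu' - C - mu' * m%:R = 0 + (i1%:R * mu' - C).
      by rewrite mE natrB //; ring.
    by apply: vfM => //; exact: (proj1 (vio (Sex _ _))).
  have polyC_ex l a : vex v l a -> vex gv l a%:P.
    move=> [h1 h2]; split.
      by move=> m; rewrite coefC; case: eqP => [->|_]; [rewrite mulr0 subr0|exact: vf0].
    move=> [m [lm /(_ 0%N)]]; rewrite coefC /= mulr0 subr0 => hm; apply: h2; by exists m.
  have G0 : G != 0.
    apply/eqP => G0; have := G1top.
    have /eqP : (c'%:P ^+ n.+1) * G1 = 0 by rewrite -hG1 G0 mulr0.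
    rewrite mulf_eq0 -rmorphXn polyC_eq0 (negPf cc0) /= => /eqP ->.
    by rewrite coef0 => /esym/eqP; rewrite -(rmorph0 io) (inj_eq io_inj) (negPf s10).
  have [gG hgG] := vf_ex gv G0.
  have [gc' hgc'] := vf_ex v c'0; have [gc hgc] := vf_ex v c0.
  have key (j : nat) : j%:R * (n.+1%:R * gc') + n.+1%:R * (j%:R * mu' - C) <= n.+1%:R * gc + j%:R * gG.
    have L : vex gv (j%:R * (n.+1%:R * gc')) ((c'%:P ^+ n.+1) ^+ j).
      by apply: vexX; apply: vexX; exact: polyC_ex.
    have Rr : vex gv (n.+1%:R * gc + j%:R * gG) (((io (SS j) * c)%:P) ^+ n.+1 * G ^+ j).
      apply: vexM; last exact: vexX.
      apply: vexX; apply: polyC_ex; rewrite -[gc]add0r; apply: vexM => //.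
      exact: vio (SSex j).
    apply: (vex_le Rr); rewrite -dE; apply: vfM; first exact: (proj1 L).
    by apply: vf_det.
  (* Divide [key] by j and let j tend to infinity; the terms in C and gc vanish. *)
  have lim : n.+1%:R * gc' + n.+1%:R * mu' <= gG.
    rewrite leNgt; apply/negP => lt.
    pose dl := n.+1%:R * gc' + n.+1%:R * mu' - gG.
    have dl0 : 0 < dl by rewrite /dl; lra.
    pose K := n.+1%:R * gc + n.+1%:R * C.
    have [j hj] : exists j : nat, K / dl < j%:R.
      exists (Num.bound `|K / dl|); apply: le_lt_trans (ler_norm _) (archi_boundP _).
      exact: normr_ge0.
    move: hj; rewrite ltr_pdivrMr // => hj.
    have E : j%:R * dl = j%:R * (n.+1%:R * gc') + n.+1%:R * (j%:R * mu') - j%:R * gG.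
      by rewrite /dl; ring.
    have E2 : n.+1%:R * (j%:R * mu' - C) = n.+1%:R * (j%:R * mu') - n.+1%:R * C by ring.
    have := key j; rewrite E2; move: hj; rewrite E /K; lra.
  have : gv (g + n.+1%:R * mu') G1.
    have exC : vex gv (n.+1%:R * gc') (c'%:P ^+ n.+1) by apply: vexX; exact: polyC_ex.
    have G10 : G1 != 0.
      apply/eqP => G10; move/eqP: hG1; rewrite G10 mulr0 mulf_eq0 (negPf G0) orbF /= polyC_eq0.
      by rewrite -(rmorph0 io) (inj_eq io_inj) (negPf s10).
    have [b hb] := vf_ex gv G10; apply: vfW (proj1 hb).
    have h1 := vexM exC hb.
    have h2 : vex gv (g + gG) (c'%:P ^+ n.+1 * G1).
      by rewrite -hG1; apply: vexM => //; apply: polyC_ex; exact: vio.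
    have := vex_uniq h1 h2; lra.
  move=> /(_ i); congr (v _ _).
  have iN : (i <= n.+1)%N by exact: ltnW.
  have -> : g + n.+1%:R * mu' - mu' * i%:R = g + (n.+1 - i)%:R * mu' by rewrite natrB //; ring.
  by rewrite /mu' mulrBr [_ * (eps / _)]mulrC divfK ?lt0r_neq0 // addrA.
Qed.

End CharPoly.

(** * Monoid algebras and the group algebra of the real numbers *)

Section MonoidAlgebraTop.
Variables (K : nmodType) (A : comNzRingType) (I : A -> Prop) (lt : K -> K -> Prop).
Hypothesis I0 : I 0.
Hypothesis ID : forall a b, I a -> I b -> I (a + b).
Hypothesis IM : forall a b, I b -> I (a * b).
Hypothesis addKI : forall x y y' : K, x + y = x + y' -> y = y'.
Hypothesis lt_add : forall x x' y y', lt x' x -> lt y' y -> x' + y' <> x + y.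
Implicit Types a b : monoid_algebra K A.

Lemma ma_coef_supp a x : x \notin finsupp a -> ma_coef a x = 0.
Proof. exact: fsfun_dflt. Qed.

(** Any other pair with the same sum has a coefficient in the ideal I, as two strictly smaller
    indices cannot add up to x + y. It is used with I = 0 and with I prime. *)
Lemma ma_coefM_top a b x y :
    (forall x', x' <> x -> I (ma_coef a x') \/ lt x' x) ->
    (forall y', y' <> y -> I (ma_coef b y') \/ lt y' y) ->
  exists r, I r /\ ma_coef (a * b) (x + y) = ma_coef a x * ma_coef b y + r.
Proof.
move=> ha hb.
pose Dx := (finsupp a `|` [fset x])%fset; pose Dy := (finsupp b `|` [fset y])%fset.
have xD : x \in Dx by rewrite !inE eqxx orbT.
have yD : y \in Dy by rewrite !inE eqxx orbT.
have -> : ma_coef (a * b) (x + y) =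
    \sum_(x' <- Dx) \sum_(y' <- Dy) (ma_coef a x' * ma_coef b y') *+ (x' + y' == x + y).
  by apply: ma_mulEw; exact: fsubsetUl.
rewrite (big_fsetD1 x) //= (big_fsetD1 y) //= eqxx mulr1n -addrA.
eexists; split; last by [].
apply: ID.
  rewrite big_seq; elim/big_ind: _ => // y'; rewrite !inE => /andP[/eqP yy _].
  by case: eqP => [/addKI //|_]; rewrite mulr0n.
rewrite big_seq; elim/big_ind: _ => // x'; rewrite !inE => /andP[/eqP xx _].
elim/big_ind: _ => // y' _; case: eqP => [E|_]; last by rewrite mulr0n.
rewrite mulr1n; case: (ha _ xx) => [h|ltx]; first by rewrite mulrC; exact: IM.
have [yy|yy] := pselect (y' = y).
  by case: xx; apply: (@addKI y); rewrite ![y + _]addrC -E yy.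
by case: (hb _ yy) => [|lty]; [exact: IM|case: (lt_add ltx lty)].
Qed.

End MonoidAlgebraTop.

Section MonoidAlgebraMisc.
Variables (K : nmodType) (A : comNzRingType).
Implicit Types a b : monoid_algebra K A.

Lemma ma_coefN a x : ma_coef (- a) x = - ma_coef a x.
Proof. by rewrite -[- a]add0r ma_coefB ma_coef0 add0r. Qed.

Lemma ma_coef_sum (I : Type) (r : seq I) (P : pred I) (F : I -> monoid_algebra K A) x :
  ma_coef (\sum_(i <- r | P i) F i) x = \sum_(i <- r | P i) ma_coef (F i) x.
Proof.
apply: (big_morph (fun a => ma_coef a x)) => [a b|]; [exact: ma_coefD|exact: ma_coef0].
Qed.

Lemma ma_expand a : a = \sum_(x <- finsupp a) ma_monom x (ma_coef a x).
Proof.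
apply: ma_coefP => y; rewrite ma_coef_sum.
under eq_bigr => x _ do rewrite [ma_coef _ y]ma_monomE.
have [ya|ya] := boolP (y \in finsupp a).
  by rewrite (ma_sum_delta (fun x => ma_coef a x)).
rewrite ma_coef_supp // big_seq big1 // => x xa.
by case: eqP => // yx; rewrite yx xa in ya.
Qed.

Lemma ma_monomD x (s t : A) : ma_monom x (s + t) = ma_monom x s + ma_monom x t :> monoid_algebra K A.
Proof. by apply: ma_coefP => y; rewrite ma_coefD [LHS]ma_monomE !ma_monomE mulrnDl. Qed.

Lemma ma_monom0 x : ma_monom x 0 = 0 :> monoid_algebra K A.
Proof. by apply: ma_coefP => y; rewrite [LHS]ma_monomE ma_coef0 mul0rn. Qed.

Lemma ma_monom_sum x (I : Type) (r : seq I) (P : pred I) (F : I -> A) :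
  ma_monom x (\sum_(i <- r | P i) F i) = \sum_(i <- r | P i) ma_monom x (F i) :> monoid_algebra K A.
Proof.
apply: (big_morph (fun s => ma_monom x s)) => [s t|]; [exact: ma_monomD|exact: ma_monom0].
Qed.

Lemma ma_monomX x (s : A) j : ma_monom x s ^+ j = ma_monom (x *+ j) (s ^+ j) :> monoid_algebra K A.
Proof.
elim: j => [|j IH]; first by rewrite mulr0n !expr0.
by rewrite exprS IH mulrS exprS ma_monomM.
Qed.

End MonoidAlgebraMisc.

(* The group algebra k[R], with the valuation given by minus the largest exponent. *)
Definition real_alg (k : fieldType) (RR : realType) : Type := monoid_algebra RR k.

Section RealAlgebra.
Variables (k : fieldType) (RR : realType).
Local Notation D := (real_alg k RR).

HB.instance Definition _ := GRing.ComNzRing.on D.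

Lemma real_alg_top (a : D) : a != 0 -> exists x, ma_coef a x != 0 /\
  forall y, y <> x -> ma_coef a y = 0 \/ y < x.
Proof.
move=> a0; have [|x [_ xn xm]] := @seq_max _ _ (finsupp a) (fun x => ma_coef a x != 0).
  apply: contrapT => h; case/eqP: a0; apply: ma_coefP => x; rewrite ma_coef0.
  have [xa|/ma_coef_supp //] := boolP (x \in finsupp a).
  by apply/eqP; apply: contrapT => /negP xn; apply: h; exists x.
exists x; split=> // y yx; have [->|yn] := eqVneq (ma_coef a y) 0; first by left.
right; rewrite lt_neqAle; apply/andP; split; first exact/eqP.
apply: xm => //; apply: contraNT yn => /ma_coef_supp ->; exact: eqxx.
Qed.

Lemma real_alg_mul_top (a b : D) x y : 
  (forall x', x' <> x -> ma_coef a x' = 0 \/ x' < x) ->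
  (forall y', y' <> y -> ma_coef b y' = 0 \/ y' < y) ->
  ma_coef (a * b) (x + y) = ma_coef a x * ma_coef b y.
Proof.
move=> ha hb.
have [|||||r [-> E]] // := @ma_coefM_top RR k (fun z => z = 0) (fun x y => x < y) _ _ _ _ _ a b x y ha hb.
- by move=> ? ? -> ->; rewrite addr0.
- by move=> ? ? ->; rewrite mulr0.
- by move=> ? ? ?; exact: addrI.
- by move=> x1 x2 y1 y2 h1 h2 E; have := ltrD h1 h2; rewrite E ltxx.
by rewrite [LHS]E addr0.
Qed.

Lemma real_alg_domain (a b : D) : a * b = 0 -> (a == 0) || (b == 0).
Proof.
move=> ab; rewrite -[_ || _]negbK negb_or; apply/negP => /andP[/real_alg_top[x [xn hx]] /real_alg_top[y [yn hy]]].
have := real_alg_mul_top hx hy; rewrite ab ma_coef0 => /esym/eqP.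
by rewrite mulf_eq0 (negPf xn) (negPf yn).
Qed.

(** Units and inverses are chosen classically in order to equip D with the structure of an
    [idomainType]. *)
Definition real_alg_unit (a : D) : bool := `[< exists b, b * a = 1 >].
Definition real_alg_inv (a : D) : D :=
  if pselect (exists b, b * a = 1) is left h then projT1 (cid h) else a.

Fact real_alg_mulVr : {in real_alg_unit, left_inverse 1 real_alg_inv *%R}.
Proof.
move=> a /asboolP h; rewrite /real_alg_inv; case: pselect => // h'.
exact: (projT2 (cid h')).
Qed.

Fact real_alg_unitP (a b : D) : b * a = 1 -> real_alg_unit a.
Proof. by move=> h; apply/asboolP; exists b. Qed.

Fact real_alg_inv_out : {in [predC real_alg_unit], real_alg_inv =1 id}.
Proof.
move=> a /negP h; rewrite /real_alg_inv; case: pselect => // h'; case: h.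
exact/asboolP.
Qed.

HB.instance Definition _ := GRing.ComNzRing_hasMulInverse.Build D
  real_alg_mulVr real_alg_unitP real_alg_inv_out.
HB.instance Definition _ := GRing.ComUnitRing_isIntegral.Build D real_alg_domain.

Lemma real_alg_top_val (a : D) x l :
    (forall y, y <> x -> ma_coef a y = 0 \/ y < x) -> ma_coef a x != 0 ->
    (forall y, ma_coef a y != 0 -> l <= - y) ->
    ~ (exists m, l < m /\ forall y, ma_coef a y != 0 -> m <= - y) -> l = - x.
Proof.
move=> hx ax hl nl; apply/eqP; rewrite eq_le (hl _ ax) andTb leNgt.
apply/negP => lx; apply: nl; exists (- x); split=> // y ay; rewrite lerN2.
by have [->//|/hx[ay0|/ltW//]] := pselect (y = x); rewrite ay0 eqxx in ay.
Qed.

Definition real_alg_val : valfilt RR D.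
Proof.
apply: (@Valfilt _ _ (fun l (a : D) => forall x, ma_coef a x != 0 -> l <= - x)).
- by move=> l x; rewrite ma_coef0 eqxx.
- move=> l a b ha hb x; rewrite ma_coefD => ab.
  have [a0|] := eqVneq (ma_coef a x) 0; last exact: ha.
  by apply: hb; rewrite a0 add0r in ab.
- move=> l m a b ha hb z; rewrite ma_coefM => abz.
  apply: contrapT => /negP; rewrite -ltNge => zlm; case/eqP: abz.
  rewrite big1 // => x _; rewrite big1 // => y _; case: eqP => // xyz; rewrite mulr1n.
  have [->|ax] := eqVneq (ma_coef a x) 0; first by rewrite mul0r.
  have [->|by0] := eqVneq (ma_coef b y) 0; first by rewrite mulr0.
  by move: zlm; rewrite -xyz opprD ltNge lerD ?ha ?hb.
- by move=> l m a lm ha x /ha; exact: le_trans.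
- move=> a a0; have [x [xn hx]] := real_alg_top a0; exists (- x); split.
    move=> y yn; rewrite lerN2.
    by have [->//|/hx[ay0|/ltW//]] := pselect (y = x); rewrite ay0 eqxx in yn.
  by move=> [m [xm /(_ _ xn)]]; rewrite leNgt xm.
- move=> l m a b ha hb [l' [ll' h]].
  have nz (c : D) t : ~ (exists m, t < m /\ forall y, ma_coef c y != 0 -> m <= - y) -> c != 0.
    move=> n; apply/eqP => c0; apply: n; exists (t + 1); split; first by rewrite ltrDl.
    by move=> y; rewrite c0 ma_coef0 eqxx.
  have a0 := nz _ _ (proj2 ha); have b0 := nz _ _ (proj2 hb).
  have [x [xn hx]] := real_alg_top a0; have [y [yn hy]] := real_alg_top b0.
  have := h (x + y); rewrite (real_alg_mul_top hx hy) mulf_neq0 // => /(_ isT).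
  case: ha hb => [ha1 ha2] [hb1 hb2].
  move: ll'; rewrite (real_alg_top_val hx xn ha1 ha2) (real_alg_top_val hy yn hb1 hb2).
  by rewrite leNgt opprD => ->.
Defined.

Lemma real_alg_valE l (a : D) : real_alg_val l a <-> forall x, ma_coef a x != 0 -> l <= - x.
Proof. exact: iff_refl. Qed.

Lemma real_alg_val_monom x (c : k) : real_alg_val (- x) (ma_monom x c).
Proof.
move=> y; rewrite (ma_monomE x c y : ma_coef _ _ = _).
by have [->//|_] := eqVneq y x; rewrite mulr0n eqxx.
Qed.

Lemma real_alg_vex_monom x (c : k) : c != 0 -> vex real_alg_val (- x) (ma_monom x c).
Proof.
move=> c0; split; first exact: real_alg_val_monom.
move=> [m [xm /(_ x)]]; rewrite [ma_coef _ _]ma_monomE eqxx mulr1n c0 => /(_ isT).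
by rewrite leNgt xm.
Qed.

(* Modulo elements of positive valuation, an element of nonnegative valuation is
   its coefficient at 0. *)
Lemma real_alg_residue (a : D) : real_alg_val 0 a ->
  vgt real_alg_val 0 (a - ma_monom 0 (ma_coef a 0)).
Proof.
move=> ha; set b := a - _.
have hb : real_alg_val 0 b by apply: vfB => //; have := @real_alg_val_monom 0 (ma_coef a 0); rewrite oppr0.
have [[_ n]|//] := vex_or hb.
have b0 : b != 0 by apply/eqP => b0; apply: n; rewrite b0; exact: vgt0.
have [l hl] := vf_ex real_alg_val b0.
exists l; split; last by case: hl.
have [x [xn hx]] := real_alg_top b0.
have xneg : x < 0.
  have := hb _ xn; rewrite oppr_ge0 le_eqVlt => /predU1P[x0|//].
  by move: xn; rewrite x0 /b ma_coefB [ma_coef (ma_monom _ _) _]ma_monomE eqxx mulr1n subrr eqxx.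
have : real_alg_val (- x) b.
  move=> y yn; rewrite lerN2.
  by have [->//|/hx[ay0|/ltW//]] := pselect (y = x); rewrite ay0 eqxx in yn.
move=> /(vex_le hl) xl; apply: lt_le_trans xl; by rewrite oppr_gt0.
Qed.

End RealAlgebra.

(** * Noether normalization for homogeneous ideals *)

Lemma mpoly_alg_ind n (R : comNzRingType) (Q : mpoly n R -> Prop) :
  (forall c, Q (mpolyC n c)) -> (forall i, Q 'X_i) ->
  (forall p q, Q p -> Q q -> Q (p + q)) -> (forall p q, Q p -> Q q -> Q (p * q)) ->
  forall p, Q p.
Proof.
move=> QC QX QD QM p; rewrite (mpolyE p).
apply: (@big_ind _ Q) => [||m _]; [|exact: QD|].
  by have := QC 0; rewrite mpolyC0.
have Q1 : Q 1 by have := QC 1; rewrite mpolyC1.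
have QXn i e : Q ('X_i ^+ e).
  by elim: e => [|e IH]; [rewrite expr0|rewrite exprS; exact: QM].
rewrite -mul_mpolyC; apply: (QM) => //; rewrite mpolyXE_id.
by apply: (@big_ind _ Q) => //; exact: QM.
Qed.

Lemma mpoly_nonzero_point (k : fieldType) n (p : mpoly n k) :
  (forall q : {poly k}, q != 0 -> exists x, q.[x] != 0) -> p != 0 ->
  exists v : 'I_n -> k, meval v p != 0.
Proof.
move=> inf; elim: n p => [|n IH] p p0.
  exists (fun=> 0); rewrite (nvar0_mpolyC p) mevalC.
  by apply: contraNneq p0 => h; rewrite (nvar0_mpolyC p) h mpolyC0.
pose g := to_main_var k (ord_max : 'I_n.+1).
have gp0 : g p != 0.
  by apply: contra_neq p0 => h; rewrite -[p](to_main_varK ord_max) -/g h rmorph0.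
have [|v hv] := IH (lead_coef (g p)); first by rewrite lead_coef_eq0.
pose q := map_poly (meval v) (g p).
have q0 : q != 0.
  apply: contraNneq hv => q0; rewrite -[meval v _]coef_map -/q q0 coef0 //.
have [x hx] := inf q q0.
exists (fun i => if unlift ord_max i is Some j then v j else x).
suff -> : meval (fun i => if unlift ord_max i is Some j then v j else x) p = q.[x] by [].
pose f1 : {rmorphism mpoly n.+1 k -> k} := meval (fun i => if unlift ord_max i is Some j then v j else x).
pose f2 : {rmorphism mpoly n.+1 k -> k} := horner_eval x \o (map_poly (meval v) \o g).
apply: (@mpoly_rmorph_ext _ _ _ f1 f2) => [c|i]; rewrite /f1 /f2 /= /horner_eval.
  by rewrite mevalC to_main_varC map_polyC /= mevalC hornerC.
rewrite mevalXU to_main_varX; case: unliftP => [j _|_].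
  by rewrite map_polyC /= mevalXU hornerC.
by rewrite map_polyX hornerX.
Qed.

Section Homogeneous.
Variables (n : nat) (R : comNzRingType).
Implicit Types p q : mpoly n R.

Definition hpart m p : mpoly n R := pihomog mdeg m p.
Definition hom m p := hpart m p = p.

Lemma hpartD m p q : hpart m (p + q) = hpart m p + hpart m q.
Proof. exact: pihomogD. Qed.

Lemma hpartB m p q : hpart m (p - q) = hpart m p - hpart m q.
Proof. exact: pihomogB. Qed.

Lemma hpart_sum m (I : Type) (r : seq I) (P : pred I) (F : I -> mpoly n R) :
  hpart m (\sum_(i <- r | P i) F i) = \sum_(i <- r | P i) hpart m (F i).
Proof. exact: raddf_sum. Qed.

Lemma hpartX m a : hpart m (mpolyX R a) = if mdeg a == m then mpolyX R a else 0.
Proof. exact: pihomogX. Qed.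

Lemma hpartZ m c p : hpart m (c *: p) = c *: hpart m p.
Proof. exact: linearZ. Qed.

Lemma homP m p : hom m p <-> (forall a, a \in msupp p -> mdeg a = m).
Proof.
split=> [h a|h]; last by apply: pihomog_dE; apply/dhomogP => a /h.
rewrite -h; have /dhomogP := pihomogP mdeg m p; exact.
Qed.

Lemma hom_hpart m p : hom m (hpart m p).
Proof. exact: pihomog_id. Qed.

Lemma hom_other m m' p : hom m p -> m != m' -> hpart m' p = 0.
Proof. by move=> /homP h mm; apply: pihomog_ne0 mm _; apply/dhomogP => a /h. Qed.

Lemma homM m m' p q : hom m p -> hom m' q -> hom (m + m') (p * q).
Proof.
move=> /homP hp /homP hq; apply/homP => a /msuppM_le/allpairsP[[b c] /= [/hp <- /hq <- ->]].
exact: mdegD.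
Qed.

Lemma hom_sum m (I : Type) (r : seq I) (P : pred I) (F : I -> mpoly n R) :
  (forall i, P i -> hom m (F i)) -> hom m (\sum_(i <- r | P i) F i).
Proof. by move=> h; rewrite /hom hpart_sum; apply: eq_bigr => i /h. Qed.

Lemma homZ m c p : hom m p -> hom m (c *: p).
Proof. by rewrite /hom hpartZ => ->. Qed.

Lemma homX m a : mdeg a = m -> hom m (mpolyX R a).
Proof. by rewrite /hom hpartX => ->; rewrite eqxx. Qed.

Lemma hom1 : hom 0 1.
Proof. by rewrite -mpolyX0; apply: homX; exact: mdeg0. Qed.

Lemma hparts p : exists N, p = \sum_(m < N) hpart m p.
Proof. by exists (msize p); apply: pihomog_partitionE. Qed.

Lemma hpartM m m' u p : hom m u -> hpart (m + m') (u * p) = u * hpart m' p.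
Proof.
move=> hu; have [N hN] := hparts p; rewrite [in LHS]hN mulr_sumr hpart_sum.
rewrite [in RHS]hN hpart_sum mulr_sumr; apply: eq_bigr => i _.
have hi := homM hu (hom_hpart i p).
have [<-|im] := eqVneq (i : nat) m'; first by rewrite hi hom_hpart.
rewrite (hom_other (hom_hpart i p) im) mulr0 (hom_other hi) //.
by rewrite eqn_add2l.
Qed.

End Homogeneous.

Lemma hpart_eval n d (R : comNzRingType) (f : {rmorphism mpoly d R -> mpoly n R}) m :
  (forall c, f (mpolyC d c) = mpolyC n c) -> (forall i, hom 1 (f 'X_i)) ->
  forall p, hpart m (f p) = f (hpart m p).
Proof.
move=> fC fX p; rewrite (mpolyE p) rmorph_sum !hpart_sum rmorph_sum; apply: eq_bigr => a _.
have fa : hom (mdeg a) (f (mpolyX R a)).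
  rewrite mpolyXE_id mdegE rmorph_prod; elim/big_ind2: _ => [|m1 p1 m2 p2|i _].
  - exact: hom1.
  - by move=> h1 h2; rewrite mulrC addnC; exact: homM.
  - rewrite rmorphXn; elim: (a i) => [|l IH]; first exact: hom1.
    by rewrite exprS -add1n; exact: homM.
have fZ c (q : mpoly d R) : f (c *: q) = c *: f q.
  by rewrite -!mul_mpolyC rmorphM fC.
rewrite !fZ !hpartZ fZ hpartX; case: eqP => [am|/eqP am]; first by rewrite -am fa.
by rewrite (hom_other fa am) rmorph0.
Qed.

Section Noether.
Variables (k : fieldType) (n : nat) (J : mpoly n k -> Prop).
Hypothesis inf : forall q : {poly k}, q != 0 -> exists x, q.[x] != 0.
Hypothesis J0 : J 0.
Hypothesis JD : forall p q, J p -> J q -> J (p + q).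
Hypothesis JM : forall p q, J q -> J (p * q).
Hypothesis JH : forall m p, J p -> J (hpart m p).
Hypothesis J1 : ~ J 1.
Local Notation S := (mpoly n k).

Definition Jspan d (Y : 'I_d -> S) (p : S) := exists b : 'I_d -> S,
  J (p - \sum_j Y j * b j).

Lemma JspanD d (Y : 'I_d -> S) p q : Jspan Y p -> Jspan Y q -> Jspan Y (p + q).
Proof.
move=> [b hb] [c hc]; exists (fun j => b j + c j).
under eq_bigr => j _ do rewrite mulrDr.
by rewrite big_split opprD addrACA; exact: JD.
Qed.

Lemma JspanM d (Y : 'I_d -> S) p q : Jspan Y q -> Jspan Y (p * q).
Proof.
move=> [b hb]; exists (fun j => p * b j).
under eq_bigr => j _ do rewrite mulrCA.
by rewrite -mulr_sumr -mulrBr; exact: JM.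
Qed.

Lemma JspanJ d (Y : 'I_d -> S) p : J p -> Jspan Y p.
Proof.
by move=> hp; exists (fun=> 0); rewrite big1 ?subr0 // => j _; rewrite mulr0.
Qed.

Lemma Jspan_id d (Y : 'I_d -> S) i : Jspan Y (Y i).
Proof.
exists (fun j => (j == i)%:R); rewrite (bigD1 i) //= eqxx mulr1 big1 ?addr0 ?subrr //.
by move=> j /negPf ->; rewrite mulr0.
Qed.

Lemma Jspan_sum d (Y : 'I_d -> S) (I : Type) (r : seq I) (P : pred I) F :
  (forall i, P i -> Jspan Y (F i)) -> Jspan Y (\sum_(i <- r | P i) F i).
Proof.
by move=> h; elim/big_ind: _ => //; [exact: JspanJ|exact: JspanD].
Qed.

(** Linear forms such that S / (J + (Y)) vanishes in degrees at least r, hence over which S / J is a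
    finite module. *)
Definition system d (Y : 'I_d -> S) := (forall j, hom 1 (Y j)) /\
  exists r, forall l p, (r <= l)%N -> hom l p -> Jspan Y p.

Lemma system_hom d (Y : 'I_d -> S) l p : (forall j, hom 1 (Y j)) -> hom l.+1 p ->
  Jspan Y p -> exists b : 'I_d -> S, (forall j, hom l (b j)) /\ J (p - \sum_j Y j * b j).
Proof.
move=> hY hp [b hb]; exists (fun j => hpart l (b j)); split=> [j|]; first exact: hom_hpart.
have := JH l.+1 hb; rewrite hpartB hp hpart_sum.
by congr (J (_ - _)); apply: eq_bigr => j _; rewrite -add1n hpartM.
Qed.

Lemma system_var : exists Y : 'I_n -> S, system Y.
Proof.
exists (fun i => 'X_i); split=> [j|]; first by apply: homX; exact: mdeg1.
exists 1%N => l p l0 /homP hp; rewrite (mpolyE p) big_seq; apply: Jspan_sum => a /hp am.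
rewrite -mul_mpolyC; apply: JspanM.
have [i ai] : exists i, a i != 0%N.
  apply: contrapT => h; move: l0; rewrite -am mdegE big1 // => i _.
  by apply/eqP; apply: contrapT => /negP ai; apply: h; exists i.
have -> : mpolyX k a = mpolyX k (mnm_sub a (mnm1 i)) * 'X_i.
  by rewrite -mpolyXD submK // lep1mP.
exact/JspanM/Jspan_id.
Qed.

Lemma system_step d (Y : 'I_d -> S) (f : {rmorphism mpoly d k -> S}) F :
    system Y -> (forall c, f (mpolyC d c) = mpolyC n c) -> (forall i, f 'X_i = Y i) ->
    F != 0 -> J (f F) ->
  exists d' (Y' : 'I_d' -> S), (d' < d)%N /\ system Y'.
Proof.
move=> [hY [r hr]] fC fX F0 JF.
have fH m p : hpart m (f p) = f (hpart m p).
  by apply: hpart_eval => // i; rewrite fX.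
have [m Fm0] : exists m, hpart m F != 0.
  apply: contrapT => h; case/eqP: F0; have [N ->] := hparts F; apply: big1 => m _.
  by apply/eqP; apply: contrapT => /negP hm; apply: h; exists (m : nat).
have JFm : J (f (hpart m F)) by rewrite -fH; exact: JH.
have [v hv] := mpoly_nonzero_point inf Fm0.
have hFm := hom_hpart m F; set Q := hpart m F in Fm0 JFm hv hFm.
have scale (c : k) (u : 'I_d -> k) : meval (fun i => c * u i) Q = c ^+ m * meval u Q.
  rewrite (mpolyE Q) !(rmorph_sum (meval _)) mulr_sumr; apply: eq_big_seq => a /(proj1 (homP _ _) hFm) am.
  rewrite -mul_mpolyC !(rmorphM (meval _)) /= !mevalC mulrCA; congr (_ * _).
  rewrite mpolyXE_id !(rmorph_prod (meval _)) -am mdegE -prodrXr -big_split; apply: eq_bigr => i _.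
  by rewrite !(rmorphXn (meval _)) /= !mevalXU exprMn.
have Jinv (c : k) : c != 0 -> J (mpolyC n c) -> False.
  move=> c0 /(JM (mpolyC n c^-1)); rewrite -mpolyCM mulVf // mpolyC1.
(* At v = 0, homogeneity would make Q a nonzero constant, and J would contain 1. *)
have [[i0 vi0]|v0] := pselect (exists i, v i != 0); last first.
  have vE : v = (fun i => 0 * v i).
    apply/funext => i; rewrite mul0r; apply/eqP; apply: contrapT => /negP vi.
    by apply: v0; exists i.
  have m0 : m = 0%N.
    apply/eqP; apply: contraTT hv => m0.
    by rewrite vE scale expr0n (negPf m0) mul0r eqxx.
  have Qc : Q = mpolyC d (mcoeff mnm0 Q).
    apply/mpolyP => a; rewrite mcoeffC.
    case: eqP => [->|/eqP an]; first by rewrite mulr1.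
    rewrite mulr0; apply: memN_msupp_eq0; apply/negP => /(proj1 (homP _ _) hFm).
    by rewrite m0 => /eqP; rewrite mdeg_eq0 => /eqP h; rewrite h eqxx in an.
  case: (@Jinv (mcoeff mnm0 Q)); last by rewrite -fC -Qc.
  by apply: contraNneq Fm0 => h; rewrite Qc h mpolyC0.
pose u i := (v i0)^-1 * v i.
have Qu : meval u Q != 0 by rewrite scale mulf_neq0 // expf_neq0 // invr_neq0.
have ui0 : u i0 = 1 by rewrite /u mulVf.
have [d' ed] : exists d', d = d'.+1 by exists d.-1; rewrite prednK // (leq_ltn_trans _ (ltn_ord i0)).
subst d; rename d' into d.
pose Y' (j : 'I_d) := Y (lift i0 j) - u (lift i0 j) *: Y i0.
exists d, Y'; split=> //.
have YY' j : Jspan Y' (Y j - u j *: Y i0).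
  case: (unliftP i0 j) => [j' ->|->]; first exact: Jspan_id.
  by rewrite ui0 scale1r subrr; exact: JspanJ.
split=> [j|]; first by rewrite /hom /Y' hpartB hpartZ !hY.
have [g gC gX] := mpoly_eval (mpolyC n (R := k) : {rmorphism k -> S}) (fun j : 'I_d.+1 => u j *: Y i0).
have congrY p : Jspan Y' (f p - g p).
  elim/mpoly_alg_ind: p => [c|i|p q hp hq|p q hp hq].
  - by rewrite fC gC subrr; exact: JspanJ.
  - by rewrite fX gX; exact: YY'.
  - by rewrite !rmorphD opprD addrACA; exact: JspanD.
  - have -> : f (p * q) - g (p * q) = f p * (f q - g q) + g q * (f p - g p).
      by rewrite !rmorphM; ring.
    by apply: JspanD; exact: JspanM.
have gQ : g Q = mpolyC n (meval u Q) * Y i0 ^+ m.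
  rewrite (mpolyE Q) (rmorph_sum g) (rmorph_sum (meval u)) (rmorph_sum (mpolyC n (R := k))) /= mulr_suml.
  apply: eq_big_seq => a /(proj1 (homP _ _) hFm) am.
  rewrite -mul_mpolyC (rmorphM g) (rmorphM (meval _)) (rmorphM (mpolyC n (R := k))) /= gC mevalC -mulrA; congr (_ * _).
  rewrite mpolyXE_id (rmorph_prod g) (rmorph_prod (meval _)) (rmorph_prod (mpolyC n (R := k))) -am mdegE -prodrXr -big_split; apply: eq_bigr => i _.
  by rewrite (rmorphXn g) (rmorphXn (meval _)) (rmorphXn (mpolyC n (R := k))) /= gX mevalXU -mul_mpolyC exprMn.
have Ym : Jspan Y' (Y i0 ^+ m).
  have -> : Y i0 ^+ m = mpolyC n (meval u Q)^-1 * (f Q - (f Q - g Q)).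
    by rewrite subKr gQ mulrA -mpolyCM mulVf // mpolyC1 mul1r.
  apply: JspanM; apply: JspanD; first exact: JspanJ.
  by rewrite -mulN1r; exact: JspanM.
(* Each degree above r splits off one factor Y_i0, because modulo Y' every Y_j is a multiple of it.
   From t = m on, the power itself lies in the ideal. *)
have key t : forall p, hom (r + t) p -> exists q, Jspan Y' (p - Y i0 ^+ t * q).
  elim: t => [|t IH] p hp.
    by exists p; rewrite expr0 mul1r subrr; exact: JspanJ.
  have [b [hb Jb]] : exists b : 'I_d.+1 -> S,
      (forall j, hom (r + t) (b j)) /\ J (p - \sum_j Y j * b j).
    apply: system_hom => //; first by rewrite -addnS.
    by apply: hr hp; exact: leq_addr.
  have [|q hq] := IH (\sum_j u j *: b j).
    by apply: hom_sum => j _; exact: homZ.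
  exists q.
  have -> : p - Y i0 ^+ t.+1 * q = (p - \sum_j Y j * b j) +
      (\sum_j b j * (Y j - u j *: Y i0) + Y i0 * (\sum_j u j *: b j - Y i0 ^+ t * q)).
    have -> : \sum_j b j * (Y j - u j *: Y i0) = \sum_j Y j * b j - Y i0 * \sum_j u j *: b j.
      rewrite mulr_sumr -sumrB; apply: eq_bigr => j _.
      by rewrite -!mul_mpolyC; ring.
    by rewrite exprS; ring.
  apply: JspanD; first exact: JspanJ.
  by apply: JspanD; [apply: Jspan_sum => j _; exact: JspanM|exact: JspanM].
exists (r + m)%N => l p rl hp.
have [|q hq] := @key (l - r)%N p.
  by rewrite subnKC // (leq_trans _ rl) // leq_addr.
rewrite -[p](subrK (Y i0 ^+ (l - r) * q)); apply: JspanD => //.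
rewrite mulrC; apply: JspanM.
have -> : (l - r = (l - r - m) + m)%N by rewrite subnK // leq_subRL // (leq_trans _ rl) // leq_addr.
by rewrite exprD; exact: JspanM.
Qed.

(** A system of minimal length is algebraically independent modulo J, since [system_step] would
    shorten any other. *)
Lemma noether_normalization : exists d (Y : 'I_d -> S), 
  [/\ forall j, hom 1 (Y j),
      exists r, forall l p, (r <= l)%N -> hom l p -> Jspan Y p
    & forall (f : {rmorphism mpoly d k -> S}) F, (forall c, f (mpolyC d c) = mpolyC n c) ->
      (forall i, f 'X_i = Y i) -> J (f F) -> F = 0].
Proof.
have ex : exists d, `[< exists Y : 'I_d -> S, system Y >].
  by exists n; apply/asboolP; exact: system_var.
case: (ex_minnP ex) => d /asboolP[Y sY] dmin; exists d, Y.
case: (sY) => hY hr; split=> // f F fC fX JF; apply: contrapT => /eqP F0.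
have [d' [Y' [dd' sY']]] := system_step sY fC fX F0 JF.
by have := dmin d' (asboolT (ex_intro _ Y' sY')); rewrite leqNgt dd'.
Qed.

End Noether.

(** * Nakayama over a valuation ring, growth of powers *)

Section Nakayama.
Variables (RR : realType) (D : idomainType) (v : valfilt RR D).

Lemma vf_unit_det m (B : 'M[D]_m) : (forall i j, vgt v 0 (B i j)) -> vex v 0 (\det (1%:M - B)).
Proof.
move=> hB; pose eqv (a b : D) := [/\ v 0 a, v 0 b & vgt v 0 (a - b)].
have eqv_refl a : v 0 a -> eqv a a by move=> ha; split=> //; rewrite subrr; exact: vgt0.
have eqvD a b a' b' : eqv a b -> eqv a' b' -> eqv (a + a') (b + b').
  move=> [h1 h2 h3] [h1' h2' h3']; split; [exact: vfD|exact: vfD|].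
  by rewrite opprD addrACA; exact: vgtD.
have eqvM a b a' b' : eqv a b -> eqv a' b' -> eqv (a * a') (b * b').
  move=> [h1 h2 h3] [h1' h2' h3']; rewrite /eqv -[0](addr0 (0 : RR)); split; [exact: vfM|exact: vfM|].
  have -> : a * a' - b * b' = a * (a' - b') + (a - b) * b' by ring.
  by apply: vgtD; [exact: vgtM|exact: vgtMr].
have v1 : v 0 1 by case: (vex1 v).
have ev : eqv (\det (1%:M - B)) (\det (1%:M : 'M[D]_m)).
  apply: (@big_ind2 _ _ eqv) => [|a b a' b'|g _]; [exact: eqv_refl (vf0 _ _)|exact: eqvD|].
  apply: (eqvM).
    by apply: (eqv_refl); have := vfX (nat_of_bool (odd_perm g)) (proj1 (vexN1 v)); rewrite mulr0.
  apply: (@big_ind2 _ _ eqv) => [|a b a' b'|i _]; [exact: eqv_refl|exact: eqvM|].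
  have h0 : v 0 ((1%:M : 'M[D]_m) i (g i)) by rewrite mxE; case: eqP => _ //; exact: vf0.
  rewrite mxE; set x := (1%:M : 'M[D]_m) i (g i) in h0 *.
  have hN : vgt v 0 ((- B) i (g i)) by rewrite mxE; exact: vgtN.
  split=> //; first exact: vfD (vgtW hN).
  by rewrite addrAC subrr add0r.
have [_ _ h] := ev; rewrite det1 in h.
by rewrite -[X in vex _ _ X](subrK 1) addrC; apply: vexD => //; exact: vex1.
Qed.

Variables (Om : comNzRingType) (io : {rmorphism D -> Om}) (W : Om -> Prop).
Hypothesis W0 : W 0.
Hypothesis WD : forall a b, W a -> W b -> W (a + b).
Hypothesis WM : forall t a, v 0 t -> W a -> W (io t * a).

(** Multiplication by the adjugate of 1 - B replaces its inverse. The determinant is 1 plus an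
    element of positive valuation, which has valuation 0 but need not be invertible in D; it becomes
    the scalar s. *)
Lemma nakayama (I : finType) (E : I -> Om) (B : I -> I -> D) : (forall i j, vgt v 0 (B i j)) ->
    (forall i, W (E i - \sum_j io (B i j) * E j)) ->
  exists2 s, vex v 0 s & forall i, W (io s * E i).
Proof.
move=> hB hW; pose m := #|I|.
pose K : 'M[D]_m := \matrix_(i, j) B (enum_val i) (enum_val j).
pose M := 1%:M - K.
have hK i j : vgt v 0 (K i j) by rewrite mxE.
exists (\det M) => [|i]; first exact: vf_unit_det.
have vM i' j' : v 0 (M i' j').
  rewrite mxE; apply: vfD; last by rewrite mxE; exact: vfN (vgtW (hK _ _)).
  by rewrite mxE; case: eqP => _; [case: (vex1 v)|exact: vf0].
have vadj i' j' : v 0 ((\adj M) i' j').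
  rewrite mxE /cofactor -[0](addr0 0); apply: vfM.
    by have := vfX (j' + i') (proj1 (vexN1 v)); rewrite mulr0.
  have := @vf_det _ _ v m.-1 0 (row' j' (col' i' M)); rewrite mulr0; apply.
  by move=> a b; have := vM (lift j' a) (lift i' b); rewrite !mxE.
have row j : W (\sum_l io (M j l) * E (enum_val l)).
  suff -> : \sum_l io (M j l) * E (enum_val l) = E (enum_val j) - \sum_i io (B (enum_val j) i) * E i by [].
  under eq_bigr => l _ do rewrite !mxE rmorphB mulrBl.
  rewrite sumrB; congr (_ - _).
    rewrite (bigD1 j) //= eqxx mulr1n rmorph1 mul1r big1 ?addr0 // => l lj.
    by rewrite eq_sym (negPf lj) rmorph0 mul0r.
  by rewrite [RHS](reindex (@enum_val I I)) //=; apply: onW_bij; exact: enum_val_bij.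
have -> : io (\det M) * E i = \sum_j io ((\adj M) (enum_rank i) j) * \sum_l io (M j l) * E (enum_val l).
  under eq_bigr => j _ do rewrite mulr_sumr.
  rewrite exchange_big /=.
  rewrite (eq_bigr (fun l => io ((\adj M *m M) (enum_rank i) l) * E (enum_val l))) => [|l _]; last first.
    rewrite mxE rmorph_sum mulr_suml; apply: eq_bigr => j _.
    by rewrite rmorphM mulrA.
  rewrite mul_adj_mx (bigD1 (enum_rank i)) //= enum_rankK mxE eqxx mulr1n big1 ?addr0 // => l il.
  by rewrite mxE eq_sym (negPf il) mulr0n rmorph0 mul0r.
by elim/big_ind: _ => // j _; exact: WM.
Qed.

End Nakayama.

(** * Growth of powers with respect to a filtration *)

Section Growth.
Variables (RR : realType) (M : comNzRingType) (F : RR -> M -> Prop) (r1 : RR).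
Hypothesis FW : forall l m u, l <= m -> F m u -> F l u.
Hypothesis F0 : forall l, F l 0.
Hypothesis FD : forall l u v, F l u -> F l v -> F l (u + v).
Hypothesis FM : forall l m u v, F l u -> F m v -> F (l + m) (u * v).
Hypothesis F1 : F r1 1.

Lemma filt_sum l (I : Type) (r : seq I) (P : pred I) f :
  (forall i, P i -> F l (f i)) -> F l (\sum_(i <- r | P i) f i).
Proof. by move=> hf; apply: (@big_ind _ (F l)) => //; exact: FD. Qed.

Lemma filt_power l u j : F l u -> F ((j.+1)%:R * l) (u ^+ j.+1).
Proof.
move=> hu; elim: j => [|j IH]; first by rewrite mul1r expr1.
by rewrite exprS -add1n natrD mulrDl mul1r; exact: FM.
Qed.

(** The error C does not depend on j; in the binomial expansion of a sum the two errors just add up,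
    so elements of a given slope are closed under addition. *)
Definition grows mu u := exists C : RR, forall j, F (j%:R * mu - C) (u ^+ j).

Lemma growsW mu mu' u : mu' <= mu -> grows mu u -> grows mu' u.
Proof.
move=> mm [C hC]; exists C => j; apply: FW (hC j).
by rewrite lerD2r ler_wpM2l.
Qed.

Lemma growsD mu u v : grows mu u -> grows mu v -> grows mu (u + v).
Proof.
move=> [C hC] [C' hC']; exists (C + C') => j; rewrite exprDn; apply: filt_sum => i _.
have -> : j%:R * mu - (C + C') = ((j - i)%:R * mu - C) + (i%:R * mu - C').
  have -> : j%:R = (j - i)%:R + i%:R :> RR by rewrite -natrD subnK // -ltnS.
  by ring.
have := FM (hC (j - i)%N) (hC' i); elim: 'C(j, i) => [|b IH] h; first exact: F0.
by rewrite mulrS; apply: FD => //; exact: IH.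
Qed.

Lemma grows0 mu : grows mu 0.
Proof.
exists (- r1) => j; case: j => [|j]; last by rewrite expr0n.
by rewrite mul0r opprK add0r expr0.
Qed.

Lemma growsM mu mu' u v : grows mu u -> grows mu' v -> grows (mu + mu') (u * v).
Proof.
move=> [C hC] [C' hC']; exists (C + C') => j; rewrite exprMn.
by have := FM (hC j) (hC' j); rewrite mulrDr opprD addrACA.
Qed.

(** Divide j by d with remainder: the finitely many remainders cost a bounded error. *)
Lemma grows_power mu u d l : (0 < d)%N -> F (d%:R * mu) (u ^+ d) -> F l u -> grows mu u.
Proof.
move=> d0 hd hl.
have low (r : nat) : exists c, forall r', (r' < r)%N -> F (r'%:R * mu - c) (u ^+ r').
  elim: r => [|r [c hc]]; first by exists 0.
  have [b hb] : exists b, F b (u ^+ r).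
    by case: (r) => [|r']; [exists r1|exists (r'.+1%:R * l); exact: filt_power].
  exists (Num.max c (r%:R * mu - b)) => r'; rewrite ltnS leq_eqVlt => /predU1P[->|/hc h].
    by apply: FW hb; rewrite lerBlDr -lerBlDl le_max lexx orbT.
  by apply: FW h; rewrite lerD2l lerN2 le_max lexx.
have [c hc] := low d; exists c => j.
have rd : (j %% d < d)%N by rewrite ltn_mod.
rewrite (divn_eq j d) natrD natrM exprD mulrDl -addrA.
have := hc _ rd; case: (j %/ d)%N => [|q] h; first by rewrite mul0n expr0 mul1r !mul0r add0r.
by apply: FM => //; rewrite mulnC exprM -mulrA; exact: filt_power.
Qed.

(** Giving up mu - mu' per factor pays for C once the exponent is at least C / (mu - mu'). All
    multiples of d qualify, so exponents for several elements can be made equal. *)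
Lemma grows_filt mu mu' u : mu' < mu -> grows mu u ->
  exists2 d, (0 < d)%N & forall j, (0 < j)%N -> F ((j * d)%:R * mu') (u ^+ (j * d)).
Proof.
move=> mm [C hC]; pose d := (Num.bound (`|C| / (mu - mu'))).+1; exists d => // j j0.
have dC : C <= d%:R * (mu - mu').
  have C0 : 0 <= `|C| / (mu - mu') by rewrite divr_ge0 // subr_ge0 ltW.
  rewrite -ler_pdivrMr ?subr_gt0 //; apply: le_trans (_ : `|C| / (mu - mu') <= _).
    by rewrite ler_wpM2r ?ler_norm // invr_ge0 subr_ge0 ltW.
  by apply/ltW/(lt_trans (archi_boundP C0)); rewrite ltr_nat.
apply: FW (hC _); rewrite lerBrDr -lerBrDl -mulrBr; apply: le_trans dC _.
by rewrite ler_wpM2r ?ler_nat ?leq_pmull // subr_ge0 ltW.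
Qed.

Lemma grows_root mu mu' u j : (0 < j)%N -> mu' < mu -> (exists l, F l u) ->
  grows (j%:R * mu) (u ^+ j) -> grows mu' u.
Proof.
move=> j0 mm [l hl] /(@grows_filt _ (j%:R * mu'))[|d d0 hd].
  by rewrite ltr_pM2l ?ltr0n.
apply: (@grows_power _ _ (j * d)) hl; first by rewrite muln_gt0 j0.
have := hd 1%N isT; rewrite mul1n -exprM natrM => h.
by rewrite -mulrA mulrCA.
Qed.

End Growth.

Section RealAlgebraMaps.
Variables (k : fieldType) (RR : realType) (A : comAlgType k).
Local Notation D := (real_alg k RR).
Local Notation MA := (monoid_algebra (nat * RR)%type A).

Definition real_alg_const (c : k) : D := ma_monom 0 c.

Fact real_alg_const_zmod : zmod_morphism real_alg_const.
Proof.
move=> a b; apply: ma_coefP => x; rewrite ma_coefB !ma_monomE.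
by case: eqP; rewrite ?mulr1n // !mulr0n subrr.
Qed.

Fact real_alg_const_monoid : monoid_morphism real_alg_const.
Proof.
split=> [//|a b]; rewrite /real_alg_const.
by rewrite [RHS](ma_monomM (0 : RR) 0 a b) addr0.
Qed.

HB.instance Definition _ := GRing.isZmodMorphism.Build k D real_alg_const real_alg_const_zmod.
HB.instance Definition _ := GRing.isMonoidMorphism.Build k D real_alg_const real_alg_const_monoid.

Definition ma_of_real (a : D) : MA :=
  \sum_(x <- finsupp a) ma_monom (0%N, x) (ma_coef a x)%:A.

Lemma ma_of_realE a m x : ma_coef (ma_of_real a) (m, x) = (ma_coef a x)%:A *+ (m == 0)%N.
Proof.
rewrite /ma_of_real ma_coef_sum.
under eq_bigr => y _ do rewrite ma_monomE xpair_eqE.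
case: eqP => [_|_] /=; last by rewrite big1 // => y _; rewrite mulr0n.
rewrite mulr1n; have [xa|xa] := boolP (x \in finsupp a); last first.
  rewrite big_seq big1 ?(ma_coef_supp xa) ?scale0r // => y ya.
  by case: eqP => [xy|]; [rewrite xy ya in xa|rewrite mulr0n].
rewrite (bigD1_seq x) ?fset_uniq //= eqxx mulr1n big1 ?addr0 // => y /negPf.
by rewrite eq_sym => ->; rewrite mulr0n.
Qed.

Lemma ma_of_real_monom x c : ma_of_real (ma_monom x c) = ma_monom (0%N, x) c%:A.
Proof.
apply: ma_coefP => -[m y]; rewrite ma_of_realE !ma_monomE xpair_eqE andbC.
case: (y == x) => /=; first by rewrite mulr1n.
by rewrite mulr0n scale0r mul0rn.
Qed.

Fact ma_of_real_zmod : zmod_morphism ma_of_real.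
Proof.
move=> a b; apply: ma_coefP => -[m x]; rewrite ma_coefB !ma_of_realE ma_coefB.
by rewrite scalerBl mulrnBl.
Qed.

HB.instance Definition _ := GRing.isZmodMorphism.Build D MA ma_of_real ma_of_real_zmod.

Fact ma_of_real_monoid : monoid_morphism ma_of_real.
Proof.
split=> [|a b].
  transitivity (ma_monom (0%N, (0 : RR)) (1 : A)); last by [].
  by rewrite -[1 in RHS](scale1r (1 : A)) -ma_of_real_monom.
have E x y c d : ma_of_real ((ma_monom x c : D) * ma_monom y d) =
    (ma_monom (0%N, x) c%:A : MA) * ma_monom (0%N, y) d%:A.
  rewrite [X in ma_of_real X](ma_monomM x y c d) ma_of_real_monom ma_monomM.
  by congr ma_monom; rewrite -scalerAl mul1r scalerA.
have -> : a * b = \sum_(x <- finsupp a) \sum_(y <- finsupp b)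
    (ma_monom x (ma_coef a x) : D) * ma_monom y (ma_coef b y).
  rewrite {1}(ma_expand a) {1}(ma_expand b) mulr_suml.
  by apply: eq_bigr => x _; rewrite mulr_sumr.
rewrite (raddf_sum ma_of_real).
under eq_bigr => x _ do rewrite (raddf_sum ma_of_real) (eq_bigr _ (fun y _ => E _ _ _ _)).
by rewrite [in RHS]/ma_of_real mulr_suml; apply: eq_bigr => x _; rewrite mulr_sumr.
Qed.

HB.instance Definition _ := GRing.isMonoidMorphism.Build D MA ma_of_real ma_of_real_monoid.

End RealAlgebraMaps.

(** * The Rees-like algebra and its two filtrations *)

Section Core.
Variables (k : fieldType) (RR : realType) (A : comAlgType k) (G : grading A).
Variables (sg : alg_seminorm A RR) (pp : A -> Prop).
Local Notation D := (real_alg k RR).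
Local Notation MA := (monoid_algebra (nat * RR)%type A).
Local Notation vD := (real_alg_val k RR).

(** A term f in degree (m, x) has value sg f - x, and [nge l] collects the elements of value at
    least l. The case l = 0 is [dsum_ge], whose quotient is gr. *)
Definition nge l (h : MA) := forall x, ma_coef h x \in G x.1 /\ ((x.2 + l)%:E <= sg (ma_coef h x))%E.

Lemma ngeW l m h : l <= m -> nge m h -> nge l h.
Proof.
move=> lm hh x; have [hG hx] := hh x; split=> //.
by apply: le_trans hx; rewrite lee_fin lerD2l.
Qed.

Lemma nge0 l : nge l 0.
Proof. by move=> x; rewrite ma_coef0 rpred0 seminorm0 leey. Qed.

Lemma ngeD l h h' : nge l h -> nge l h' -> nge l (h + h').
Proof.
move=> hh hh' x; have [hG hx] := hh x; have [hG' hx'] := hh' x.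
rewrite ma_coefD rpredD //; split=> //.
by apply: le_trans (seminormD _ _ _); rewrite le_min hx.
Qed.

Lemma nge_sum l (I : Type) (r : seq I) (P : pred I) F :
  (forall i, P i -> nge l (F i)) -> nge l (\sum_(i <- r | P i) F i).
Proof. by move=> hF; elim/big_ind: _ => //; [exact: nge0|exact: ngeD]. Qed.

Lemma ngeM l m h h' : nge l h -> nge m h' -> nge (l + m) (h * h').
Proof.
move=> hh hh' z; rewrite ma_coefM.
pose Q (f : A) := f \in G z.1 /\ ((z.2 + (l + m))%:E <= sg f)%E.
have Q0 : Q 0 by rewrite /Q rpred0 seminorm0 leey.
have QD f g : Q f -> Q g -> Q (f + g).
  move=> [fG fx] [gG gx]; split; first exact: rpredD.
  by apply: le_trans (seminormD _ _ _); rewrite le_min fx.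
apply: (@big_ind _ Q) => // x _; apply: (@big_ind _ Q) => // y _.
rewrite {}/Q in Q0 QD *; case: eqP => [<-|_] //; have [hG hx] := hh x; have [hG' hx'] := hh' y.
rewrite mulr1n; split; first exact: gcompM.
apply: le_trans (seminormM _ _ _); apply: le_trans (leeD hx hx').
by rewrite -EFinD lee_fin /= addrACA.
Qed.

Lemma nge1 : nge 0 1.
Proof.
move=> x; rewrite ma_coef1; case: eqP => [->|_] /=.
  by rewrite gcomp1 seminorm1 addr0.
by rewrite rpred0 seminorm0 leey.
Qed.

Lemma ngeX l h j : nge l h -> nge (j%:R * l) (h ^+ j).
Proof.
move=> hh; elim: j => [|j IH]; first by rewrite mul0r expr0; exact: nge1.
by rewrite exprS -add1n natrD mulrDl mul1r; exact: ngeM.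
Qed.

Lemma nge_monom l x f : f \in G x.1 -> ((x.2 + l)%:E <= sg f)%E -> nge l (ma_monom x f).
Proof.
move=> fG fx y; rewrite ma_monomE; case: eqP => [->|_]; first by rewrite mulr1n.
by rewrite mulr0n rpred0 seminorm0 leey.
Qed.

Lemma seminorm_scalar (c : k) : (0 <= sg c%:A)%E.
Proof. by rewrite -(seminorm1 sg); exact: seminormZ. Qed.

Lemma nge_of_real l (a : D) : vD l a -> nge l (ma_of_real A a).
Proof.
move=> ha [m x]; rewrite ma_of_realE /=; have [a0|a0] := eqVneq (ma_coef a x) 0.
  by rewrite a0 scale0r mul0rn rpred0 seminorm0 leey.
case: eqP => [->|_]; last by rewrite mulr0n rpred0 seminorm0 leey.
rewrite mulr1n rpredZ ?gcomp1 //; split=> //.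
apply: le_trans (seminorm_scalar _); rewrite lee_fin.
by have := (proj1 (real_alg_valE _ _) ha) x a0; lra.
Qed.

Variables (n : nat) (s : 'I_n -> A) (w : 'I_n -> RR).
Hypothesis sG : forall i, s i \in G 1%N.
Hypothesis ws : forall i, ((w i)%:E <= sg (s i))%E.
Variable sev : {rmorphism mpoly n k -> A}.
Hypothesis sevC : forall c, sev (mpolyC n c) = c%:A.
Hypothesis sevX : forall i, sev 'X_i = s i.
Variable evx : {rmorphism mpoly n D -> MA}.
Hypothesis evxC : forall c, evx (mpolyC n c) = ma_of_real A c.
Hypothesis evxX : forall i, evx 'X_i = ma_monom (1%N, w i) (s i).
Variables (Om : comNzRingType) (phi : {rmorphism MA -> Om}).
Local Notation gauss := (gauss_mpoly vD n).

Definition wt (a : multinom n) : RR := \sum_i (a i)%:R * w i.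

Lemma evx_monomial a : evx (mpolyX D a) = ma_monom (mdeg a, wt a) (sev (mpolyX k a)).
Proof.
have exp (m : nat) (x : RR) f j : (ma_monom (m, x) f : MA) ^+ j = ma_monom ((m * j)%N, j%:R * x) (f ^+ j).
  rewrite ma_monomX; congr ma_monom.
  elim: j => [|j IH]; first by rewrite muln0 mul0r.
  by rewrite mulrS IH mulnS -(add1n j) natrD mulrDl mul1r.
rewrite !mpolyXE_id (rmorph_prod evx) (rmorph_prod sev) mdegE /wt.
under eq_bigr => i _ do rewrite (rmorphXn evx) /= evxX exp mul1n.
have -> : \prod_i sev ('X_i ^+ a i) = \prod_i s i ^+ a i.
  by apply: eq_bigr => i _; rewrite (rmorphXn sev) /= sevX.
elim: (index_enum _) => [|i r IH]; first by rewrite !big_nil.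
by rewrite !big_cons IH ma_monomM.
Qed.

Lemma nge_evx l Q : gauss l Q -> nge l (evx Q).
Proof.
move=> hQ; rewrite (mpolyE Q) (rmorph_sum evx); apply: nge_sum => a _.
rewrite -mul_mpolyC (rmorphM evx) /= evxC -[l]addr0; apply: ngeM.
  exact/nge_of_real/hQ.
rewrite mpolyXE_id (rmorph_prod evx).
apply: (@big_ind _ (nge 0)) => [|h h' hh hh'|i _]; first exact: nge1.
  by rewrite -[0]addr0; exact: ngeM.
rewrite (rmorphXn evx) /= evxX -[0](mulr0 (a i)%:R); apply: ngeX.
by apply: nge_monom => //=; rewrite addr0.
Qed.

(** The quotient filtration of the Gauss valuation of D[x]. It is contained in the one coming from
    [nge]; the converse holds only for the growth of powers, by [grows_nge]. *)
Definition Rge l om := exists Q, gauss l Q /\ om = phi (evx Q).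

Lemma RgeW l m u : l <= m -> Rge m u -> Rge l u.
Proof. by move=> lm [Q [hQ ->]]; exists Q; split=> //; exact: vfW hQ. Qed.

Lemma Rge0 l : Rge l 0.
Proof. by exists 0; split; [exact: vf0|rewrite !rmorph0]. Qed.

Lemma Rge1 : Rge 0 1.
Proof. by exists 1; split; [exact: (proj1 (vex1 _))|rewrite !rmorph1]. Qed.

Lemma RgeD l u u' : Rge l u -> Rge l u' -> Rge l (u + u').
Proof.
move=> [Q [hQ ->]] [Q' [hQ' ->]]; exists (Q + Q').
by split; [exact: vfD|rewrite !rmorphD].
Qed.

Lemma RgeM l m u u' : Rge l u -> Rge m u' -> Rge (l + m) (u * u').
Proof.
move=> [Q [hQ ->]] [Q' [hQ' ->]]; exists (Q * Q').
by split; [exact: vfM|rewrite (rmorphM evx) rmorphM].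
Qed.

Lemma Rge_monom m x l F : hom m F -> (forall a, a \in msupp F -> x + l <= wt a) ->
  Rge l (phi (ma_monom (m, x) (sev F))).
Proof.
move=> hF hw.
(* [evx] puts the monomial a in real degree wt a; the scalar of exponent x - wt a moves it to x and
   has valuation wt a - x, at least l. *)
exists (\sum_(a <- msupp F) mpolyC n (ma_monom (x - wt a) (mcoeff a F) : D) * mpolyX D a); split.
  rewrite big_seq; apply: vf_sum => a /hw ha; rewrite -[l]addr0; apply: vfM; last exact: gauss_mpolyX.
  apply: gauss_mpolyC; apply: (@vfW _ _ vD _ (- (x - wt a))); last exact: real_alg_val_monom.
  by rewrite opprB lerBrDl.
rewrite {1}(mpolyE F) (rmorph_sum sev) ma_monom_sum (rmorph_sum evx) big_seq [in RHS]big_seq.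
congr (phi _); apply: eq_bigr => a aF.
rewrite (rmorphM evx) /= evxC evx_monomial ma_of_real_monom ma_monomM.
rewrite -mul_mpolyC (rmorphM sev) /= sevC; congr (ma_monom _ _).
by rewrite ((homP _ _).1 hF) //; congr (_, _); rewrite /= subrK.
Qed.

Hypothesis Gspan : forall m f, f \in G m -> exists2 F, hom m F & f = sev F.
Hypothesis sg_power : forall m f (mu : RR), f \in G m -> (mu%:E < sg f)%E ->
  exists d F, [/\ (0 < d)%N, hom (m * d) F, forall a, a \in msupp F -> d%:R * mu <= wt a
    & pp (f ^+ d - sev F)].
Hypothesis phiP : forall a, phi a = 0 <-> forall x, pp (ma_coef a x).
Hypothesis pp0 : pp 0.

Lemma Rge_exists_monom m x f : f \in G m -> exists l, Rge l (phi (ma_monom (m, x) f)).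
Proof.
move=> /Gspan[F hF ->].
have [l hl] : exists l, forall a, a \in msupp F -> l <= wt a.
  exists (- \sum_(a <- msupp F) `|wt a|) => a aF.
  rewrite lerNl (bigD1_seq a) ?msupp_uniq //=.
  apply: le_trans (_ : `|wt a| <= _); first by rewrite -normrN ler_norm.
  by rewrite lerDl sumr_ge0.
by exists (l - x); apply: Rge_monom => // a /hl; rewrite addrC subrK.
Qed.

Lemma phi_monom x f g : pp (f - g) -> phi (ma_monom x f) = phi (ma_monom x g).
Proof.
move=> h; apply/eqP; rewrite -subr_eq0 -rmorphB; apply/eqP/phiP => y.
by rewrite ma_coefB !ma_monomE; case: eqP; rewrite ?mulr1n // !mulr0n subrr.
Qed.

Lemma grows_monom mu x f : f \in G x.1 -> ((x.2 + mu)%:E < sg f)%E -> grows Rge mu (phi (ma_monom x f)).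
Proof.
case: x => m x /= fG /(sg_power fG)[d [F [d0 hF hw hp]]].
have hd : Rge (d%:R * mu) (phi (ma_monom (m, x) f) ^+ d).
  have xd : ((m, x) : nat * RR) *+ d = ((m * d)%N, d%:R * x).
    elim: d {d0 hF hw hp} => [|d IH]; first by rewrite muln0 mul0r.
    by rewrite mulrS IH mulnS -(add1n d) natrD mulrDl mul1r.
  rewrite -rmorphXn ma_monomX xd (phi_monom _ hp); apply: Rge_monom => // a /hw.
  by rewrite mulrDr.
have [l hl] := Rge_exists_monom x fG.
exact: (grows_power (@RgeW) (@RgeM) Rge1 d0 hd hl).
Qed.

(** [grows] is additive, so a single term suffices; for it [sg_power] lifts some power to a
    polynomial of the right weight. *)
Lemma grows_nge l mu h : nge l h -> mu < l -> grows Rge mu (phi h).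
Proof.
move=> hh ml; rewrite (ma_expand h) (rmorph_sum phi).
apply: (@big_ind _ (grows Rge mu)) => [||x _].
- exact: (grows0 (@Rge0) Rge1).
- by move=> u v; exact: (growsD (@Rge0) (@RgeD) (@RgeM)).
- have [hG hx] := hh x; apply: grows_monom => //; apply: lt_le_trans hx.
  by rewrite lte_fin ltrD2l.
Qed.

End Core.

(** * Symbols in the associated graded algebra *)

Section Symbols.
Local Open Scope quotient_scope.
Variables (k : fieldType) (RR : realType) (A : comAlgType k) (G : grading A).
Variables (sg : alg_seminorm A RR).
Local Notation MA := (monoid_algebra (nat * RR)%type A).
Local Notation nge := (nge G sg).

Lemma dsum_ge_nge (h : MA) : reflect (nge 0 h) (h \in dsum_ge G sg).
Proof.
apply: (iffP (dsum_geP _ _ _)) => hh x.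
  by have := hh x; rewrite inE addr0 => /andP.
by have := hh x; rewrite inE addr0 => /andP.
Qed.

Lemma nge_dsum (a : dsum_ge_type G sg) : nge 0 (dsum_val a).
Proof. exact/dsum_ge_nge/dsum_valP. Qed.

(** Outside [nge 0] the default makes the symbol 0; the algebraic rules therefore carry [nge 0]
    hypotheses. *)
Definition sym (h : MA) : gr G sg := \pi_(gr G sg) (insubd (0 : dsum_ge_type G sg) h).

Lemma insubd_val h : nge 0 h -> dsum_val (insubd (0 : dsum_ge_type G sg) h) = h.
Proof. by move=> /dsum_ge_nge hh; rewrite -[LHS]/(val _) insubdK. Qed.

Lemma sym_val (a : dsum_ge_type G sg) : sym (dsum_val a) = \pi_(gr G sg) a.
Proof. by rewrite /sym; congr (\pi_(gr G sg) _); exact: (valKd 0 a). Qed.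

Lemma sym_ex u : exists2 h, nge 0 h & u = sym h.
Proof. by exists (dsum_val (repr u)); [exact: nge_dsum|rewrite sym_val reprK]. Qed.

Lemma nge_val h : nge 0 h -> exists a : dsum_ge_type G sg, h = dsum_val a.
Proof. by move=> hh; exists (insubd 0 h); rewrite insubd_val. Qed.

Lemma symD h h' : nge 0 h -> nge 0 h' -> sym (h + h') = sym h + sym h'.
Proof.
move=> /nge_val[a ->] /nge_val[b ->]; rewrite -dsum_valD !sym_val.
by rewrite !piE.
Qed.

Lemma symM h h' : nge 0 h -> nge 0 h' -> sym (h * h') = sym h * sym h'.
Proof.
move=> /nge_val[a ->] /nge_val[b ->]; rewrite -dsum_valM !sym_val.
by rewrite !piE.
Qed.

Lemma sym0 : sym 0 = 0.
Proof. by rewrite -[0 in LHS](dsum_val0 G sg) sym_val !piE. Qed.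

Lemma sym1 : sym 1 = 1.
Proof. by rewrite -[1 in LHS](dsum_val1 G sg) sym_val !piE. Qed.

Lemma sym_scalar (c : k) : sym (ma_monom 0 c%:A) = c%:A.
Proof.
have -> : (c%:A : gr G sg) = gr_scale c 1 by [].
rewrite -sym1 -[1 in RHS](dsum_val1 G sg) sym_val gr_scale_pi -sym_val; congr (sym _).
apply: ma_coefP => x; rewrite ma_scaleE dsum_val1 ma_coef1 ma_monomE.
by case: eqP; rewrite ?mulr1n // !mulr0n scaler0.
Qed.

Lemma symX h j : nge 0 h -> sym (h ^+ j) = sym h ^+ j.
Proof.
move=> hh; elim: j => [|j IH]; first by rewrite !expr0 sym1.
rewrite !exprS symM ?IH //.
by have := ngeX j hh; rewrite mulr0.
Qed.

Lemma sym_sum (I : Type) (r : seq I) (P : pred I) F :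
  (forall i, P i -> nge 0 (F i)) -> sym (\sum_(i <- r | P i) F i) = \sum_(i <- r | P i) sym (F i).
Proof.
move=> hF; apply: (@proj1 _ (nge 0 (\sum_(i <- r | P i) F i))).
elim/big_ind2: _ => [|h1 u1 h2 u2 [<- n1] [<- n2]|i Pi].
- by split; [exact: sym0|exact: nge0].
- by split; [exact: symD|exact: ngeD].
- by split=> //; exact: hF.
Qed.

Lemma sym_eq0 h : nge 0 h -> sym h = 0 <-> forall x, (x.2%:E < sg (ma_coef h x))%E.
Proof.
move=> hh; have [a ah] := nge_val hh; rewrite ah sym_val.
have -> : (\pi_(gr G sg) a = 0) <-> a \in @dsum_gt k A G RR sg.
  have -> : (0 : gr G sg) = \pi_(gr G sg) 0 by rewrite !piE.
  split; first by move/gr_eqP; rewrite subr0.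
  by move=> h1; apply/gr_eqP; rewrite subr0.
split=> [/dsum_gtP ha x|ha]; first by have := ha x; rewrite inE => /andP[].
by apply/dsum_gtP => x; rewrite inE ha; have := (hh x).1; rewrite -ah => ->.
Qed.

Lemma sym_gt0 h l : 0 < l -> nge l h -> sym h = 0.
Proof.
move=> l0 hh; apply/sym_eq0 => [|x]; first exact: ngeW (ltW l0) hh.
by apply: lt_le_trans (hh x).2; rewrite lte_fin ltrDl.
Qed.

(** The support of h is finite, so the strict inequalities leave a uniform gap. *)
Lemma sym_eq0_gt h : nge 0 h -> sym h = 0 -> exists2 l, 0 < l & nge l h.
Proof.
move=> hh /(sym_eq0 hh) hx.
suff [l l0 hl] : exists2 l, 0 < l & forall x, x \in finsupp h -> ((x.2 + l)%:E <= sg (ma_coef h x))%E.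
  exists l => // x; split; first exact: (hh x).1.
  have [/hl//|xh] := boolP (x \in finsupp h).
  by rewrite ma_coef_supp // seminorm0 leey.
suff H (r : seq (nat * RR)) : exists2 l, 0 < l & forall x, x \in r -> ((x.2 + l)%:E <= sg (ma_coef h x))%E.
  exact: H.
elim: r => [|x r [l l0 hl]]; first by exists 1; rewrite ?ltr01.
have [m m0 hm] : exists2 m, 0 < m & ((x.2 + m)%:E <= sg (ma_coef h x))%E.
  have := hx x; case: (sg (ma_coef h x)) => [t| |] //; last by exists 1; rewrite ?ltr01 ?leey.
  rewrite lte_fin => ht; exists (t - x.2); first by rewrite subr_gt0.
  by rewrite addrC subrK lexx.
exists (Num.min l m); first by rewrite lt_min l0.
move=> y; rewrite in_cons => /predU1P[->|/hl].
  by apply: le_trans hm; rewrite lee_fin lerD2l ge_min lexx orbT.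
by apply: le_trans; rewrite lee_fin lerD2l ge_min lexx.
Qed.

End Symbols.

(** * Residues of polynomials over the group algebra *)

Section MultivariateResidue.
Variables (k : fieldType) (RR : realType).
Local Notation D := (real_alg k RR).
Local Notation vD := (real_alg_val k RR).

Lemma mcoeff_hpart (R : comNzRingType) n m (p : mpoly n R) a :
  mcoeff a (hpart m p) = if mdeg a == m then mcoeff a p else 0.
Proof.
case: eqP => [am|/eqP am]; last first.
  by apply: memN_msupp_eq0; apply: contra am => /(proj1 (homP _ _) (hom_hpart m p)) ->.
have [N hN] := hparts p; rewrite [in RHS]hN [RHS]raddf_sum /=.
have other (i : nat) : i != m -> mcoeff a (hpart i p) = 0.
  move=> im; apply: memN_msupp_eq0; apply: contra im.
  by move=> /(proj1 (homP _ _) (hom_hpart i p)) <-; apply/eqP.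
have [mN|Nm] := ltnP m N; last first.
  rewrite [RHS]big1 => [|i _]; last by apply: other; rewrite neq_ltn (leq_trans (ltn_ord i)).
  rewrite hN hpart_sum big1 ?mcoeff0 // => i _.
  rewrite (hom_other (hom_hpart _ _)) //.
  by rewrite neq_ltn (leq_trans (ltn_ord i)).
by rewrite [RHS](bigD1 (Ordinal mN)) //= big1 ?addr0 // => i; rewrite -val_eqE /= => im; exact: other.
Qed.

Definition mlift n : {rmorphism mpoly n k -> mpoly n D} :=
  s2val (mpoly_eval (mpolyC n (R := D) \o real_alg_const RR (k := k)) (fun i => 'X_i)).

Lemma mliftC n c : mlift n (mpolyC n c) = mpolyC n (real_alg_const RR c).
Proof. by rewrite /mlift; case: mpoly_eval. Qed.

Lemma mliftXU n i : mlift n 'X_i = 'X_i.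
Proof. by rewrite /mlift; case: mpoly_eval. Qed.

Lemma mliftX n a : mlift n (mpolyX k a) = mpolyX D a.
Proof.
rewrite !mpolyXE_id rmorph_prod; apply: eq_bigr => i _.
by rewrite rmorphXn /= mliftXU.
Qed.

Lemma mcoeff_mlift n a (F : mpoly n k) : mcoeff a (mlift n F) = real_alg_const RR (mcoeff a F).
Proof.
rewrite {1}(mpolyE F) rmorph_sum raddf_sum.
rewrite (eq_bigr (fun b => real_alg_const RR (mcoeff b F) * (b == a)%:R)) => [|b _]; last first.
  by rewrite -mul_mpolyC (rmorphM (mlift n)) /= mliftC mliftX mcoeffCM mcoeffX.
have [aF|aF] := boolP (a \in msupp F); last first.
  rewrite (memN_msupp_eq0 aF) rmorph0 big_seq big1 // => b bF.
  by case: eqP => [ba|]; [rewrite -ba bF in aF|rewrite mulr0].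
by rewrite (bigD1_seq a) ?msupp_uniq //= eqxx mulr1 big1 ?addr0 // => b /negPf ->; rewrite mulr0.
Qed.

Lemma mlift_hpart n m (F : mpoly n k) : mlift n (hpart m F) = hpart m (mlift n F).
Proof.
apply/mpolyP => a; rewrite mcoeff_mlift !mcoeff_hpart mcoeff_mlift.
by case: eqP; rewrite ?rmorph0.
Qed.

Lemma mlift_hom n m (F : mpoly n k) : hom m F -> hom m (mlift n F).
Proof. by rewrite /hom -mlift_hpart => ->. Qed.

Lemma real_alg_val_const c : vD 0 (real_alg_const RR c).
Proof. by have := @real_alg_val_monom k RR 0 c; rewrite oppr0. Qed.

Lemma gauss_mlift n (F : mpoly n k) : gauss_mpoly vD n 0 (mlift n F).
Proof. by move=> a; rewrite mcoeff_mlift; exact: real_alg_val_const. Qed.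

Lemma gauss_hpart n m l (Q : mpoly n D) : gauss_mpoly vD n l Q -> gauss_mpoly vD n l (hpart m Q).
Proof. by move=> hQ a; rewrite mcoeff_hpart; case: eqP => _; [exact: hQ|exact: vf0]. Qed.

Lemma gauss_residue n (p : mpoly n D) : gauss_mpoly vD n 0 p ->
  exists z : mpoly n k, vgt (gauss_mpoly vD n) 0 (p - mlift n z).
Proof.
move=> hp; exists (\sum_(a <- msupp p) mpolyC n (ma_coef (mcoeff a p : D) 0) * mpolyX k a).
rewrite rmorph_sum {1}(mpolyE p) -sumrB; apply: vgt_sum => a _.
rewrite (rmorphM (mlift n)) /= mliftC mliftX -mul_mpolyC -mulrBl -mpolyCB.
have [m [m0 hm]] := real_alg_residue (hp a).
exists m; split=> //; rewrite -[m]addr0; apply: vfM; last exact: gauss_mpolyX.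
exact: gauss_mpolyC.
Qed.

Lemma vex_normalize n (p : mpoly n D) : p != 0 ->
  exists2 t : D, t != 0 & vex (gauss_mpoly vD n) 0 (mpolyC n t * p).
Proof.
move=> /(vf_ex (gauss_mpoly vD n))[l hl].
exists (ma_monom l 1).
  by have /vex_neq0 := real_alg_vex_monom l (oner_neq0 k).
rewrite -(addNr l); apply: vexM => //; apply: vex_mpolyC.
exact: (real_alg_vex_monom l (oner_neq0 k)).
Qed.

End MultivariateResidue.

(** * Relations between the symbols of the generators *)

Section SymbolIdeal.
Variables (k : fieldType) (RR : realType) (A : comAlgType k) (G : grading A).
Variables (sg : alg_seminorm A RR) (pp : A -> Prop).
Local Notation D := (real_alg k RR).
Local Notation MA := (monoid_algebra (nat * RR)%type A).
Local Notation vD := (real_alg_val k RR).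
Local Notation gauss n := (gauss_mpoly vD n).
Local Notation nge := (nge G sg).
Variables (n : nat) (s : 'I_n -> A) (w : 'I_n -> RR).
Hypothesis sG : forall i, s i \in G 1%N.
Hypothesis ws : forall i, ((w i)%:E <= sg (s i))%E.
Variable sev : {rmorphism mpoly n k -> A}.
Hypothesis sevX : forall i, sev 'X_i = s i.
Variable evx : {rmorphism mpoly n D -> MA}.
Hypothesis evxC : forall c, evx (mpolyC n c) = ma_of_real A c.
Hypothesis evxX : forall i, evx 'X_i = ma_monom (1%N, w i) (s i).
Variables (Om : comNzRingType) (phi : {rmorphism MA -> Om}).
Local Notation Rge := (Rge evx phi).
Hypothesis phiP : forall a, phi a = 0 <-> forall x, pp (ma_coef a x).
Hypothesis pp_sg : forall f, pp f -> sg f = +oo%E.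
Hypothesis pp0 : pp 0.

Lemma evx_hom m (Q : mpoly n D) m' x : hom m Q -> m' != m -> ma_coef (evx Q) (m', x) = 0.
Proof.
move=> /homP hQ mm; rewrite (mpolyE Q) (rmorph_sum evx) ma_coef_sum big_seq big1 // => a /hQ am.
rewrite -mul_mpolyC (rmorphM evx) /= evxC (evx_monomial sevX evxX) am /ma_of_real mulr_suml.
rewrite ma_coef_sum big1 // => y _; rewrite ma_monomM ma_monomE xpair_eqE.
by rewrite (negPf mm).
Qed.

Lemma evx_hpart m (Q : mpoly n D) m' x :
  ma_coef (evx (hpart m Q)) (m', x) = if m' == m then ma_coef (evx Q) (m', x) else 0.
Proof.
case: eqP => [->|/eqP]; last by move=> mm; rewrite (evx_hom x (hom_hpart m Q) mm).
have [N hN] := hparts Q; have -> : ma_coef (evx Q) (m, x) = \sum_(i < N) ma_coef (evx (hpart i Q)) (m, x).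
  by rewrite {1}hN (rmorph_sum evx) ma_coef_sum.
have [mN|Nm] := ltnP m N.
  rewrite [RHS](bigD1 (Ordinal mN)) //= big1 ?addr0 // => i; rewrite -val_eqE /= => im.
  by rewrite (evx_hom x (hom_hpart i Q)) // eq_sym.
have -> : hpart m Q = 0.
  rewrite hN hpart_sum big1 // => i _.
  by rewrite (hom_other (hom_hpart _ _)) // neq_ltn (leq_trans (ltn_ord i)).
rewrite rmorph0 ma_coef0 big1 // => i _; rewrite (evx_hom x (hom_hpart i Q)) //.
by rewrite neq_ltn (leq_trans (ltn_ord i)) ?orbT.
Qed.

Lemma phi_hpart m P Q : phi (evx P) = phi (evx Q) -> phi (evx (hpart m P)) = phi (evx (hpart m Q)).
Proof.
move=> /eqP; rewrite -subr_eq0 -(rmorphB phi) -(rmorphB evx) => /eqP/phiP h.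
apply/eqP; rewrite -subr_eq0 -(rmorphB phi) -(rmorphB evx) -hpartB; apply/eqP/phiP => -[m' x].
by rewrite evx_hpart; case: eqP.
Qed.

(* The ideal of relations between the symbols of the generators. *)
Definition symideal (F : mpoly n k) := exists2 l, 0 < l & Rge l (phi (evx (mlift k RR n F))).
Local Notation J := symideal.

Lemma symideal0 : J 0.
Proof. by exists 1; rewrite ?ltr01 // !rmorph0; exact: Rge0. Qed.

Lemma symidealD F F' : J F -> J F' -> J (F + F').
Proof.
move=> [l l0 hl] [m m0 hm]; exists (Num.min l m); first by rewrite lt_min l0.
rewrite !rmorphD; apply: RgeD.
  by apply: RgeW hl; rewrite ge_min lexx.
by apply: RgeW hm; rewrite ge_min lexx orbT.
Qed.

Lemma Rge_mlift F : Rge 0 (phi (evx (mlift k RR n F))).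
Proof. by exists (mlift k RR n F); split=> //; exact: gauss_mlift. Qed.

Lemma symidealM F F' : J F' -> J (F * F').
Proof.
move=> [l l0 hl]; exists l => //.
rewrite (rmorphM (mlift k RR n)) (rmorphM evx) (rmorphM phi) -[l]add0r.
by apply: RgeM => //; exact: Rge_mlift.
Qed.

Lemma symideal_hpart m F : J F -> J (hpart m F).
Proof.
move=> [l l0 [Q [hQ E]]]; exists l => //; exists (hpart m Q); split.
  exact: gauss_hpart.
by rewrite mlift_hpart; exact: phi_hpart.
Qed.

(** Otherwise 1 would be, modulo an element with sg = +oo, of positive value, against sg 1 = 0. *)
Lemma symideal1 : ~ J 1.
Proof.
move=> [l l0 [Q [hQ /eqP]]]; rewrite -subr_eq0 -(rmorphB phi) => /eqP/phiP/(_ 0)/pp_sg.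
have [_ hx] := nge_evx sG ws evxC evxX hQ (0 : nat * RR).
rewrite !rmorph1 ma_coefB ma_coef1 eqxx => h1.
have := seminormD sg (1 - ma_coef (evx Q) 0) (ma_coef (evx Q) 0).
rewrite subrK seminorm1 h1 leNgt lt_min ltry /=.
by rewrite (lt_le_trans _ hx) // lte_fin add0r.
Qed.

Lemma sym_phi h : nge 0 h -> phi h = 0 -> sym G sg h = 0.
Proof.
by move=> hh /phiP h0; apply/(sym_eq0 hh) => x; rewrite (pp_sg (h0 x)) ltry.
Qed.

Lemma sym_phi_eq h h' : nge 0 h -> nge 0 h' -> phi h = phi h' -> sym G sg h = sym G sg h'.
Proof.
move=> hh hh' E; apply/eqP; rewrite -subr_eq0; apply/eqP.
have nB : nge 0 (- h').
  by move=> x; have [xG hx] := hh' x; rewrite ma_coefN -scaleN1r rpredZ //; split=> //; exact: le_trans hx (seminormZ _ _ _).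
have -> : - sym G sg h' = sym G sg (- h').
  by apply/esym/eqP; rewrite -addr_eq0 -(symD nB hh') addNr sym0.
rewrite -symD //; apply: sym_phi; first exact: ngeD.
by rewrite rmorphB E subrr.
Qed.

End SymbolIdeal.

Lemma reduced_of_squares (M : comNzRingType) : (forall u : M, u ^+ 2 = 0 -> u = 0) -> reduced M.
Proof.
move=> h u m; elim/ltn_ind: m u => -[|[|m]] IH u.
- by rewrite expr0 => /eqP; rewrite oner_eq0.
- by rewrite expr1.
move=> um; apply: (IH (uphalf m.+2)); first by rewrite /= ltnS uphalf_half; lia.
apply: h; rewrite -exprM.
have : (m.+2 <= uphalf m.+2 * 2)%N by rewrite muln2; lia.
by move=> /subnK <-; rewrite exprD um mulr0.
Qed.

(** * Reducedness of the associated graded algebra *)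

Section Reduced.
Variables (k : fieldType) (RR : realType) (A : comAlgType k) (G : grading A).
Variables (sg : alg_seminorm A RR).
Local Notation MA := (monoid_algebra (nat * RR)%type A).
Local Notation nge := (nge G sg).
Local Notation sym := (sym G sg).
Hypothesis sgX : forall (f : A) (mu : RR) j, (0 < j)%N ->
  ((j%:R * mu)%:E <= sg (f ^+ j)%R)%E -> (mu%:E <= sg f)%E.

Definition lex_lt (x y : nat * RR) := (x.1 < y.1)%N \/ x.1 = y.1 /\ x.2 < y.2.

Lemma lex_top (r : seq (nat * RR)) (Q : nat * RR -> Prop) : (exists2 x, x \in r & Q x) ->
  exists x0, [/\ x0 \in r, Q x0 & forall y, y \in r -> Q y -> y <> x0 -> lex_lt y x0].
Proof.
move=> [x xr Qx].
have [|m [_ [z [zr Qz zm]] hm]] := @seq_max _ nat [seq y.1 | y <- r]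
  (fun m => exists y, [/\ y \in r, Q y & y.1 = m]).
  by exists x.1; [exact: map_f|exists x].
have zr' : (m, z.2) \in r by rewrite -zm -surjective_pairing.
have Qz' : Q (m, z.2) by rewrite -zm -surjective_pairing.
have [|l [_ [lr Ql] hl]] := @seq_max _ RR [seq y.2 | y <- r] (fun l => (m, l) \in r /\ Q (m, l)).
  by exists z.2 => //; exact: map_f.
exists (m, l); split=> // -[m' l'] yr Qy yx.
have := hm m' (map_f fst yr) (ex_intro _ _ (And3 yr Qy erefl)).
rewrite leEnat leq_eqVlt => /predU1P[E|]; [right|by left].
split=> //=; subst m'; have := hl l' (map_f snd yr) (conj yr Qy).
by rewrite le_eqVlt => /predU1P[E|//]; case: yx; rewrite E.
Qed.

Lemma sgX_gt f (mu : RR) j : (0 < j)%N -> ((j%:R * mu)%:E < sg (f ^+ j)%R)%E -> (mu%:E < sg f)%E.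
Proof.
move=> j0 h; have [mu' mm h'] : exists2 mu', mu < mu' & ((j%:R * mu')%:E <= sg (f ^+ j)%R)%E.
  have jR : 0 < j%:R :> RR by rewrite ltr0n.
  move: h; case: (sg _) => [t| |] //.
    rewrite lte_fin => ht; exists (t / j%:R); first by rewrite ltr_pdivlMr // mulrC.
    by rewrite mulrC divfK ?gt_eqF.
  by move=> _; exists (mu + 1); [rewrite ltrDl|rewrite leey].
by apply: lt_le_trans (sgX j0 h'); rewrite lte_fin.
Qed.

(** Keep in h only the terms with nonzero symbol and let x0 be the lexicographically largest index.
    The coefficient of the square at x0 + x0 is the square of the one at x0, and
    power-multiplicativity of sg keeps its symbol nonzero. *)
Lemma gr_reduced : reduced (gr G sg).
Proof.
apply: reduced_of_squares => u; have [h hh ->] := sym_ex u => u2.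
apply: contrapT => u0.
pose Q x := ~ (x.2%:E < sg (ma_coef h x))%E.
have ex : exists2 x, x \in finsupp h & Q x.
  apply: contrapT => nex; apply: u0; apply/(sym_eq0 hh) => x.
  have [xh|xh] := boolP (x \in finsupp h); last by rewrite ma_coef_supp // seminorm0 ltry.
  by apply: contrapT => hx; apply: nex; exists x.
have [x0 [x0h Qx0 top]] := lex_top ex.
pose g : MA := \sum_(x <- finsupp h | ~~ (x.2%:E < sg (ma_coef h x))%E) ma_monom x (ma_coef h x).
have gE y : ma_coef g y = if ~~ (y.2%:E < sg (ma_coef h y))%E then ma_coef h y else 0.
  rewrite /g ma_coef_sum; under eq_bigr => x _ do rewrite ma_monomE.
  have [yh|yh] := boolP (y \in finsupp h); last first.
    rewrite (ma_coef_supp yh) if_same big_seq_cond big1 // => x /andP[xh _].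
    by case: eqP => [E|]; rewrite ?mulr0n //; rewrite -E (ma_coef_supp (x := y)) // E.
  rewrite big_mkcond (bigD1_seq y) ?fset_uniq //= eqxx mulr1n big1 ?addr0 // => x /negPf.
  by rewrite eq_sym => ->; rewrite mulr0n if_same.
have hg : nge 0 g.
  by move=> y; rewrite gE; case: ifP => _; [exact: hh|exact: (nge0 G sg 0 y).1 || rewrite rpred0 seminorm0 leey].
have Eg : sym h = sym g.
  have hB : nge 0 (h - g).
    move=> y; rewrite ma_coefB gE; case: ifP => _; last by rewrite subr0; exact: hh.
    by rewrite subrr rpred0 seminorm0 leey.
  rewrite -[h](subrK g) symD // (_ : sym (h - g) = 0) ?add0r //.
  apply/(sym_eq0 hB) => y; rewrite ma_coefB gE; case: ifP => [_|/negbFE hy]; last by rewrite subr0.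
  by rewrite subrr seminorm0 ltry.
have gx0 : ma_coef g x0 = ma_coef h x0 by rewrite gE; move/negP: Qx0 => ->.
have gtop y : y <> x0 -> ma_coef g y = 0 \/ lex_lt y x0.
  move=> yx; rewrite gE; case: ifP => [/negP hy|_]; last by left.
  have [yh|yh] := boolP (y \in finsupp h); last by left; rewrite ma_coef_supp.
  by right; apply: top.
have [|||||r [-> E]] := @ma_coefM_top (nat * RR)%type A (fun f => f = 0) lex_lt _ _ _ _ _ g g x0 x0 gtop gtop.
- by [].
- by move=> a b -> ->; rewrite addr0.
- by move=> a b ->; rewrite mulr0.
- by move=> [m x] [m1 x1] [m2 x2] [/addnI -> /addrI ->].
- move=> [m x] [m' x'] [p y] [p' y']; rewrite /lex_lt /= => h1 h2 [E1 E2].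
  move: h1 h2 => [h1|[e1 h1]] [h2|[e2 h2]]; [lia|lia|lia|].
  by have := ltrD h1 h2; rewrite E2 ltxx.
apply: Qx0; apply: (@sgX_gt _ _ 2) => //; rewrite -gx0 expr2.
rewrite addr0 in E; rewrite -E.
have /(sym_eq0 _) : sym (g * g) = 0 by rewrite symM // -Eg -expr2.
have -> : 2%:R * x0.2 = (x0 + x0).2 by rewrite mulr_natl mulr2n.
by apply; rewrite -[0](addr0 0); exact: ngeM.
Qed.

End Reduced.

(** * The monoid algebra modulo a prime of A *)

Section CoefficientQuotient.
Local Open Scope quotient_scope.
Variables (RR : realType) (A : comNzRingType) (pp : A -> Prop).
Local Notation MA := (monoid_algebra (nat * RR)%type A).
Hypothesis pp0 : pp 0.
Hypothesis ppD : forall a b, pp a -> pp b -> pp (a + b).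
Hypothesis ppM : forall a b, pp b -> pp (a * b).
Hypothesis pp1 : ~ pp 1.
Hypothesis ppP : forall a b, pp (a * b) -> pp a \/ pp b.

Let ppB a b : pp a -> pp b -> pp (a - b).
Proof. by move=> ha hb; apply: ppD => //; rewrite -mulN1r; exact: ppM. Qed.

Definition coef_ideal : {pred MA} := [pred a | `[< forall x, pp (ma_coef a x) >]].

Lemma coef_idealP (a : MA) : reflect (forall x, pp (ma_coef a x)) (a \in coef_ideal).
Proof. exact: asboolP. Qed.

Fact coef_ideal_zmod : zmod_closed coef_ideal.
Proof.
split=> [|a b /coef_idealP ha /coef_idealP hb]; apply/coef_idealP => x.
  by rewrite ma_coef0.
by rewrite ma_coefB; exact: ppB.
Qed.

Fact coef_ideal_proper : 1 \notin coef_ideal /\ forall a, {in coef_ideal, forall b, a * b \in coef_ideal}.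
Proof.
split=> [|a b /coef_idealP hb].
  by apply/negP => /coef_idealP/(_ 0); rewrite ma_coef1 eqxx.
apply/coef_idealP => x; rewrite ma_coefM.
apply: (@big_ind _ pp) => // y _; apply: (@big_ind _ pp) => // z _.
by case: eqP => _; rewrite ?mulr1n // ; exact: ppM.
Qed.

HB.instance Definition _ := GRing.isZmodClosed.Build MA coef_ideal coef_ideal_zmod.
HB.instance Definition _ := isProperIdeal.Build MA coef_ideal coef_ideal_proper.

(** The quotient is the monoid algebra of A / pp, a domain because nat * RR is ordered
    lexicographically and lexicographically top coefficients multiply. *)
Lemma coef_quotient : exists (Om : comNzRingType) (phi : {rmorphism MA -> Om}),
  (forall a, phi a = 0 <-> forall x, pp (ma_coef a x)) /\
  (forall u v : Om, u * v = 0 -> u = 0 \/ v = 0).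
Proof.
pose Om : comNzRingType := {ideal_quot coef_ideal}.
pose phi : {rmorphism MA -> Om} := \pi_{ideal_quot coef_ideal}.
have phiP a : phi a = 0 <-> forall x, pp (ma_coef a x).
  have -> : (phi a = 0) <-> a \in coef_ideal.
    rewrite -[a in a \in _]subr0 Quotient.idealrBE /phi -(rmorph0 phi).
    by split=> /eqP.
  by split=> /coef_idealP.
exists Om, phi; split=> // u v.
have [a ->] : exists a, u = phi a by exists (repr u); rewrite /phi /= reprK.
have [b ->] : exists b, v = phi b by exists (repr v); rewrite /phi /= reprK.
rewrite -rmorphM => /phiP ab; apply: contrapT => nab.
have top (c : MA) : phi c <> 0 -> exists x, ~ pp (ma_coef c x) /\
    forall y, y <> x -> pp (ma_coef c y) \/ lex_lt y x.
  move=> c0; have [|x [xc hx h]] := @lex_top RR (finsupp c) (fun x => ~ pp (ma_coef c x)).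
    apply: contrapT => nex; apply: c0; apply/phiP => x.
    have [xc|xc] := boolP (x \in finsupp c); last by rewrite ma_coef_supp.
    by apply: contrapT => hx; apply: nex; exists x.
  exists x; split=> // y yx; have [yc|yc] := boolP (y \in finsupp c); last by left; rewrite ma_coef_supp.
  by have [?|hy] := pselect (pp (ma_coef c y)); [left|right; exact: h].
have [|x [hx tx]] := top a; first by move=> a0; apply: nab; left.
have [|y [hy ty]] := top b; first by move=> b0; apply: nab; right.
have [|||||r [hr E]] := @ma_coefM_top (nat * RR)%type A pp (@lex_lt RR) _ _ _ _ _ a b x y tx ty => //.
- by move=> [m z] [m1 z1] [m2 z2] [/addnI -> /addrI ->].
- move=> [m z] [m' z'] [p t] [p' t']; rewrite /lex_lt /= => h1 h2 [E1 E2].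
  move: h1 h2 => [h1|[e1 h1]] [h2|[e2 h2]]; [lia|lia|lia|].
  by have := ltrD h1 h2; rewrite E2 ltxx.
have [] : pp (ma_coef a x) \/ pp (ma_coef b y) => //; apply: ppP.
by rewrite -[_ * _](addrK r) -E; exact: ppB.
Qed.

End CoefficientQuotient.

(** * Noetherianity modulo a prime *)

Section NoetherianSymbols.
Variables (k : fieldType) (RR : realType) (A : comAlgType k) (G : grading A).
Variables (sg : alg_seminorm A RR) (pp : A -> Prop).
Local Notation D := (real_alg k RR).
Local Notation MA := (monoid_algebra (nat * RR)%type A).
Local Notation vD := (real_alg_val k RR).
Local Notation gauss n := (gauss_mpoly vD n).
Local Notation nge := (nge G sg).
Local Notation sym := (sym G sg).
Local Notation gr := (gr G sg).
Variables (n : nat) (s : 'I_n -> A) (w : 'I_n -> RR).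
Hypothesis sG : forall i, s i \in G 1%N.
Hypothesis ws : forall i, ((w i)%:E <= sg (s i))%E.
Variable sev : {rmorphism mpoly n k -> A}.
Hypothesis sevC : forall c, sev (mpolyC n c) = c%:A.
Hypothesis sevX : forall i, sev 'X_i = s i.
Variable evx : {rmorphism mpoly n D -> MA}.
Hypothesis evxC : forall c, evx (mpolyC n c) = ma_of_real A c.
Hypothesis evxX : forall i, evx 'X_i = ma_monom (1%N, w i) (s i).
Variables (Om : comNzRingType) (phi : {rmorphism MA -> Om}).
Local Notation Rge := (Rge evx phi).
Hypothesis Gspan : forall m f, f \in G m -> exists2 F, hom m F & f = sev F.
Hypothesis sg_power : forall m f (mu : RR), f \in G m -> (mu%:E < sg f)%E ->
  exists d F, [/\ (0 < d)%N, hom (m * d) F, forall a, a \in msupp F -> d%:R * mu <= wt w a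
    & pp (f ^+ d - sev F)].
Hypothesis phiP : forall a, phi a = 0 <-> forall x, pp (ma_coef a x).
Hypothesis pp_sg : forall f, pp f -> sg f = +oo%E.
Hypothesis pp0 : pp 0.
Hypothesis Om_domain : forall a b : Om, a * b = 0 -> a = 0 \/ b = 0.
Hypothesis sgX : forall (f : A) (mu : RR) j, (0 < j)%N -> ((j%:R * mu)%:E <= sg (f ^+ j)%R)%E -> (mu%:E <= sg f)%E.

Variables (d : nat) (Y : 'I_d -> mpoly n k).
Local Notation J := (symideal evx phi).
Hypothesis hY : forall j, hom 1 (Y j).
Hypothesis finY : exists r, forall l p, (r <= l)%N -> hom l p -> Jspan J Y p.
Hypothesis indY : forall (f : {rmorphism mpoly d k -> mpoly n k}) F, 
  (forall c, f (mpolyC d c) = mpolyC n c) -> (forall i, f 'X_i = Y i) -> J (f F) -> F = 0.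

Variable yk : {rmorphism mpoly d k -> mpoly n k}.
Hypothesis ykC : forall c, yk (mpolyC d c) = mpolyC n c.
Hypothesis ykX : forall j, yk 'X_j = Y j.
Variable ys : {rmorphism mpoly d D -> mpoly n D}.
Hypothesis ysC : forall c, ys (mpolyC d c) = mpolyC n c.
Hypothesis ysX : forall j, ys 'X_j = mlift k RR n (Y j).
Variable th : {rmorphism mpoly d k -> gr}.
Hypothesis thC : forall c, th (mpolyC d c) = c%:A.
Hypothesis thX : forall j, th 'X_j = sym (evx (mlift k RR n (Y j))).
Variable eta : {rmorphism mpoly d D -> Om}.
Hypothesis etaE : forall p, eta p = phi (evx (ys p)).

Let nge_ev l Q : gauss n l Q -> nge l (evx Q) := @nge_evx _ _ _ _ _ _ _ _ sG ws _ evxC evxX l Q.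
Let grow l mu h : nge l h -> mu < l -> grows Rge mu (phi h) :=
  @grows_nge _ _ _ _ _ _ _ _ _ _ sevC sevX _ evxC evxX _ _ Gspan sg_power phiP pp0 l mu h.

Lemma ys_mlift F : ys (mlift k RR d F) = mlift k RR n (yk F).
Proof.
pose f1 := (ys \o mlift k RR d : {rmorphism _ -> _}); pose f2 := (mlift k RR n \o yk : {rmorphism _ -> _}).
rewrite -[LHS]/(f1 F) -[RHS]/(f2 F).
apply: mpoly_rmorph_ext => [c|j]; rewrite /f1 /f2 /= .
  by rewrite mliftC ysC ykC mliftC.
by rewrite mliftXU ysX ykX.
Qed.

Lemma gauss_ys l p : gauss d l p -> gauss n l (ys p).
Proof.
move=> hp; rewrite (mpolyE p) (rmorph_sum ys); apply: vf_sum => a _.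
rewrite -mul_mpolyC (rmorphM ys) /= ysC -[l]addr0.
apply: (@vfM _ _ (gauss n)); first exact: gauss_mpolyC.
have -> : mpolyX D a = mlift k RR d (mpolyX k a) by rewrite mliftX.
by rewrite ys_mlift; exact: gauss_mlift.
Qed.

Lemma nge_ys l p : gauss d l p -> nge l (evx (ys p)).
Proof. by move=> hp; exact/nge_ev/gauss_ys. Qed.

Lemma evx_const c : evx (mpolyC n (real_alg_const RR c)) = ma_monom 0 c%:A.
Proof. by rewrite evxC /real_alg_const ma_of_real_monom. Qed.

Lemma nge_mlift F : nge 0 (evx (mlift k RR n F)).
Proof. exact/nge_ev/gauss_mlift. Qed.

Lemma sym_mlift F : sym (evx (mlift k RR n (yk F))) = th F.
Proof.
elim/mpoly_alg_ind: F => [c|j|p q hp hq|p q hp hq].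
- by rewrite ykC mliftC evx_const thC sym_scalar.
- by rewrite ykX thX.
- by rewrite !rmorphD -hp -hq symD //; exact: nge_mlift.
- rewrite (rmorphM yk) (rmorphM (mlift k RR n)) (rmorphM evx) (rmorphM th) -hp -hq symM //; exact: nge_mlift.
Qed.

(** A vanishing symbol gives positive slope; for j large the growth of the j-th power beats the
    constant C, so F^j is a relation in J and the independence of Y applies. *)
Lemma th_inj F : th F = 0 -> F = 0.
Proof.
rewrite -sym_mlift => /(sym_eq0_gt (nge_mlift _))[l l0 hl].
have [|C hC] := grow hl (_ : l / 2 < l); first by lra.
pose j := (Num.bound (`|C| / (l / 2))).+1.
have Cj : C < j%:R * (l / 2).
  have C0 : 0 <= `|C| / (l / 2) by rewrite divr_ge0 //; lra.
  rewrite -ltr_pdivrMr; last by lra.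
  apply: le_lt_trans (_ : `|C| / (l / 2) < _).
    by rewrite ler_wpM2r ?ler_norm // invr_ge0; lra.
  by apply: lt_trans (archi_boundP C0) _; rewrite ltr_nat.
have JF : J (yk (F ^+ j)).
  exists (j%:R * (l / 2) - C); first by rewrite subr_gt0.
  by have := hC j; rewrite !rmorphXn.
have /eqP := indY ykC ykX JF.
by rewrite expf_eq0 => /andP[_ /eqP].
Qed.

Lemma sym_residue p : gauss d 0 p -> exists2 z, sym (evx (ys p)) = th z &
  vex (gauss d) 0 p -> z != 0.
Proof.
move=> hp; have [z hz] := gauss_residue hp; exists z; last first.
  move=> [_ np]; apply/eqP => z0; apply: np.
  by move: hz; rewrite z0 rmorph0 subr0.
rewrite -sym_mlift -ys_mlift -[p in LHS](subrK (mlift k RR d z)) (rmorphD ys) (rmorphD evx).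
have [m [m0 hm]] := hz; have hn := nge_ys hm.
rewrite symD; last 2 first.
- exact: ngeW (ltW m0) hn.
- exact/nge_ys/gauss_mlift.
by rewrite (sym_gt0 m0 hn) add0r.
Qed.

(** Scale p to Gauss valuation 0: its residue would be nonzero with vanishing symbol, against
    [th_inj]. *)
Lemma eta_inj p : eta p = 0 -> p = 0.
Proof.
move=> ep; apply: contrapT => /eqP /vex_normalize[t t0 ht].
have [z hz z0] := sym_residue (proj1 ht).
case/eqP: (z0 ht); apply: th_inj; rewrite -hz.
apply: (sym_phi phiP pp_sg); first exact: nge_ys (proj1 ht).
by rewrite -etaE rmorphM ep mulr0.
Qed.

Lemma sym_scalar_residue t : vD 0 t -> exists2 c : k, sym (evx (ys (mpolyC d t))) = c%:A &
  vex vD 0 t -> c != 0.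
Proof.
move=> ht; have hr := real_alg_residue ht; exists (ma_coef t 0); last first.
  move=> [_ nt]; apply/eqP => c0; apply: nt.
  by move: hr; rewrite c0 ma_monom0 subr0.
rewrite ysC -sym_scalar -evx_const.
rewrite -[t in LHS](subrK (real_alg_const RR (ma_coef t 0))) mpolyCD (rmorphD evx).
have [m [m0 hm]] := hr; have hn := nge_ev (@gauss_mpolyC _ _ vD n _ _ hm).
rewrite symD; last 2 first.
- exact: ngeW (ltW m0) hn.
- by apply/nge_ev/gauss_mpolyC; exact: real_alg_val_const.
by rewrite (sym_gt0 m0 hn) add0r.
Qed.

Let io : {rmorphism D -> Om} := eta \o mpolyC d (R := D).

Definition xmon (a : multinom n) : Om := phi (evx (mpolyX D a)).

(** The type [bmultinom n r.+1] consists of the monomials of degree at most r. *)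
Definition short r l u := exists p : bmultinom n r.+1 -> mpoly d D,
  (forall c, gauss d l (p c)) /\ u = \sum_c eta (p c) * xmon c.

Lemma short0 r l : short r l 0.
Proof. by exists (fun=> 0); split=> [c|]; [exact: vf0|rewrite big1 // => c _; rewrite rmorph0 mul0r]. Qed.

Lemma shortD r l u u' : short r l u -> short r l u' -> short r l (u + u').
Proof.
move=> [p [hp ->]] [p' [hp' ->]]; exists (fun c => p c + p' c); split=> [c|]; first exact: vfD.
by rewrite -big_split; apply: eq_bigr => c _; rewrite rmorphD mulrDl.
Qed.

Lemma shortM r l m t u : gauss d l t -> short r m u -> short r (l + m) (eta t * u).
Proof.
move=> ht [p [hp ->]]; exists (fun c => t * p c); split=> [c|]; first exact: vfM.
by rewrite mulr_sumr; apply: eq_bigr => c _; rewrite rmorphM mulrA.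
Qed.

Lemma phi_evxC t : phi (evx (mpolyC n t)) = eta (mpolyC d t).
Proof. by rewrite etaE ysC. Qed.

Lemma phi_evx_sum m (Q : mpoly n D) : (msize Q <= m)%N ->
  phi (evx Q) = \sum_(c : bmultinom n m) eta (mpolyC d (mcoeff c Q)) * xmon c.
Proof.
move=> hQ; rewrite {1}(mpolywE hQ) (rmorph_sum evx) (rmorph_sum phi); apply: eq_bigr => c _.
by rewrite -mul_mpolyC (rmorphM evx) (rmorphM phi) /= phi_evxC.
Qed.

Lemma hom_msize (R : comNzRingType) m (p : mpoly n R) : hom m p -> (msize p <= m.+1)%N.
Proof. by move=> /homP hp; rewrite msizeE; apply/bigmax_leqP_seq => a /hp ->. Qed.

Lemma short_evx r l (Q : mpoly n D) : gauss n l Q -> (msize Q <= r.+1)%N -> short r l (phi (evx Q)).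
Proof.
move=> hQ mQ; exists (fun c => mpolyC d (mcoeff c Q)); split; last exact: phi_evx_sum.
by move=> c; apply: gauss_mpolyC; exact: hQ.
Qed.

Lemma short_xmon r a : (mdeg a <= r)%N -> short r 0 (xmon a).
Proof.
move=> ar; apply: short_evx; first exact: gauss_mpolyX.
by rewrite msizeX.
Qed.

(** Normalization concerns symbols, so it rewrites a monomial of degree r + 1 only up to an error of
    positive valuation. Taking components, the error is again homogeneous of degree r + 1, a
    combination of the same finitely many monomials, and [nakayama] removes it. *)
Lemma shortening : exists r s0, vex vD 0 s0 /\
  forall a, (mdeg a <= r.+1)%N -> short r 0 (io s0 * xmon a).
Proof.
have [r hr] := finY; exists r.
have /choice[B hB] : forall a : bmultinom n r.+2, exists B : bmultinom n r.+2 -> D,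
    (forall b, vgt vD 0 (B b)) /\ short r 0 (xmon a - \sum_b io (B b) * xmon b).
  move=> a; have := bmdeg a; rewrite ltnS leq_eqVlt => /predU1P[ar|ar]; last first.
    exists (fun=> 0); split=> [b|]; first exact: vgt0.
    rewrite big1 ?subr0; first exact: short_xmon.
    by move=> b _; rewrite rmorph0 mul0r.
  have ha : hom r.+1 (mpolyX k a) by exact: homX.
  have [b [hb [l l0 [Q [hQ E]]]]] := system_hom (symideal_hpart sevX evxC evxX phiP pp0) hY ha (hr _ _ (leqnSn r) ha).
  have hom_lhs : hom r.+1 (mpolyX k a - \sum_j Y j * b j).
    by rewrite /hom hpartB ha; congr (_ - _); apply: hom_sum => j _; rewrite -add1n; exact: homM.
  have E' := phi_hpart sevX evxC evxX phiP pp0 r.+1 E.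
  rewrite (mlift_hom RR hom_lhs) rmorphB mliftX in E'.
  have hQ' := @gauss_hpart _ _ _ r.+1 _ _ hQ.
  have sQ' := hom_hpart r.+1 Q; set Q' := hpart r.+1 Q in E' hQ' sQ'.
  exists (fun b => mcoeff b Q'); split=> [c|]; first by exists l; split.
  rewrite -(phi_evx_sum (hom_msize sQ')) -E' (rmorphB evx) (rmorphB phi) -/(xmon _) subKr.
  rewrite (rmorph_sum (mlift k RR n)) (rmorph_sum evx) (rmorph_sum phi).
  apply: (@big_ind _ (short r 0)) => [||j _]; [exact: short0|exact: shortD|].
  rewrite (rmorphM (mlift k RR n)) (rmorphM evx) (rmorphM phi) /=.
  have -> : phi (evx (mlift k RR n (Y j))) = eta 'X_j by rewrite etaE ysX.
  rewrite -[0](addr0 0); apply: shortM; first exact: gauss_mpolyX.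
  apply: short_evx; first exact: gauss_mlift.
  exact/hom_msize/mlift_hom.
have [|||||s0 vs0 h] := @nakayama RR D vD Om io (short r 0) _ _ _ (bmultinom n r.+2) (fun a => xmon a) B.
- exact: short0.
- exact: shortD.
- move=> t u ht hu; rewrite -[0](addr0 0); apply: shortM => //.
  exact: gauss_mpolyC.
- by move=> a b; case: (hB a).
- by move=> a; case: (hB a).
by exists s0; split=> // a ar; have := h (BMultinom (ar : (mdeg a < r.+2)%N)).
Qed.

Lemma xmon_mnm1 a i : xmon (mnm_add a (mnm1 i)) = xmon (mnm1 i) * xmon a.
Proof. by rewrite /xmon mpolyXD mulrC (rmorphM evx) (rmorphM phi). Qed.

Lemma mnm_pred (a : multinom n) : (0 < mdeg a)%N -> exists i b, a = mnm_add b (mnm1 i).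
Proof.
move=> a0; have [i ai] : exists i, a i != 0%N.
  apply: contrapT => h; move: a0; rewrite mdegE big1 // => i _.
  by apply/eqP; apply: contrapT => /negP ai; apply: h; exists i.
by exists i, (mnm_sub a (mnm1 i)); rewrite submK // lep1mP.
Qed.

Lemma short_mono r t t' s0 l u : vex vD 0 s0 -> (t <= t')%N ->
  short r l (io (s0 ^+ t) * u) -> short r l (io (s0 ^+ t') * u).
Proof.
move=> v0 tt h; rewrite -(subnK tt) exprD rmorphM -mulrA -[l]add0r; apply: shortM => //.
by apply: gauss_mpolyC; have := vfX (t' - t) (proj1 v0); rewrite mulr0.
Qed.

(** Each further degree costs one more factor s0, so the exponent t depends on u; the factors still
    have valuation 0. *)
Lemma shortening_all : exists r s0, vex vD 0 s0 /\
  forall l u, Rge l u -> exists t, short r l (io (s0 ^+ t) * u).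
Proof.
have [r [s0 [v0 h]]] := shortening; exists r, s0; split=> //.
have mon m a : (mdeg a <= m)%N -> exists t, short r 0 (io (s0 ^+ t) * xmon a).
  elim: m a => [|m IH] a am.
    by exists 1%N; apply: h; exact: leq_trans am _.
  have [ar|ra] := leqP (mdeg a) r.+1; first by exists 1%N; exact: h.
  have [|i [b E]] := @mnm_pred a; first exact: leq_trans ra.
  have [|t [p [hp Ep]]] := IH b; first by move: am; rewrite E mdegD mdeg1 addn1.
  exists t.+1; have -> : io (s0 ^+ t.+1) * xmon a = io s0 * xmon (mnm1 i) * (io (s0 ^+ t) * xmon b).
    by rewrite E xmon_mnm1 exprS rmorphM; ring.
  rewrite Ep mulr_sumr; apply: (@big_ind _ (short r 0)) => [||c _]; [exact: short0|exact: shortD|].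
  have -> : io s0 * xmon (mnm1 i) * (eta (p c) * xmon c) = eta (p c) * (io s0 * xmon (mnm_add c (mnm1 i))).
    by rewrite xmon_mnm1; ring.
  rewrite -[0](addr0 0); apply: shortM => //; apply: h.
  by rewrite mdegD mdeg1 addn1; exact: bmdeg.
move=> l u [Q [hQ ->]]; rewrite (mpolyE Q) (rmorph_sum evx) (rmorph_sum phi).
apply: (@big_ind _ (fun u => exists t, short r l (io (s0 ^+ t) * u))) => [|u1 u2 [t1 h1] [t2 h2]|a _].
- by exists 0%N; rewrite mulr0; exact: short0.
- exists (t1 + t2)%N; rewrite mulrDr; apply: shortD.
    by apply: short_mono h1; rewrite ?leq_addr.
  by apply: short_mono h2; rewrite ?leq_addl.
- have [t ht] := mon _ a (leqnn _); exists t.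
  rewrite -mul_mpolyC (rmorphM evx) (rmorphM phi) /= phi_evxC mulrCA -[l]addr0.
  apply: shortM => //; apply: gauss_mpolyC; exact: hQ.
Qed.

Local Notation lat := (lat (mpolyC d (R := D)) vD (gauss d) eta).

(** Here e is a maximal independent set of short monomials, c clears the denominators of all short
    monomials in terms of e, and - C bounds the valuations of the resulting coordinates from
    below. *)
Lemma lattice : exists N (e : 'I_N.+1 -> Om) c (C : RR),
  [/\ forall i, Rge 0 (e i), pindep eta e, c != 0 & forall l u, Rge l u -> lat e (l - C) (eta c * u)].
Proof.
have [r [s0 [v0 h]]] := shortening_all.
have [|N [e [hS ei hspan]]] := @max_indep _ _ eta (fun u => exists c : bmultinom n r.+1, u = xmon c)
    #|{: bmultinom n r.+1}|.+1.
  move=> u /choice[c hc].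
  apply: (@pspan_dep _ _ eta _ (fun i : 'I_#|{: bmultinom n r.+1}| => xmon (enum_val i))) => // i.
  by rewrite hc -(enum_rankK (c i)); exact: pspan_id.
have /choice[q hq] : forall c : bmultinom n r.+1, exists q, q != 0 /\ pspan eta e (eta q * xmon c).
  by move=> c; have [|q ? ?] := hspan (xmon c); [exists c|exists q].
have {}hq c := hq c; have q0 c : q c != 0 by case: (hq c).
have /choice[p hp] : forall c : bmultinom n r.+1, exists p : 'I_N -> mpoly d D, eta (q c) * xmon c = \sum_i eta (p i) * e i.
  by move=> c; case: (hq c) => _ [p hp]; exists p.
pose c := \prod_b q b; pose p' (b : bmultinom n r.+1) i := (\prod_(b' | b' != b) q b') * p b i.
have hp' (b : bmultinom n r.+1) : eta c * xmon b = \sum_i eta (p' b i) * e i.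
  rewrite /c (bigD1 b) //= [X in eta X]mulrC rmorphM -mulrA hp mulr_sumr.
  by apply: eq_bigr => i _; rewrite /p' rmorphM mulrA.
have [C hC] : exists C, forall b i, gauss d (- C) (p' b i).
  have [l hl] := @vf_boundf _ _ (gauss d) (bmultinom n r.+1 * 'I_N)%type (fun x => p' x.1 x.2).
  by exists (- l) => b i; rewrite opprK; exact: (hl (b, i)).
(* An empty e would make the monomial 1 torsion, against [eta_inj]. *)
case: N e hS ei hspan p hp p' hp' hC hq => [|N] e hS ei hspan p hp p' hp' hC hq.
  have b0 : (mdeg (mnm0 : multinom n) < r.+1)%N by rewrite mdeg0.
  case/eqP: (q0 (BMultinom b0)); apply: eta_inj.
  by have := hp (BMultinom b0); rewrite big_ord0 /xmon /= mpolyX0 !rmorph1 mulr1.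
exists N, e, c, C; split=> //.
- move=> i; have [b ->] := hS i; exists (mpolyX D b); split=> //; exact: gauss_mpolyX.
- by rewrite prodf_seq_neq0; apply/allP => b _; exact: q0.
move=> l u /h[t [f [hf Ef]]]; exists (s0 ^+ t), (fun i => \sum_b f b * p' b i); split.
- by have := vexX t v0; rewrite mulr0.
- rewrite mulrCA Ef mulr_sumr.
  under [RHS]eq_bigr => i _ do rewrite rmorph_sum mulr_suml.
  rewrite [RHS]exchange_big; apply: eq_bigr => b _.
  by rewrite mulrCA hp' mulr_sumr; apply: eq_bigr => i _; rewrite rmorphM mulrA.
- by move=> i; apply: vf_sum => b _; apply: vfM.
Qed.

Lemma symbol_equation : exists N, forall l0 h, nge l0 h -> exists t g (a : 'I_N.+1 -> mpoly d D),
  [/\ vex vD g t, io t * phi h ^+ N.+1 = \sum_i eta (a i) * phi h ^+ i &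
      forall q mu, vex (gauss d) 0 q -> (forall mu', mu' < mu -> grows Rge mu' (eta q * phi h)) ->
      forall i : 'I_N.+1, gauss d (g + (N.+1 - i)%:R * mu) (a i)].
Proof.
have [N [e [c [C [he ei c0 hlat]]]]] := lattice; exists N => l0 h hh.
have io_inj : injective (mpolyC d (R := D)).
  by move=> x y /eqP; rewrite mpolyC_eq => /eqP.
have vio l t : vex vD l t -> vex (gauss d) l (mpolyC d t) by exact: vex_mpolyC.
have [|t [g [a [ht hE hv]]]] := integral_equation io_inj vio (cic_poly io_inj (@cic_mpoly D d))
    Om_domain eta_inj ei c0 (h := phi h).
  move=> j i; have [|C' hC'] := grow hh (_ : l0 - 1 < l0); first by lra.
  exists (j%:R * (l0 - 1) - C' + 0 - C); rewrite -mulrA; apply: hlat.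
  exact: RgeM.
exists t, g, a; split=> // q mu vq hq i; apply: (hv q) => // mu' /hq[C' hC'].
exists (C' + C) => j i'.
have -> : eta (c * q ^+ j) * phi h ^+ j * e i' = eta c * ((eta q * phi h) ^+ j * e i').
  by rewrite rmorphM rmorphXn exprMn; ring.
have -> : j%:R * mu' - (C' + C) = j%:R * mu' - C' + 0 - C by ring.
by apply: hlat; exact: RgeM.
Qed.

(** The residue of the integral equation. When mu > 0 its lower coefficients have positive
    valuation, so their residues vanish. *)
Lemma symbol_relation : exists N, forall h, nge 0 h -> 
  forall q mu, vex (gauss d) 0 q -> 0 <= mu -> (forall mu', mu' < mu -> grows Rge mu' (eta q * phi h)) ->
  exists z : 'I_N.+1 -> mpoly d k, sym h ^+ N.+1 = \sum_i th (z i) * sym h ^+ i /\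
    (0 < mu -> forall i, z i = 0).
Proof.
have [N HN] := symbol_equation; exists N => h hh q mu vq mu0 hq.
have [t [g [a [vt E va]]]] := HN _ _ hh; have {}va := va q mu vq hq.
(* It has valuation - g, so t1 t has valuation 0 and its residue is a nonzero constant that can be
   inverted in k. *)
pose t1 : D := ma_monom g 1.
have vt1 : vex vD (- g) t1 by exact: real_alg_vex_monom (oner_neq0 k).
have va' (i : 'I_N.+1) : gauss d ((N.+1 - i)%:R * mu) (mpolyC d t1 * a i).
  rewrite -[X in gauss d X](addKr g); apply: vfM => //.
  exact: gauss_mpolyC (proj1 vt1).
have va0 (i : 'I_N.+1) : gauss d 0 (mpolyC d t1 * a i) by apply: vfW (va' i); rewrite mulr_ge0.
have vt' : vex vD 0 (t1 * t) by rewrite -(addNr g); exact: vexM.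
have [c Ec c0] := sym_scalar_residue (proj1 vt'); have {}c0 := c0 vt'.
have /choice[z hz] : forall i : 'I_N.+1, exists z, sym (evx (ys (mpolyC d t1 * a i))) = th z.
  by move=> i; have [z] := sym_residue (va0 i); exists z.
exists (fun i => mpolyC d c^-1 * z i); split; last first.
  move=> mu1 i; suff -> : z i = 0 by rewrite mulr0.
  apply: th_inj; rewrite -hz; apply: sym_gt0 (nge_ys (va' i)).
  by rewrite mulr_gt0 // ltr0n subn_gt0.
have hX j : nge 0 (h ^+ j) by have := ngeX j hh; rewrite mulr0.
have M0 (x y : MA) : nge 0 x -> nge 0 y -> nge 0 (x * y).
  by move=> hx hy; rewrite -[0](addr0 0); exact: ngeM.
have key : c%:A * sym h ^+ N.+1 = \sum_i th (z i) * sym h ^+ i.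
  transitivity (sym (evx (ys (mpolyC d (t1 * t))) * h ^+ N.+1)).
    rewrite symM //; last by apply: nge_ys; apply: gauss_mpolyC; case: vt'.
    by rewrite Ec symX.
  transitivity (sym (\sum_i evx (ys (mpolyC d t1 * a i)) * h ^+ i)); last first.
    rewrite sym_sum => [|i _]; last by apply: M0 => //; exact: nge_ys.
    apply: eq_bigr => i _; rewrite symM ?symX ?hz //; exact: nge_ys.
  apply: (sym_phi_eq phiP pp_sg).
  - by apply: M0 => //; apply: nge_ys; apply: gauss_mpolyC; case: vt'.
  - by apply: nge_sum => i _; apply: M0 => //; exact: nge_ys.
  rewrite rmorphM -etaE rmorph_sum mpolyCM rmorphM -mulrA rmorphXn E mulr_sumr.
  apply: eq_bigr => i _.
  by rewrite [in RHS]rmorphM -etaE (rmorphM eta) rmorphXn mulrA.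
under eq_bigr => i _ do rewrite rmorphM thC -mulrA.
rewrite -mulr_sumr -key mulrA -scalerAl mul1r scalerA mulVf // scale1r mul1r //.
Qed.

Lemma vex_mlift q : q != 0 -> vex (gauss d) 0 (mlift k RR d q).
Proof.
move=> q0; split; first exact: gauss_mlift.
move=> [m [m0 hm]]; case/eqP: q0; apply/mpolyP => a; rewrite mcoeff0.
apply/eqP; apply: contrapT => /negP qa; have := hm a; rewrite mcoeff_mlift => /real_alg_valE/(_ 0).
by rewrite ma_monomE eqxx mulr1n oppr0 => /(_ qa); rewrite leNgt m0.
Qed.

Lemma th_mlift q : th q = sym (evx (ys (mlift k RR d q))).
Proof. by rewrite ys_mlift sym_mlift. Qed.

(** If the symbol of q h vanishes, q h has positive slope; [symbol_relation] then turns the equation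
    for u into u^(N+1) = 0. *)
Lemma gr_torsion_free q u : th q * u = 0 -> q = 0 \/ u = 0.
Proof.
have [->|q0] := eqVneq q 0; first by left.
have [h hh ->] := sym_ex u; have vq := vex_mlift q0.
have nq : nge 0 (evx (ys (mlift k RR d q))) by apply: nge_ys; exact: gauss_mlift.
rewrite th_mlift -symM // => /(sym_eq0_gt _)[|l l0 hl].
  by rewrite -[0](addr0 0); exact: ngeM.
right; have [N HN] := symbol_relation.
have [|z [E z0]] := HN h hh _ l vq (ltW l0).
  by move=> mu' /(grow hl); rewrite etaE -rmorphM.
apply: (gr_reduced sgX (n := N.+1)); rewrite E big1 // => i _.
by rewrite z0 // rmorph0 mul0r.
Qed.

Lemma gr_integral u : exists N (a : 'I_N -> mpoly d k), u ^+ N = \sum_i th (a i) * u ^+ i.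
Proof.
have [N HN] := symbol_relation; have [h hh ->] := sym_ex u.
have [|z [E _]] := HN h hh 1 0 (vex1 _) (lexx 0).
  by move=> mu' /(grow hh); rewrite rmorph1 mul1r.
by exists N.+1, z.
Qed.

Lemma gauss_min (I : finType) (F : I -> mpoly d D) (i0 : I) : F i0 != 0 ->
  exists l, (forall i, gauss d l (F i)) /\ exists i, vex (gauss d) l (F i).
Proof.
move=> Fi0.
have /choice[L hL] : forall i, exists l, F i != 0 -> vex (gauss d) l (F i).
  move=> i; have [->|/(vf_ex (gauss d))[l hl]] := eqVneq (F i) 0; first by exists 0.
  by exists l.
case: (@Order.TotalTheory.arg_minP _ RR _ i0 (fun i => F i != 0) L Fi0) => i Fi hi.
exists (L i); split=> [j|]; last by exists i; exact: hL.
have [->|Fj] := eqVneq (F j) 0; first exact: vf0.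
exact: vfW (hi j Fj) (proj1 (hL j Fj)).
Qed.

(** Lifts of N + 2 symbols are dependent over D[Y]. Once the relation is scaled to minimal Gauss
    valuation 0, its residue is a nontrivial relation over k[Y]. *)
Lemma gr_rank : exists R, forall u : 'I_R -> gr, ~ pindep th u.
Proof.
have [N [e [c [C [_ ei c0 hlat]]]]] := lattice.
exists N.+2 => u hu.
have /choice[h hh] : forall i, exists h, nge 0 h /\ u i = sym h.
  by move=> i; have [h ? ?] := sym_ex (u i); exists h.
have /choice[t ht] : forall i, exists t, t != 0 /\ pspan eta e (eta (mpolyC d t * c) * phi (h i)).
  move=> i; have [|C' hC'] := grow (proj1 (hh i)) (_ : -1 < 0); first by rewrite ltrN10.
  have [t [p [vt E _]]] := hlat _ _ (hC' 1%N); exists t; split; first exact: vex_neq0 vt.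
  by exists p; rewrite rmorphM -mulrA; rewrite expr1 in E.
have [] := @pspan_dep _ _ eta _ e N.+2 (fun i => eta (mpolyC d (t i) * c) * phi (h i)) (leqnn _).
  by move=> i; case: (ht i).
move=> p Ep i; apply/eqP; apply: contrapT => /negP pi.
pose F j := p j * (mpolyC d (t j) * c).
have Fi : F i != 0.
  by rewrite !mulf_neq0 // mpolyC_eq0; case: (ht i).
have [l [vF [i1 vi1]]] := gauss_min Fi.
pose T : D := ma_monom l 1.
have vT : vex (gauss d) (- l) (mpolyC d T) by apply: vex_mpolyC; exact: real_alg_vex_monom (oner_neq0 k).
have vTF j : gauss d 0 (mpolyC d T * F j) by rewrite -(addNr l); apply: vfM => //; case: vT.
have /choice[z hz] : forall j, exists z, sym (evx (ys (mpolyC d T * F j))) = th z /\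
    (vex (gauss d) 0 (mpolyC d T * F j) -> z != 0).
  by move=> j; have [z ? ?] := sym_residue (vTF j); exists z.
have z1 : z i1 != 0 by apply: (hz i1).2; rewrite -(addNr l); exact: vexM.
case/eqP: z1; apply: hu.
have nn j : nge 0 (evx (ys (mpolyC d T * F j)) * h j).
  by rewrite -[0](addr0 0); apply: ngeM; [exact: nge_ys|case: (hh j)].
have <- : sym (\sum_j evx (ys (mpolyC d T * F j)) * h j) = \sum_j th (z j) * u j.
  rewrite sym_sum //; apply: eq_bigr => j _; rewrite symM //; last by case: (hh j).
  by rewrite (hz j).1 (hh j).2.
  exact: nge_ys.
apply: (sym_phi phiP pp_sg); first exact: nge_sum.
rewrite rmorph_sum -[RHS](mulr0 (eta (mpolyC d T))) -{2}Ep mulr_sumr; apply: eq_bigr => j _.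
by rewrite rmorphM -etaE !rmorphM !mulrA.
Qed.

(** Every slope is allowed, so all lower coefficients of the integral equation vanish and a power of
    [phi h] is 0 in the domain Om. *)
Lemma seminorm_infinite m f : f \in G m -> sg f = +oo%E -> pp f.
Proof.
move=> fG fy; pose h : MA := ma_monom (m, 0) f.
have hh l : nge l h by apply: nge_monom => //; rewrite fy leey.
have [N HN] := symbol_equation; have [t [g [a [vt E va]]]] := HN 0 h (hh 0).
have a0 i : a i = 0.
  apply: contrapT => /eqP /(vf_ex (gauss d))[l vl].
  (* This slope forces the valuation of a_i to be at least l + 1, although it is l. *)
  pose mu := (l - g + 1) / (N.+1 - i)%:R.
  have Emu : (N.+1 - i)%:R * mu = l - g + 1.
    by rewrite /mu mulrC divfK // pnatr_eq0 -lt0n subn_gt0.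
  have gmu mu' : mu' < mu -> grows Rge mu' (eta 1 * phi h).
    by rewrite rmorph1 mul1r; exact: grow.
  have := vex_le vl (va 1 mu (vex1 _) gmu i).
  have -> : g + (N.+1 - i)%:R * mu = l + 1 by rewrite Emu; ring.
  by rewrite gerDl ler10.
have t0 : io t != 0.
  apply/eqP => /eta_inj /eqP; rewrite mpolyC_eq0; exact/negP/(vex_neq0 vt).
have : phi h = 0.
  have [||] := Om_domain (a := io t) (b := phi h ^+ N.+1).
  - by rewrite E big1 // => i _; rewrite a0 rmorph0 mul0r.
  - by move/eqP: t0.
  elim: N.+1 => [|j IH]; first by rewrite expr0 => h1; rewrite -[phi h]mul1r h1 mul0r.
  by rewrite exprS => /Om_domain[].
by move/phiP/(_ (m, 0)); rewrite ma_monomE eqxx mulr1n.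
Qed.

(** Multiplication by the common denominator c moves U into a finite k[Y]-module, where [opnoeth]
    applies; torsion-freeness cancels c afterwards. Generators over k[Y] also generate over k[x]. *)
Lemma gr_noetherian (X : nat -> gr -> gr) U : (forall (i : 'I_n) u, X i u = sym (evx 'X_i) * u) ->
  opsub X n U -> opfg X n U.
Proof.
move=> XE Us; have [R rank] := gr_rank.
have [r [e [ei [c c0 span]]]] := finite_den gr_torsion_free (gr_reduced sgX) gr_integral rank.
have XM V F u : opsub X n V -> V u -> V (sym (evx (mlift k RR n F)) * u).
  move=> Vs; elim/mpoly_alg_ind: F u => [a|i|p q hp hq|p q hp hq] u Vu.
  - by rewrite mliftC evx_const sym_scalar -scalerAl mul1r; exact: (opsubZ Vs).
  - by rewrite mliftXU -XE; apply: (opsubX Vs).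
  - rewrite rmorphD rmorphD symD ?mulrDl; try exact: nge_mlift.
    by apply: (opsubD Vs); [exact: hp|exact: hq].
  - rewrite (rmorphM (mlift k RR n)) (rmorphM evx) symM -?mulrA; try exact: nge_mlift.
    exact/hp/hq.
pose YX (j : nat) (u : gr) : gr := if (insub j : option 'I_d) is Some i then th 'X_i * u else 0.
have YXE (j : 'I_d) u : YX j u = th 'X_j * u by rewrite /YX valK.
have XY V : opsub X n V -> opsub YX d V.
  move=> Vs; split; [exact: opsub0 Vs|exact: opsubD Vs|exact: opsubZ Vs|].
  by move=> j u jd Vu; rewrite (YXE (Ordinal jd)) thX; exact: XM.
have YM V F u : opsub YX d V -> V u -> V (th F * u).
  move=> Vs; elim/mpoly_alg_ind: F u => [a|i|p q hp hq|p q hp hq] u Vu.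
  - by rewrite thC -scalerAl mul1r; exact: (opsubZ Vs).
  - by rewrite -YXE; apply: (opsubX Vs).
  - by rewrite rmorphD mulrDl; apply: (opsubD Vs); [exact: hp|exact: hq].
  - by rewrite rmorphM -mulrA; exact/hp/hq.
pose im V (u : gr) := exists2 v, V v & u = th c * v.
have imS V : opsub X n V -> opsub YX d (im V).
  move=> /XY Vs; split.
  - by exists 0; [exact: opsub0 Vs|rewrite mulr0].
  - by move=> _ _ [u Vu ->] [v Vv ->]; exists (u + v); [exact: (opsubD Vs Vu Vv)|rewrite mulrDr].
  - by move=> a _ [u Vu ->]; exists (a *: u); [exact: (opsubZ Vs)|exact: scalerAr].
  - move=> j _ jd [u Vu ->]; exists (YX j u); first exact: (opsubX Vs jd Vu).
    by rewrite !(YXE (Ordinal jd)) mulrCA.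
have [||||s' [hs' gs']] := @opnoeth k gr YX _ _ _ d [seq e i | i <- enum 'I_r] (im U) (imS _ Us).
- by move=> i u v; rewrite /YX; case: insub => [j|]; rewrite ?mulrDr ?addr0.
- by move=> i a u; rewrite /YX; case: insub => [j|]; rewrite ?scalerAr ?scaler0.
- move=> i j u; rewrite /YX; case: insub => [i'|]; case: insub => [j'|]; rewrite ?mulr0 //.
  exact: mulrCA.
- move=> _ [u Uu ->]; have [p ->] := span u.
  move=> V Vs hV; apply: (@big_ind _ V) => [||i _]; [exact: opsub0 Vs|exact: opsubD Vs|].
  by apply: YM => //; apply: hV; apply: map_f; rewrite mem_enum.
have [s1 [s1U Es]] : exists s1 : seq gr, (forall u, u \in s1 -> U u) /\ s' = [seq th c * u | u <- s1].
  elim: s' hs' {gs'} => [|u s' IH] hs'; first by exists [::].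
  have [|s1 [h1 ->]] := IH; first by move=> v vs; apply: hs'; rewrite in_cons vs orbT.
  have [v Vv ->] := hs' u (mem_head _ _); exists (v :: s1); split=> // v'.
  by rewrite in_cons => /predU1P[->|/h1].
exists s1; split=> // u Uu V Vs hV.
have [||v Vv E] := gs' (th c * u) _ (im V) (imS _ Vs).
- by exists u.
- by move=> v; rewrite Es => /mapP[v1 /hV Vv1 ->]; exists v1.
suff -> : u = v by [].
apply/eqP; rewrite -subr_eq0; apply/eqP.
have [|/eqP c1|//] := @gr_torsion_free c (u - v); first by rewrite mulrBr E subrr.
by rewrite (negPf c0) in c1.
Qed.

End NoetherianSymbols.

Section PrimeCore.
Variables (k : fieldType) (RR : realType) (A : comAlgType k) (G : grading A).
Variables (sg : alg_seminorm A RR) (pp : A -> Prop).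
Local Notation D := (real_alg k RR).
Local Notation MA := (monoid_algebra (nat * RR)%type A).
Local Notation gr := (gr G sg).
Hypothesis inf : forall q : {poly k}, q != 0 -> exists x, q.[x] != 0.
Hypothesis pp0 : pp 0.
Hypothesis ppD : forall a b, pp a -> pp b -> pp (a + b).
Hypothesis ppM : forall a b, pp b -> pp (a * b).
Hypothesis pp1 : ~ pp 1.
Hypothesis ppP : forall a b, pp (a * b) -> pp a \/ pp b.
Hypothesis pp_sg : forall f, pp f -> sg f = +oo%E.
Hypothesis sgX : forall (f : A) (mu : RR) j, (0 < j)%N ->
  ((j%:R * mu)%:E <= sg (f ^+ j)%R)%E -> (mu%:E <= sg f)%E.
Variables (n : nat) (s : 'I_n -> A) (w : 'I_n -> RR).
Hypothesis sG : forall i, s i \in G 1%N.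
Hypothesis ws : forall i, ((w i)%:E <= sg (s i))%E.
Variable sev : {rmorphism mpoly n k -> A}.
Hypothesis sevC : forall c, sev (mpolyC n c) = c%:A.
Hypothesis sevX : forall i, sev 'X_i = s i.
Hypothesis Gspan : forall m f, f \in G m -> exists2 F, hom m F & f = sev F.
Hypothesis sg_power : forall m f (mu : RR), f \in G m -> (mu%:E < sg f)%E ->
  exists d F, [/\ (0 < d)%N, hom (m * d) F, forall a, a \in msupp F -> d%:R * mu <= wt w a
    & pp (f ^+ d - sev F)].

Theorem prime_core : (forall m f, f \in G m -> sg f = +oo%E -> pp f) /\
  forall (X : nat -> gr -> gr) U,
    (forall (i : 'I_n) u, X i u = sym G sg (ma_monom (1%N, w i) (s i)) * u) ->
    opsub X n U -> opfg X n U.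
Proof.
have [Om [phi [phiP dom]]] := @coef_quotient RR A pp pp0 ppD ppM pp1 ppP.
have [evx evxC evxX] := mpoly_eval (@ma_of_real k RR A : {rmorphism D -> MA})
  (fun i : 'I_n => ma_monom (1%N, w i) (s i) : MA).
pose J := symideal evx phi.
have [d [Y [hY finY indY]]] := noether_normalization inf (symideal0 evx phi) (@symidealD _ _ _ _ evx _ phi)
  (@symidealM _ _ _ _ evx _ phi) (symideal_hpart sevX evxC evxX phiP pp0)
  (symideal1 sG ws evxC evxX phiP pp_sg).
have [yk ykC ykX] := mpoly_eval (mpolyC n (R := k)) Y.
have [ys ysC ysX] := mpoly_eval (mpolyC n (R := D)) (fun j => mlift k RR n (Y j)).
have [th thC thX] := mpoly_eval (GRing.in_alg gr) (fun j => sym G sg (evx (mlift k RR n (Y j)))).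
pose eta : {rmorphism mpoly d D -> Om} := phi \o (evx \o ys).
have etaE p : eta p = phi (evx (ys p)) by [].
split=> [m f|X U XE Us].
  exact: (seminorm_infinite sG ws sevC sevX evxC evxX Gspan sg_power phiP pp_sg pp0 dom hY finY
    indY ykC ykX ysC ysX thC thX etaE).
apply: (gr_noetherian sG ws sevC sevX evxC evxX Gspan sg_power phiP pp_sg pp0 dom sgX hY finY
    indY ykC ykX ysC ysX thC thX etaE _ Us).
by move=> i u; rewrite XE evxX.
Qed.

End PrimeCore.

(** * Homogeneous components and orthogonal bases *)

Section Components.
Variables (k : fieldType) (A : comAlgType k) (G : grading A).

Lemma gcompB m f g : f \in G m -> g \in G m -> f - g \in G m.
Proof. by move=> fG gG; rewrite rpredD // -scaleN1r rpredZ. Qed.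

Lemma hc_exists : exists hc : A -> nat -> A, forall f, (forall m, hc f m \in G m) /\
  exists N, (forall m, (N <= m)%N -> hc f m = 0) /\ f = \sum_(m < N) hc f m.
Proof.
suff /choice[h hh] : forall f, exists t : nat -> A, (forall m, t m \in G m) /\
  exists N, (forall m, (N <= m)%N -> t m = 0) /\ f = \sum_(m < N) t m by exists h.
move=> f; have [N [t [tG ft]]] := gcomp_span G f.
exists (fun m => if (m < N)%N then t m else 0); split=> [m|].
  by case: ifP => _; rewrite ?tG ?rpred0.
exists N; split=> [m|]; first by rewrite leqNgt => /negbTE ->.
by rewrite ft; apply: eq_bigr => i _; rewrite ltn_ord.
Qed.

Definition hc m f := projT1 (cid hc_exists) f m.

Lemma hc_in m f : hc m f \in G m.
Proof. by rewrite /hc; case: cid => h H /=; case: (H f). Qed.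

Lemma hc_bound f : exists N, forall m, (N <= m)%N -> hc m f = 0.
Proof. by rewrite /hc; case: cid => h H /=; case: (H f) => _ [N [? _]]; exists N. Qed.

Lemma hc_expand f N : (forall m, (N <= m)%N -> hc m f = 0) -> f = \sum_(m < N) hc m f.
Proof.
rewrite /hc; case: cid => h H /= hN; case: (H f) => _ [N' [hN' {1}->]].
rewrite -!(big_mkord xpredT (h f)).
have [NN|NN] := leqP N N'.
  rewrite (big_cat_nat (leq0n N) NN) //= [X in _ + X]big_nat_cond [X in _ + X]big1 ?addr0 // => i /andP[/andP[Ni _] _].
  exact: hN.
rewrite [RHS](big_cat_nat (leq0n N') (ltnW NN)) //= [X in _ + X]big_nat_cond [X in _ + X]big1 ?addr0 // => i /andP[/andP[Ni _] _].
exact: hN'.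
Qed.

Lemma hc_uniq N (t : nat -> A) m : (forall i, t i \in G i) ->
  hc m (\sum_(i < N) t i) = if (m < N)%N then t m else 0.
Proof.
move=> tG; set f := \sum_(i < N) t i; have [N' hN'] := hc_bound f.
pose M := maxn m.+1 (maxn N N').
pose t' i := if (i < N)%N then t i else 0.
have ft : f = \sum_(i < M) t' i.
  have NM : (N <= M)%N by rewrite /M !leq_max leqnn orbT.
  rewrite /f (big_ord_widen M t NM) big_mkcond; apply: eq_bigr => i _.
  by rewrite /t'.
have fh : f = \sum_(i < M) hc i f.
  by apply: hc_expand => i Mi; apply: hN'; apply: leq_trans Mi; rewrite /M !leq_max leqnn !orbT.
rewrite -/(t' m); apply/eqP; rewrite -subr_eq0; apply/eqP.
apply: (@gcomp_free _ _ G M (fun i => hc i f - t' i)).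
- by move=> i; apply: gcompB; rewrite ?hc_in // /t'; case: ifP => _; rewrite ?tG ?rpred0.
- by rewrite sumrB -fh -ft subrr.
- by rewrite /M leq_max leqnn.
Qed.

Lemma hc_id m f l : f \in G m -> hc l f = if l == m then f else 0.
Proof.
move=> fG; have {1}-> : f = \sum_(i < m.+1) (if i == m :> nat then f else 0).
  by rewrite big_ord_recr /= eqxx big1 ?add0r // => i _; rewrite ltn_eqF.
rewrite (@hc_uniq _ (fun i => if i == m then f else 0)).
  by rewrite ltnS; case: eqP => [->|_]; rewrite ?leqnn ?if_same.
by move=> i; case: eqP => [->|]; rewrite ?rpred0.
Qed.

Fact hc_additive m : zmod_morphism (hc m).
Proof.
move=> f g; have [N hN] := hc_bound f; have [N' hN'] := hc_bound g.
pose M := maxn m.+1 (maxn N N').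
have fE : f = \sum_(i < M) hc i f.
  by apply: hc_expand => i Mi; apply: hN; apply: leq_trans Mi; rewrite /M !leq_max leqnn orbT.
have gE : g = \sum_(i < M) hc i g.
  by apply: hc_expand => i Mi; apply: hN'; apply: leq_trans Mi; rewrite /M !leq_max leqnn !orbT.
rewrite {1}fE {1}gE -sumrB (@hc_uniq _ (fun i => hc i f - hc i g)).
  by rewrite /M leq_max leqnn.
by move=> i; apply: gcompB; exact: hc_in.
Qed.

HB.instance Definition _ m := GRing.isZmodMorphism.Build A A (hc m) (hc_additive m).

Lemma hcMl l a m f : a \in G l -> hc m (a * f) = if (l <= m)%N then a * hc (m - l) f else 0.
Proof.
move=> aG; have [N hN] := hc_bound f; rewrite {1}(hc_expand hN) mulr_sumr raddf_sum /=.
have term i : hc m (a * hc i f) = if m == (l + i)%N then a * hc i f else 0.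
  by apply: hc_id; apply: gcompM => //; exact: hc_in.
case: leqP => lm; last first.
  by rewrite big1 // => i _; rewrite term ltn_eqF // (leq_trans lm) // leq_addr.
have [mN|Nm] := ltnP (m - l) N; last first.
  rewrite hN // mulr0 big1 // => i _; rewrite term; case: eqP => // E.
  by move: Nm; rewrite E addKn leqNgt ltn_ord.
rewrite (bigD1 (Ordinal mN)) //= term subnKC // eqxx big1 ?addr0 // => i.
rewrite -val_eqE /= term => im; case: eqP => // E; case/eqP: im.
by rewrite E addKn.
Qed.

Lemma hcM N m a b : (forall i, (N <= i)%N -> hc i a = 0) ->
  hc m (a * b) = \sum_(i < N | (i <= m)%N) hc i a * hc (m - i) b.
Proof.
move=> hN; rewrite {1}(hc_expand hN) mulr_suml raddf_sum [RHS]big_mkcond.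
by apply: eq_bigr => i _; rewrite /= (hcMl _ _ (hc_in i a)).
Qed.

(** Let l be the lowest degree in which b has a component outside P. By induction on m, the
    component of a b in degree m + l puts the degree m component of a in P. *)
Lemma homogeneous_prime (P : A -> Prop) :
    P 0 -> (forall a b, P a -> P b -> P (a + b)) -> (forall a b, P b -> P (a * b)) ->
    (forall m f, P f -> P (hc m f)) ->
    (forall l m a b, a \in G l -> b \in G m -> P (a * b) -> P a \/ P b) ->
  forall a b, P (a * b) -> P a \/ P b.
Proof.
move=> P0 PD PM Ph Pp a b ab.
have PN x : P x -> P (- x) by move=> hx; rewrite -mulN1r; exact: PM.
have all_P f : (forall m, P (hc m f)) -> P f.
  move=> hf; have [N hN] := hc_bound f; rewrite (hc_expand hN).
  by apply: (@big_ind _ P) => // i _; exact: hf.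
have [?|nb] := pselect (P b); [by right|left].
have exb : exists l, ~~ `[< P (hc l b) >].
  apply: contrapT => h; apply: nb; apply: all_P => m; apply: contrapT => hm.
  by apply: h; exists m; apply/asboolPn.
case: (ex_minnP exb) => l /asboolPn nbl lmin.
have Pbi i : (i < l)%N -> P (hc i b).
  by move=> il; apply: contrapT => /asboolPn /lmin; rewrite leqNgt il.
apply: all_P; elim/ltn_ind => m IH.
have [N0 hN0] := hc_bound a; pose N := maxn m.+1 N0.
have hN i : (N <= i)%N -> hc i a = 0.
  by move=> Ni; apply: hN0; apply: leq_trans Ni; rewrite leq_max leqnn orbT.
have mN : (m < N)%N by rewrite leq_max leqnn.
have := Ph (m + l)%N _ ab; rewrite (hcM _ _ hN) (bigD1 (Ordinal mN)) ?leq_addr //= addKn.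
set S := \sum_(i < N | _) _ => hS; suff PS : P S.
  have [] // := @Pp m l (hc m a) (hc l b) (hc_in _ _) (hc_in _ _).
  by rewrite -[_ * _](addrK S); exact/PD/PN.
apply: (@big_ind _ P) => // i /andP[iml]; rewrite -val_eqE /= neq_ltn => /orP[im|mi].
  by rewrite mulrC; exact/PM/IH.
by apply/PM/Pbi; rewrite ltn_subLR // ltn_add2r.
Qed.

End Components.

(** * Orthogonal bases of normed spaces *)

Section Orthogonal.
Variables (k : fieldType) (V : lmodType k) (RR : realType).

(** Vectors of strictly increasing values are independent: in a relation, the first term would have
    the value of the sum of the later ones, which is larger. The span of n vectors cannot contain n
    + 1 of them. *)
Lemma ascending_dependent (psi : V -> \bar RR) n (b : 'I_n -> V) (x : nat -> V) :
    psi 0 = +oo%E -> (forall (a : k) f, (psi f <= psi (a *: f)%R)%E) ->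
    (forall f g, (mine (psi f) (psi g) <= psi (f + g)%R)%E) ->
    (forall j, (psi (x j) < psi (x j.+1))%E) ->
    (forall j, exists a : 'I_n -> k, x j = \sum_i a i *: b i) -> False.
Proof.
move=> psi0 psiZ psiD lt /choice[a xa].
have mono i j : (i < j)%N -> (psi (x i) < psi (x j))%E.
  elim: j => // j IH; rewrite ltnS leq_eqVlt => /predU1P[->//|/IH h].
  exact: lt_trans h (lt j).
have [c [[i0 ci0] hc]] := dep_domain (fun (j : 'I_n.+1) i => a j i) (leqnn n.+1).
have ex : exists j, [exists i : 'I_n.+1, (i == j :> nat) && (c i != 0)].
  by exists i0; apply/existsP; exists i0; rewrite eqxx.
case: (ex_minnP ex) => _ /existsP[j /andP[/eqP <- cj]] jmin.
have cz (i : 'I_n.+1) : (i < j)%N -> c i = 0.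
  move=> ij; apply: contrapT => /eqP ci; move: ij; rewrite ltnNge jmin //.
  by apply/existsP; exists i; rewrite eqxx.
have s0 : \sum_i c i *: x i = 0.
  under eq_bigr => i _ do rewrite xa scaler_sumr.
  rewrite exchange_big big1 // => l _ /=.
  under eq_bigr => i _ do rewrite scalerA.
  by rewrite -scaler_suml hc scale0r.
have E : x j = - (c j)^-1 *: \sum_(i | i != j) c i *: x i.
  move: s0; rewrite (bigD1 j) //= addrC => /eqP; rewrite addr_eq0 => /eqP ->.
  by rewrite scaleNr scalerN opprK scalerA mulVf // scale1r.
have : (psi (x j) < psi (x j))%E; last by rewrite ltxx.
rewrite {2}E; apply: lt_le_trans (psiZ _ _).
apply: (@big_ind _ (fun f => (psi (x j) < psi f)%E)) => [|f g hf hg|i ij].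
- by rewrite psi0; apply: lt_le_trans (lt j) _; rewrite leey.
- by apply: lt_le_trans (psiD _ _); rewrite lt_min hf.
case: (ltngtP i j) => [/cz ->|ji|/val_inj E']; last by rewrite E' eqxx in ij.
  by rewrite scale0r psi0; apply: lt_le_trans (lt j) _; rewrite leey.
exact: lt_le_trans (mono _ _ ji) (psiZ _ _).
Qed.

Variable chi : V -> \bar RR.
Hypothesis chiV : is_vnorm chi.

Lemma vnorm0 : chi 0 = +oo%E.
Proof. exact/(vnorm_eqy chiV). Qed.

Lemma vnormZ_le (a : k) f : (chi f <= chi (a *: f)%R)%E.
Proof.
have [->|a0] := eqVneq a 0; first by rewrite scale0r vnorm0 leey.
by rewrite (vnormZ chiV).
Qed.

Lemma vnormN f : chi (- f) = chi f.
Proof. by rewrite -scaleN1r (vnormZ chiV) // oppr_eq0 oner_eq0. Qed.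

Lemma vnorm_max v w : (chi (v + w) <= chi v)%E -> chi (v + w) = mine (chi v) (chi w).
Proof.
move=> h; apply/eqP; rewrite eq_le (vnormD chiV) andbT le_min h /=.
apply: le_trans (_ : mine (chi (v + w)%R) (chi (- v)%R) <= _)%E; last first.
  by apply: le_trans (vnormD chiV _ _) _; rewrite addrAC subrr add0r.
by rewrite le_min lexx vnormN.
Qed.

(** Gram-Schmidt: the new vector is a translate v + u of maximal norm by the span of the others. The
    maximum is attained, since otherwise [ascending_dependent] would apply. *)
Lemma orthogonal_family n (b : 'I_n -> V) :
    (forall a : 'I_n -> k, \sum_(i < n) a i *: b i = 0 -> forall i, a i = 0) ->
  exists s : 'I_n -> V, [/\ forall v, (exists a, v = \sum_i a i *: s i) <-> (exists a, v = \sum_i a i *: b i),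
    forall i, s i != 0 &
    forall a : 'I_n -> k, chi (\sum_i a i *: s i) = \big[mine/+oo%E]_(i < n | a i != 0) chi (s i)].
Proof.
elim: n b => [|n IH] b bi.
  by exists b; split=> [//|[]//|a]; rewrite !big_ord0 vnorm0.
pose b' i := b (lift ord0 i); pose v := b ord0.
have bi' a : \sum_(i < n) a i *: b' i = 0 -> forall i, a i = 0.
  move=> h i; pose a' (j : 'I_n.+1) := if unlift ord0 j is Some l then a l else 0.
  have := bi a' _ (lift ord0 i); rewrite /a' liftK; apply.
  rewrite big_ord_recl unlift_none scale0r add0r -[RHS]h; apply: eq_bigr => l _.
  by rewrite liftK.
have [s' [sp s0 so]] := IH b' bi'.
pose span u := exists a : 'I_n -> k, u = \sum_i a i *: s' i.
have [u [a0 ua] umax] : exists2 u, span u & forall u', span u' -> (chi (v + u') <= chi (v + u))%E.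
  apply: contrapT => nomax.
  have next u : exists u', span u -> span u' /\ (chi (v + u) < chi (v + u'))%E.
    have [su|nsu] := pselect (span u); last by exists 0.
    apply: contrapT => h; apply: nomax; exists u => // u' su'.
    by rewrite leNgt; apply/negP => lt; apply: h; exists u'.
  have /choice[f hf] := next.
  pose x j := iter j f 0.
  have sx j : span (x j).
    elim: j => [|j IHj]; last by have [] := hf _ IHj.
    by exists (fun=> 0); rewrite big1 // => i _; rewrite scale0r.
  apply: (@ascending_dependent chi n.+1 b (fun j => v + x j)) => //.
  - exact: vnorm0.
  - exact: vnormZ_le.
  - exact: vnormD chiV.
  - by move=> j; have [] := hf _ (sx j).
  - move=> j; have [a ha] := (sp _).1 (sx j).
    exists (fun i => if unlift ord0 i is Some l then a l else 1).
    rewrite big_ord_recl unlift_none scale1r ha; congr (_ + _); apply: eq_bigr => l _.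
    by rewrite liftK.
pose s i := if unlift ord0 i is Some l then s' l else v + u.
exists s.
have sE a : \sum_i a i *: s i = a ord0 *: (v + u) + \sum_i a (lift ord0 i) *: s' i.
  rewrite big_ord_recl /s unlift_none; congr (_ + _); apply: eq_bigr => l _.
  by rewrite liftK.
have spanS c x : span x -> span (c *: x).
  by move=> [a ->]; exists (fun i => c * a i); rewrite scaler_sumr; apply: eq_bigr => i _; rewrite scalerA.
have spanD x y : span x -> span y -> span (x + y).
  move=> [a ->] [a' ->]; exists (fun i => a i + a' i).
  by rewrite -big_split; apply: eq_bigr => i _; rewrite scalerDl.
have su : span u by exists a0.
split.
- move=> x; split=> [[a ->]|[a ->]].
    have [a1 E1] : exists a1, a ord0 *: u + \sum_i a (lift ord0 i) *: s' i = \sum_i a1 i *: b' i.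
      by apply/sp/spanD; [exact: spanS|exists (fun i => a (lift ord0 i))].
    exists (fun i => if unlift ord0 i is Some l then a1 l else a ord0).
    rewrite sE scalerDr -addrA E1 big_ord_recl unlift_none; congr (_ + _).
    by apply: eq_bigr => l _; rewrite liftK.
  have [a1 E1] : span (- a ord0 *: u + \sum_i a (lift ord0 i) *: b' i).
    by apply: spanD; [exact: spanS|apply/sp; exists (fun i => a (lift ord0 i))].
  exists (fun i => if unlift ord0 i is Some l then a1 l else a ord0).
  rewrite sE unlift_none (eq_bigr (fun i => a1 i *: s' i)) => [|l _]; last by rewrite liftK.
  by rewrite -E1 scalerDr big_ord_recl addrA scaleNr addrK.
- move=> i; rewrite /s; case: unliftP => [j _|_] //.
  apply/eqP => vu; have [a1 E1] := (sp _).1 su.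
  suff /eqP : (1 : k) = 0 by rewrite oner_eq0.
  have := bi (fun i => if unlift ord0 i is Some l then a1 l else 1) _ ord0.
  rewrite unlift_none; apply.
  rewrite big_ord_recl unlift_none scale1r -[RHS]vu E1; congr (_ + _); apply: eq_bigr => l _.
  by rewrite liftK.
move=> a; rewrite sE [RHS]big_mkcond [RHS]big_ord_recl.
have -> : \big[mine/+oo%E]_(i < n) (if a (lift ord0 i) != 0 then chi (s (lift ord0 i)) else +oo%E) =
    chi (\sum_i a (lift ord0 i) *: s' i).
  by rewrite so [RHS]big_mkcond; apply: eq_bigr => l _; rewrite /s liftK.
set y := \sum_i a (lift ord0 i) *: s' i.
have sy : span y by exists (fun i => a (lift ord0 i)).
have [->|a00] := eqVneq (a ord0) 0; first by rewrite scale0r add0r /= min_r ?leey.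
rewrite /= /s unlift_none -[in RHS](vnormZ chiV (v + u) a00) vnorm_max //.
have -> : a ord0 *: (v + u) + y = a ord0 *: (v + (u + (a ord0)^-1 *: y)).
  by rewrite addrA [in RHS]scalerDr scalerA mulfV // scale1r.
by rewrite !(vnormZ chiV) //; apply: umax; apply: spanD => //; exact: spanS.
Qed.

End Orthogonal.

Section AlgebraInduction.
Variables (k : fieldType) (A : algType k) (P : A -> Prop).
Hypothesis P1 : P 1.
Hypothesis PZD : forall (c : k) f g, P f -> P g -> P (c *: f + g).
Hypothesis PM : forall f g, P f -> P g -> P (f * g).

(** [alg_generated_by] quantifies over subalgebra structures, so a property must be packaged as one
    to be proved by induction on generators. *)
Definition prop_pred : {pred A} := [pred f | `[< P f >]].

Fact prop_pred_subalg : GRing.subalg_closed prop_pred.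
Proof.
split=> [|c f g /asboolP hf /asboolP hg|f g /asboolP hf /asboolP hg]; apply/asboolP => //.
  exact: PZD.
exact: PM.
Qed.

HB.instance Definition _ := GRing.isSubalgClosed.Build k A prop_pred prop_pred_subalg.

Lemma alg_generated_ind (X : {pred A}) : alg_generated_by X -> (forall f, f \in X -> P f) -> forall f, P f.
Proof. by move=> gen hX f; apply/asboolP; apply: (gen prop_pred) => x /hX hx; apply/asboolP. Qed.

End AlgebraInduction.

(** * Presentation by polynomials in an orthogonal basis of degree one *)

Section Presentation.
Variables (k : fieldType) (RR : realType) (A : comAlgType k) (G : grading A).
Variable chi : A -> \bar RR.

Record presentation n (s : 'I_n -> A) (w : 'I_n -> RR) (sev : {rmorphism mpoly n k -> A}) : Prop := Presentation {
  pres_deg1 : forall i, s i \in G 1%N;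
  pres_weight : forall i, chi (s i) = (w i)%:E;
  pres_C : forall c, sev (mpolyC n c) = c%:A;
  pres_X : forall i, sev 'X_i = s i;
  pres_surj : forall m f, f \in G m -> exists2 F, hom m F & f = sev F;
  pres_filt : forall m f mu, f \in G m -> (mu%:E <= chi f)%E ->
    exists F, [/\ hom m F, f = sev F & forall a, a \in msupp F -> mu <= wt w a]
}.

Hypotheses (chi_NR : in_NR G chi) (chi_gen : generated_in_degree_1 G chi).

Let chiV := NR_vnorm chi_NR.

Lemma vnorm_orthogonal_basis (W : submodClosed A) : finite_dimensional W ->
  exists n (s : 'I_n -> A), is_orthogonal_basis chi W s /\ forall i, s i != 0.
Proof.
move=> [n [b [bW bspan bi]]]; have [s [sp s0 so]] := orthogonal_family chiV bi.
have s_in i : s i = \sum_j (j == i)%:R *: s j.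
  rewrite (bigD1 i) //= eqxx scale1r big1 ?addr0 // => j /negPf ->.
  by rewrite scale0r.
exists n, s; split=> //; split=> //; split.
- move=> i; have [a ->] := (sp (s i)).1 (ex_intro _ (fun j => (j == i)%:R) (s_in i)).
  by apply: rpred_sum => j _; exact: rpredZ.
- by move=> v /bspan/sp.
- move=> a h i; apply: contrapT => /eqP ai; have := so a; rewrite h (vnorm0 chiV) => E.
  have := @bigmin_le_cond _ (\bar RR) _ +oo%E i (fun i => a i != 0) (fun i => chi (s i)) ai.
  by rewrite -E leye_eq => /eqP/(vnorm_eqy chiV)/eqP; rewrite (negPf (s0 i)).
Qed.

Lemma chi1_le0 : (chi 1 <= 0)%E.
Proof.
have := NR_superadditive chi_NR 1 1; rewrite mulr1.
have := vnormNy chiV 1; case E : (chi 1) => [r| |] // _.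
  by rewrite -EFinD !lee_fin; lra.
by move/(vnorm_eqy chiV): E => /eqP; rewrite oner_eq0.
Qed.

Lemma presentation_exists : exists n s w sev, @presentation n s w sev.
Proof.
have [fin gen orth] := chi_gen.
have [n [s [ob s0]]] := vnorm_orthogonal_basis fin.
have /choice[w hw] : forall i, exists r, chi (s i) = r%:E.
  move=> i; have := vnormNy chiV (s i); case E : (chi (s i)) => [r| |] // _; first by exists r.
  by move/(vnorm_eqy chiV): E => /eqP; rewrite (negPf (s0 i)).
have [sev sevC sevX] := mpoly_eval (GRing.in_alg A) s.
have sG i : s i \in G 1%N by case: ob => -[].
have sevZ c F : sev (c *: F) = c *: sev F.
  by rewrite -mul_mpolyC rmorphM /= sevC -scalerAl mul1r.
have sev_mon a : sev (mpolyX k a) = \prod_i s i ^+ a i.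
  by rewrite mpolyXE_id rmorph_prod; apply: eq_bigr => i _; rewrite rmorphXn /= sevX.
have sev_hom m F : hom m F -> sev F \in G m.
  move=> /homP hF; rewrite (mpolyE F) rmorph_sum big_seq; apply: rpred_sum => a /hF <-.
  rewrite sevZ rpredZ // sev_mon mdegE.
  elim: (index_enum _) => [|i r IH]; first by rewrite !big_nil gcomp1.
  rewrite !big_cons gcompM //; elim: (a i : nat) => [|j IHj]; first by rewrite expr0 gcomp1.
  by rewrite exprS -add1n gcompM.
have surj f : exists F, f = sev F.
  move: f; apply: (alg_generated_ind _ _ _ gen) => [|c f g [F ->] [F' ->]|f g [F ->] [F' ->]|f fG].
  - by exists 1; rewrite rmorph1.
  - by exists (c *: F + F'); rewrite rmorphD sevZ.
  - by exists (F * F'); rewrite rmorphM.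
  - case: ob => -[_ span _] _; have [a ->] := span f fG.
    exists (\sum_i a i *: 'X_i); rewrite rmorph_sum; apply: eq_bigr => i _.
    by rewrite /= sevZ sevX.
have hsurj m f : f \in G m -> exists2 F, hom m F & f = sev F.
  move=> fG; have [F fF] := surj f; exists (hpart m F); first exact: hom_hpart.
  have [N hN] := hparts F.
  have := hc_id m fG; rewrite eqxx => {1}<-.
  rewrite {1}fF {1}hN rmorph_sum (@hc_uniq _ _ _ _ (fun i => sev (hpart i F))); last first.
    by move=> i; exact/sev_hom/hom_hpart.
  case: ltnP => // Nm; rewrite hN hpart_sum big1 ?rmorph0 // => i _.
  by rewrite (hom_other (hom_hpart _ _)) // neq_ltn (leq_trans (ltn_ord i)).
exists n, s, w, sev; split=> // m f mu fG fmu.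
have [->|f0] := eqVneq f 0.
  by exists 0; split; [exact: raddf0|rewrite rmorph0|move=> a; rewrite msupp0].
(* [generated_in_degree_1] speaks of m >= 1; in degree 0, f is a scalar and chi f = chi 1 <= 0 is
   bounded by the weight 0 of the empty monomial. *)
case: m fG => [|m] fG.
  have [F hF E] := hsurj _ _ fG; exists F; split=> // a aF.
  have := (homP _ _).1 hF a aF => /eqP; rewrite mdeg_eq0 => /eqP ->.
  rewrite /wt big1 => [|i _]; last by rewrite mnm0E mul0r.
  have [c Fc] : exists c, F = mpolyC n c.
    exists (mcoeff mnm0 F).
    apply/mpolyP => b; rewrite mcoeffC; case: eqP => [->|/eqP bn]; first by rewrite mulr1.
    rewrite mulr0; apply: memN_msupp_eq0; apply: contra bn => /((homP _ _).1 hF)/eqP.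
    by rewrite mdeg_eq0.
  have fc : f = c%:A by rewrite E Fc sevC.
  have c0 : c != 0 by apply: contraNneq f0 => c0; rewrite fc c0 scale0r.
  by rewrite -lee_fin; apply: le_trans fmu _; rewrite fc (vnormZ chiV) // chi1_le0.
have [c [fE chiE]] := orth n s ob m.+1 f isT fG f0.
pose mon (al : {ffun 'I_n -> 'I_m.+2}) : multinom n := Multinom [tuple (al i : nat) | i < n].
have monE (al : {ffun 'I_n -> 'I_m.+2}) (i : 'I_n) : mon al i = al i :> nat by rewrite multinomE tnth_mktuple.
pose P (F : mpoly n k) := hom m.+1 F /\ forall a, a \in msupp F -> mu <= wt w a.
have P0 : P 0 by split; [exact: raddf0|move=> a; rewrite msupp0].
(* In generated_in_degree_1 the exponents are added in 'I_m.+1, hence modulo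
   m.+1: the monomials of the wrong degree are discarded by taking components. *)
pose F : mpoly n k := \sum_(al : {ffun 'I_n -> 'I_m.+2} |
  (\sum_i al i == m.+1 :> nat) && (mdeg (mon al) == m.+1)) c al *: mpolyX k (mon al).
have : P F.
  apply: (@big_ind _ P) => // [F1 F2 [h1 w1] [h2 w2]|al /andP[alm /eqP dal]].
    split; first by rewrite /hom hpartD h1 h2.
    by move=> a /msuppD_le; rewrite mem_cat => /orP[/w1|/w2].
  have [->|cal] := eqVneq (c al) 0; first by rewrite scale0r.
  split; first exact/homZ/homX.
  move=> a /msuppZ_le; rewrite msuppX inE => /eqP ->.
  rewrite -lee_fin; apply: le_trans fmu _; rewrite chiE.
  apply: le_trans (@bigmin_le_cond _ (\bar RR) _ +oo%E al _ _ _) _; first by rewrite alm.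
  rewrite /wt -sumEFin le_eqVlt; apply/orP; left; apply/eqP; apply: eq_bigr => i _.
  by rewrite hw -EFin_natmul monE mulr_natl.
move=> [hF wF]; exists F; split=> //.
have := hc_id m.+1 fG; rewrite eqxx => <-; rewrite {1}fE !raddf_sum big_mkcondr.
apply: eq_bigr => al _.
have -> : \prod_i s i ^+ al i = sev (mpolyX k (mon al)).
  by rewrite sev_mon; apply: eq_bigr => i _; rewrite monE.
rewrite /= -sevZ; have h : hom (mdeg (mon al)) (c al *: mpolyX k (mon al)) by exact/homZ/homX.
by rewrite (hc_id _ (sev_hom _ _ h)) eq_sym.
Qed.

End Presentation.

(** * Homogeneous primes and their spectral seminorms *)

Section HomogeneousPrimes.
Variables (k : fieldType) (A : comAlgType k) (G : grading A).
Implicit Types (I P : A -> Prop).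

Record hideal I : Prop := Hideal {
  hideal0 : I 0;
  hidealD : forall a b, I a -> I b -> I (a + b);
  hidealM : forall a b, I b -> I (a * b);
  hideal_hc : forall m f, I f -> I (hc G m f)
}.

Variables (n : nat) (s : 'I_n -> A) (sev : {rmorphism mpoly n k -> A}).
Hypothesis sevC : forall c, sev (mpolyC n c) = c%:A.
Hypothesis sevX : forall i, sev 'X_i = s i.
Hypothesis surj : forall m f, f \in G m -> exists2 F, hom m F & f = sev F.

Definition gen_op (i : nat) (f : A) : A := if (insub i : option 'I_n) is Some j then s j * f else 0.

Lemma gen_opE (i : 'I_n) f : gen_op i f = s i * f.
Proof. by rewrite /gen_op valK. Qed.

Lemma hideal_opsub I : hideal I -> opsub gen_op n I.
Proof.
move=> Ii; split; [exact: hideal0 Ii|exact: hidealD Ii| |].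
  by move=> c u /(hidealM Ii c%:A); rewrite -scalerAl mul1r.
by move=> i u im Iu; rewrite (gen_opE (Ordinal im)); exact: (hidealM Ii).
Qed.

Lemma opsub_fg I : opsub gen_op n I -> opfg gen_op n I.
Proof.
move=> Is; apply: (@opnoeth k A gen_op _ _ _ n [:: 1]) => //.
- by move=> i u v; rewrite /gen_op; case: insub => [j|]; rewrite ?mulrDr ?addr0.
- by move=> i c u; rewrite /gen_op; case: insub => [j|]; rewrite ?scalerAr ?scaler0.
- move=> i j u; rewrite /gen_op; case: insub => [i'|]; case: insub => [j'|]; rewrite ?mulr0 //.
  exact: mulrCA.
move=> u _ V Vs V1; have V1' : V 1 by apply: V1; rewrite mem_head.
have [N hN] := hc_bound G u; rewrite (hc_expand hN).
apply: (@big_ind _ V) => [||i _]; [exact: opsub0 Vs|exact: opsubD Vs|].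
have [F _ ->] := surj (hc_in G i u).
suff H v : V v -> V (sev F * v) by rewrite -[sev F]mulr1; exact: H.
elim/mpoly_alg_ind: F v => [c|j|p q hp hq|p q hp hq] v Vv.
- by rewrite sevC -scalerAl mul1r; exact: (opsubZ Vs).
- by rewrite sevX -gen_opE; exact: (opsubX Vs).
- by rewrite rmorphD mulrDl; apply: (opsubD Vs); [exact: hp|exact: hq].
- by rewrite rmorphM -mulrA; exact/hp/hq.
Qed.

(** Noetherian induction: a failure produces by choice a strictly increasing sequence of ideals,
    whose union is finitely generated and thus already reached. *)
Lemma hideal_ind (Q : (A -> Prop) -> Prop) :
    (forall I, hideal I -> (forall I', hideal I' -> (forall f, I f -> I' f) ->
      (exists f, I' f /\ ~ I f) -> Q I') -> Q I) ->
  forall I, hideal I -> Q I.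
Proof.
move=> step I hI; apply: contrapT => nQ.
pose T := {I : A -> Prop | hideal I /\ ~ Q I}.
have next (x : T) : exists y : T, (forall f, sval x f -> sval y f) /\ exists f, sval y f /\ ~ sval x f.
  case: x => J [hJ nJ]; apply: contrapT => h; apply: (nJ); apply: step => // I' hI' sub str.
  by apply: contrapT => nI'; apply: h; exists (exist _ I' (conj hI' nI')).
have /choice[f hf] := next.
pose J j := sval (iter j f (exist _ I (conj hI nQ) : T)).
have hJ j : hideal (J j) by rewrite /J; case: (iter _ _ _) => ? [].
have mono i j x : (i <= j)%N -> J i x -> J j x.
  elim: j => [|j IH]; first by rewrite leqn0 => /eqP ->.
  rewrite leq_eqVlt => /predU1P[->//|]; rewrite ltnS => /IH h /h.
  exact: (hf _).1.
pose U x := exists j, J j x.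
have Us : hideal U.
  split.
  - by exists 0%N; exact: hideal0.
  - move=> a b [i ai] [j bj]; exists (maxn i j); apply: (hidealD (hJ _)).
      by apply: mono ai; rewrite leq_maxl.
    by apply: mono bj; rewrite leq_maxr.
  - by move=> a b [i bi]; exists i; exact: (hidealM (hJ _)).
  - by move=> m x [i xi]; exists i; exact: (hideal_hc (hJ _)).
have [gs [gU gen]] := opsub_fg (hideal_opsub Us).
have [N hN] : exists N, forall x, x \in gs -> J N x.
  elim: gs gU {gen} => [|x r IH] gU; first by exists 0%N.
  have [|N hN] := IH; first by move=> y yr; apply: gU; rewrite in_cons yr orbT.
  have [j xj] := gU x (mem_head _ _); exists (maxn N j) => y; rewrite in_cons => /predU1P[->|yr].
    by apply: mono xj; rewrite leq_maxr.
  by apply: mono (hN y yr); rewrite leq_maxl.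
have [_ [x [xN nx]]] := hf (iter N f (exist _ I (conj hI nQ) : T)).
apply: nx; apply: (gen x _ (J N) (hideal_opsub (hJ N)) hN).
by exists N.+1.
Qed.

(** If a b is in I with a and b homogeneous outside I, pass to J = (I : a) and K = (I : J). Both are
    radical and proper; b enlarges J and a enlarges K. An f in both has its square in I, so J and K
    meet in I. *)
Theorem prime_decomposition I : hideal I -> ~ I 1 -> (forall f, I (f ^+ 2) -> I f) ->
  exists N (P : nat -> A -> Prop), 
    (forall i, [/\ hideal (P i), ~ P i 1 & forall a b, P i (a * b) -> P i a \/ P i b]) /\
    forall f, (forall i, (i < N)%N -> P i f) -> I f.
Proof.
move=> hI; move: I hI; apply: hideal_ind => I hI IH I1 Irad.
have [prim|] := pselect (forall l m a b, a \in G l -> b \in G m -> I (a * b) -> I a \/ I b).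
  exists 1%N, (fun=> I); split=> [_|f]; last by move=> h; exact: (h 0%N).
  split=> //; apply: (homogeneous_prime (hideal0 hI) (hidealD hI) (hidealM hI) (hideal_hc hI) prim).
move=> nprim.
have [l [m [a [b [aG bG ab [na nb]]]]]] : exists l m a b, [/\ a \in G l, b \in G m, I (a * b) & ~ I a /\ ~ I b].
  apply: contrapT => h; apply: nprim => l m a b aG bG ab.
  have [?|na] := pselect (I a); [by left|right]; apply: contrapT => nb.
  by apply: h; exists l, m, a, b.
pose J x := I (a * x); pose K x := forall y, J y -> I (y * x).
have hJ : hideal J.
  split; rewrite /J.
  - by rewrite mulr0; exact: hideal0.
  - by move=> x y hx hy; rewrite mulrDr; exact: hidealD.
  - by move=> x y hy; rewrite mulrCA; exact: hidealM.
  - move=> j x /(hideal_hc hI (l + j)); rewrite (hcMl _ _ aG) leq_addr addKn //.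
have hK : hideal K.
  split.
  - by move=> y _; rewrite mulr0; exact: hideal0.
  - by move=> x x' hx hx' y Jy; rewrite mulrDr; apply: (hidealD hI); [exact: hx|exact: hx'].
  - by move=> x x' hx y Jy; rewrite mulrCA; apply: (hidealM hI); exact: hx.
  - move=> j x hx y Jy; have [N hN] := hc_bound G y; rewrite (hc_expand hN) mulr_suml.
    apply: (@big_ind _ I) => [||i _]; [exact: hideal0 hI|exact: hidealD hI|].
    have := hideal_hc hI (i + j) (hx _ (hideal_hc hJ i Jy)).
    by rewrite (hcMl _ _ (hc_in G i y)) leq_addr addKn.
have [||||N1 [P1 [hP1 sP1]]] := IH J hJ.
- by move=> f; exact: hidealM.
- by exists b.
- by rewrite /J mulr1.
- move=> f; rewrite /J => h; apply: Irad; rewrite exprMn expr2 -mulrA; exact: hidealM.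
have [||||N2 [P2 [hP2 sP2]]] := IH K hK.
- by move=> f If y _; exact: hidealM.
- exists a; split=> // y; by rewrite /J mulrC.
- by move=> /(_ b ab); rewrite mulr1.
- move=> f h y Jy; apply: Irad; rewrite exprMn expr2 -mulrA; apply: (hidealM hI); exact: h.
exists (N1 + N2)%N, (fun i => if (i < N1)%N then P1 i else P2 (i - N1)%N); split.
  by move=> i; case: ifP.
move=> f hf; apply: Irad; rewrite expr2.
have Jf : J f by apply: sP1 => i iN; have := hf i; rewrite iN; apply; exact: ltn_addr.
apply: (sP2 f _ f Jf) => i iN; have := hf (N1 + i)%N; rewrite ltn_add2l (ltnNge (N1 + i)) leq_addr addKn.
exact.
Qed.

End HomogeneousPrimes.

Lemma ereal_le_real (RR : realType) (x y : \bar RR) :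
  (forall c : RR, (c%:E < x)%E -> (c%:E <= y)%E) -> (x <= y)%E.
Proof.
move=> h; rewrite leNgt; apply/negP => yx.
have [c yc cx] : exists2 c : RR, (y < c%:E)%E & (c%:E < x)%E.
  move: yx {h}; case: x y => [r| |] [t| |] //=.
  - by rewrite lte_fin => tr; exists ((r + t) / 2); rewrite lte_fin; lra.
  - by move=> _; exists (r - 1); rewrite ?ltNyr // lte_fin gtrBl ltr01.
  - by move=> _; exists (t + 1); rewrite ?ltry // lte_fin ltrDl ltr01.
  - by move=> _; exists 0; rewrite ?ltry ?ltNyr.
by have := h c cx; rewrite leNgt yc.
Qed.

Lemma ereal_lt_add (RR : realType) (x y : \bar RR) (c : RR) : x != -oo%E -> y != -oo%E ->
  (c%:E < x + y)%E -> exists a b : RR, [/\ (a%:E < x)%E, (b%:E < y)%E & c = a + b].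
Proof.
case: x y => [x| |] [y| |] //= _ _; rewrite ?lte_fin => h.
- by exists (x - (x + y - c) / 2), (y - (x + y - c) / 2); rewrite !lte_fin; split; lra.
- by exists (x - 1), (c - (x - 1)); rewrite lte_fin !ltry; split => //; lra.
- by exists (c - (y - 1)), (y - 1); rewrite lte_fin !ltry; split => //; lra.
- by exists 0, c; rewrite !ltry add0r.
Qed.

(** * The spectral seminorm modulo a homogeneous prime *)

Section QuotientSpectralSeminorm.
Variables (k : fieldType) (RR : realType) (A : comAlgType k) (G : grading A).
Variable chi : A -> \bar RR.
Hypothesis chi_NR : in_NR G chi.
Variables (n : nat) (s : 'I_n -> A) (w : 'I_n -> RR) (sev : {rmorphism mpoly n k -> A}).
Hypothesis pres : presentation G chi s w sev.
Variable P : A -> Prop.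
Hypothesis hP : hideal G P.
Hypothesis P1 : ~ P 1.

Let chiV := NR_vnorm chi_NR.
Let chiM := NR_superadditive chi_NR.

Lemma grading_component m f : (chi f <= chi (hc G m f))%E.
Proof.
have [N hN] := hc_bound G f; have [mN|Nm] := ltnP m N; last by rewrite hN // (vnorm0 chiV) leey.
rewrite [in leLHS](hc_expand hN) (NR_grading chi_NR) => [|i]; last exact: hc_in.
exact: (@bigmin_le_cond _ (\bar RR) _ +oo%E (Ordinal mN)).
Qed.

Definition qfilt l f := exists2 q, P q & (l%:E <= chi (f + q)%R)%E.

Lemma qfilt_chi l f : (l%:E <= chi f)%E -> qfilt l f.
Proof. by exists 0; [exact: hideal0 hP|rewrite addr0]. Qed.

Lemma qfiltW l m f : l <= m -> qfilt m f -> qfilt l f.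
Proof. by move=> lm [q Pq h]; exists q => //; apply: le_trans h; rewrite lee_fin. Qed.

Lemma qfilt_ideal l f : P f -> qfilt l f.
Proof.
move=> Pf; exists (- f); last by rewrite subrr (vnorm0 chiV) leey.
by rewrite -mulN1r; exact: (hidealM hP).
Qed.

Lemma qfilt0 l : qfilt l 0.
Proof. exact/qfilt_ideal/(hideal0 hP). Qed.

Lemma qfiltD l f g : qfilt l f -> qfilt l g -> qfilt l (f + g).
Proof.
move=> [q Pq hq] [r Pr hr]; exists (q + r); first exact: (hidealD hP).
by rewrite addrACA; apply: le_trans (vnormD chiV _ _); rewrite le_min hq.
Qed.

Lemma qfiltM l m f g : qfilt l f -> qfilt m g -> qfilt (l + m) (f * g).
Proof.
move=> [q Pq hq] [r Pr hr]; exists (f * r + (g + r) * q).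
  by apply: (hidealD hP); exact: (hidealM hP).
have -> : f * g + (f * r + (g + r) * q) = (f + q) * (g + r) by ring.
by apply: le_trans (chiM _ _); rewrite EFinD; exact: leeD.
Qed.

Lemma qfiltZ l (c : k) f : qfilt l f -> qfilt l (c *: f).
Proof.
move=> [q Pq hq]; exists (c *: q).
  by have := hidealM hP c%:A Pq; rewrite -scalerAl mul1r.
by rewrite -scalerDr; apply: le_trans hq (vnormZ_le chiV _ _).
Qed.

Lemma chi_real f : exists l : RR, (l%:E <= chi f)%E.
Proof.
by have := vnormNy chiV f; case: (chi f) => [r| |] // _; [exists r|exists 0; rewrite leey].
Qed.

Lemma qfilt_ex f : exists l, qfilt l f.
Proof. by have [l hl] := chi_real f; exists l; exact: qfilt_chi. Qed.

Let r1 := projT1 (cid (qfilt_ex 1)).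
Let qfilt1 : qfilt r1 1 := projT2 (cid (qfilt_ex 1)).

Lemma qgrows_power mu f d : (0 < d)%N -> qfilt (d%:R * mu) (f ^+ d) -> grows qfilt mu f.
Proof.
move=> d0 hd; have [l hl] := qfilt_ex f.
exact: (grows_power (@qfiltW) (@qfiltM) qfilt1 d0 hd hl).
Qed.

Lemma qgrows_qfilt mu f : qfilt mu f -> grows qfilt mu f.
Proof. by move=> h; apply: (@qgrows_power _ _ 1); rewrite // mul1r expr1. Qed.

(** As a supremum of slopes, it inherits its rules for sums and products from those of [grows]. *)
Definition qspec f : \bar RR := ereal_sup [set mu%:E | mu in [set mu | grows qfilt mu f]].

Lemma le_qspec mu f : grows qfilt mu f -> (mu%:E <= qspec f)%E.
Proof. by move=> h; apply: ereal_sup_ubound; exists mu. Qed.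

Lemma lt_qspec mu f : (mu%:E < qspec f)%E -> exists2 mu', mu < mu' & grows qfilt mu' f.
Proof. by move=> /ereal_sup_gt[_ [mu' h <-]]; rewrite lte_fin => ?; exists mu'. Qed.

Lemma lt_qspecW mu f : (mu%:E < qspec f)%E -> grows qfilt mu f.
Proof. by move=> /lt_qspec[mu' /ltW mm h]; exact: (growsW (@qfiltW) mm h). Qed.

Lemma qspec_ideal f : P f -> qspec f = +oo%E.
Proof.
move=> Pf; apply/eqP; rewrite -leye_eq; apply: ereal_le_real => c _.
exact/le_qspec/qgrows_qfilt/qfilt_ideal.
Qed.

Lemma chi_le_qspec f : (chi f <= qspec f)%E.
Proof.
by apply: ereal_le_real => c /ltW h; exact/le_qspec/qgrows_qfilt/qfilt_chi.
Qed.

Lemma hom_le_qspec f : (homogenization chi f <= qspec f)%E.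
Proof.
apply: ereal_le_real => c /ereal_sup_gt[_ [d /= d0 <-]] h.
apply/le_qspec/(qgrows_power d0)/qfilt_chi.
by rewrite EFinM -lee_pdivlMl ?ltr0n // ltW.
Qed.

Lemma qspecNy f : qspec f != -oo%E.
Proof.
have [l hl] := chi_real f; have := le_trans hl (chi_le_qspec f).
by case: (qspec f).
Qed.

Fact qspec0 : qspec 0 = +oo%E.
Proof. exact/qspec_ideal/(hideal0 hP). Qed.

Lemma deg0_scalar f : f \in G 0%N -> exists c : k, f = c%:A.
Proof.
move=> /(pres_surj pres)[F hF ->]; exists (mcoeff mnm0 F); rewrite -(pres_C pres); congr (sev _).
apply/mpolyP => b; rewrite mcoeffC; case: eqP => [->|/eqP bn]; first by rewrite mulr1.
rewrite mulr0; apply: memN_msupp_eq0; apply: contra bn => /((homP _ _).1 hF)/eqP.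
by rewrite mdeg_eq0.
Qed.

(** A positive slope would give q in P with chi (1 + q) > 0. The degree 0 component of q is a scalar
    in the proper ideal P, hence 0, which leaves chi 1 > 0. *)
Fact qspec1 : qspec 1 = 0%E.
Proof.
apply/eqP; rewrite eq_le; apply/andP; split.
  apply: ereal_le_real => c /lt_qspec[mu cmu]; rewrite leNgt lte_fin => gmu.
  apply/negP => c0; have [d d0 /(_ 1%N isT)] := grows_filt (@qfiltW) cmu gmu.
  rewrite mul1n expr1n => -[q Pq hq].
  have [a ha] := deg0_scalar (hc_in G 0 q).
  have a0 : a = 0.
    apply: contrapT => /eqP a0; apply: P1.
    have := hidealM hP a^-1%:A (hideal_hc hP 0 Pq).
    by rewrite ha -scalerAl mul1r scalerA mulVf // scale1r.
  have := le_trans hq (grading_component 0 (1 + q)); rewrite raddfD /= ha a0 scale0r addr0.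
  rewrite (hc_id _ (gcomp1 G)) eqxx => h.
  have := le_trans h (chi1_le0 chi_NR); rewrite lee_fin leNgt.
  by rewrite mulr_gt0 // ltr0n.
apply: le_qspec; exists (- r1) => j.
by rewrite mulr0 add0r opprK expr1n.
Qed.

Fact qspecZ (c : k) f : (qspec f <= qspec (c *: f))%E.
Proof.
apply: ereal_le_real => mu /lt_qspecW[C hC]; apply: le_qspec; exists C => j.
by rewrite exprZn; exact: qfiltZ.
Qed.

Fact qspecD f g : (mine (qspec f) (qspec g) <= qspec (f + g)%R)%E.
Proof.
apply: ereal_le_real => mu; rewrite lt_min => /andP[/lt_qspecW hf /lt_qspecW hg].
by apply: le_qspec; exact: (growsD (@qfilt0) (@qfiltD) (@qfiltM)).
Qed.

Fact qspecM : superadditive qspec.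
Proof.
move=> f g; apply: ereal_le_real => mu.
move=> /(ereal_lt_add (qspecNy f) (qspecNy g))[a [b [/lt_qspecW hf /lt_qspecW hg ->]]].
by apply: le_qspec; exact: (growsM (@qfiltM)).
Qed.

Definition qspec_seminorm : alg_seminorm A RR := AlgSeminorm qspec0 qspec1 qspecZ qspecD qspecM.

Lemma qspecX (f : A) (mu : RR) j : (0 < j)%N -> ((j%:R * mu)%:E <= qspec (f ^+ j)%R)%E ->
  (mu%:E <= qspec f)%E.
Proof.
move=> j0 h; apply: ereal_le_real => c; rewrite lte_fin => cmu; apply: le_qspec.
have cm : c < (c + mu) / 2 by lra.
apply: (grows_root (@qfiltW) (@qfiltM) qfilt1 j0 cm (qfilt_ex f)).
apply: lt_qspecW; apply: lt_le_trans h.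
by rewrite lte_fin ltr_pM2l ?ltr0n //; lra.
Qed.

Lemma gcompX m f d : f \in G m -> f ^+ d \in G (m * d)%N.
Proof.
move=> fG; elim: d => [|d IH]; first by rewrite muln0 expr0 gcomp1.
by rewrite exprS mulnS gcompM.
Qed.

Lemma qspec_power m f (mu : RR) : f \in G m -> (mu%:E < qspec f)%E ->
  exists d F, [/\ (0 < d)%N, hom (m * d) F, forall a, a \in msupp F -> d%:R * mu <= wt w a
    & P (f ^+ d - sev F)].
Proof.
move=> fG /lt_qspec[mu' mm hmu]; have [d d0 /(_ 1%N isT)] := grows_filt (@qfiltW) mm hmu.
rewrite mul1n => -[q Pq hq].
have := le_trans hq (grading_component (m * d) _).
move=> /(pres_filt pres (hc_in _ _ _))[F [hF E wF]]; exists d, F; split=> //.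
rewrite -E raddfD /= (hc_id _ (gcompX d fG)) eqxx opprD addrA subrr add0r -mulN1r.
exact/(hidealM hP)/(hideal_hc hP).
Qed.

End QuotientSpectralSeminorm.

(** * Noetherianity of the graded algebra of the homogenization *)

Section Gluing.
Variables (k : fieldType) (V : lmodType k) (X : nat -> V -> V) (n : nat).
Implicit Types U K : V -> Prop.

Definition fg_modulo K := forall U, opsub X n U -> exists s : seq V,
  (forall e, e \in s -> U e) /\
  forall u, U u -> exists2 v, opspan X n (fun e => e \in s) v & K (u - v).

Lemma fg_modulo_kernel (V' : lmodType k) (X' : nat -> V' -> V') (g : {additive V -> V'}) :
    (forall c u, g (c *: u) = c *: g u) -> (forall i u, (i < n)%N -> g (X i u) = X' i (g u)) ->
    (forall U' : V' -> Prop, opsub X' n U' -> opfg X' n U') -> fg_modulo (fun u => g u = 0).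
Proof.
move=> gZ gX noeth U Us.
pose im W v := exists2 u : V, W u & v = g u.
have imS W : opsub X n W -> opsub X' n (im W).
  move=> Ws; split.
  - by exists 0; [exact: opsub0 Ws|rewrite raddf0].
  - by move=> _ _ [u Wu ->] [v Wv ->]; exists (u + v); [exact: (opsubD Ws Wu Wv)|rewrite raddfD].
  - by move=> c _ [u Wu ->]; exists (c *: u); [exact: (opsubZ Ws)|rewrite gZ].
  - by move=> i _ iN [u Wu ->]; exists (X i u); [exact: (opsubX Ws)|rewrite gX].
have [s' [s'U gen]] := noeth _ (imS _ Us).
have [s [sU E]] : exists s : seq V, (forall u, u \in s -> U u) /\ s' = [seq g u | u <- s].
  elim: s' s'U {gen} => [|u s' IH] hs'; first by exists [::].
  have [|s [h1 ->]] := IH; first by move=> v vs; apply: hs'; rewrite in_cons vs orbT.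
  have [v Vv ->] := hs' u (mem_head _ _); exists (v :: s); split=> // v'.
  by rewrite in_cons => /predU1P[->|/h1].
exists s; split=> // u Uu.
have [||v vs gv] := gen (g u) _ (im (opspan X n (fun e => e \in s))) (imS _ (opspan_sub X n _)).
- by exists u.
- move=> e; rewrite E => /mapP[v vs ->]; exists v => //.
  by move=> W Ws; apply.
by exists v => //; rewrite raddfB gv subrr.
Qed.

(** Induction on N: join generators of U modulo the last K to generators of the intersection of U
    with it. *)
Lemma fg_glue N (K : nat -> V -> Prop) U :
    (forall i, (i < N)%N -> opsub X n (K i) /\ fg_modulo (K i)) -> opsub X n U ->
    (forall u, U u -> (forall i, (i < N)%N -> K i u) -> u = 0) -> opfg X n U.
Proof.
elim: N U => [|N IH] U hK Us U0.
  exists [::]; split=> // u /U0 -> // W Ws _; exact: opsub0 Ws.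
have [KN fgN] := hK N (leqnn _).
have [|||s' [s'U gen']] := IH (fun u => U u /\ K N u).
- by move=> i iN; apply: hK; exact: ltnW.
- split.
  + by split; [exact: opsub0 Us|exact: opsub0 KN].
  + by move=> u v [? ?] [? ?]; split; [exact: (opsubD Us)|exact: (opsubD KN)].
  + by move=> c u [? ?]; split; [exact: (opsubZ Us)|exact: (opsubZ KN)].
  + by move=> i u im [? ?]; split; [exact: (opsubX Us)|exact: (opsubX KN)].
- move=> u [Uu Ku] hu; apply: U0 => // i; rewrite ltnS leq_eqVlt => /predU1P[->//|]; exact: hu.
have [s [sU gen]] := fgN U Us.
exists (s ++ s'); split=> [e|u Uu].
  by rewrite mem_cat => /orP[/sU//|/s'U[]].
have [v vs Kuv] := gen u Uu.
have Uv : U v by exact: vs.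
have Uuv : U (u - v) by apply: (opsubD Us) => //; rewrite -scaleN1r; exact: (opsubZ Us).
move=> W Ws hW; rewrite -[u](subrK v); apply: (opsubD Ws).
  by apply: (gen' _ (conj Uuv Kuv)) => // e es; apply: hW; rewrite mem_cat es orbT.
by apply: vs => // e es; apply: hW; rewrite mem_cat es.
Qed.

End Gluing.

(** * Maps between the graded algebras of two comparable seminorms *)

Section Comparison.
Local Open Scope quotient_scope.
Variables (k : fieldType) (RR : realType) (A : comAlgType k) (G : grading A).
Variables (sg tg : alg_seminorm A RR).
Hypothesis le_st : forall f, (sg f <= tg f)%E.
Local Notation MA := (monoid_algebra (nat * RR)%type A).

Lemma nge_le l (h : MA) : nge G sg l h -> nge G tg l h.
Proof. by move=> hh x; have [hG hx] := hh x; split=> //; exact: le_trans hx (le_st _). Qed.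

Definition gr_map (u : gr G sg) : gr G tg := sym G tg (dsum_val (repr u)).

Lemma sym_sub (tg' : alg_seminorm A RR) (h h' : MA) : nge G tg' 0 h -> nge G tg' 0 h' ->
  sym G tg' (h - h') = sym G tg' h - sym G tg' h'.
Proof.
move=> hh hh'; apply/eqP; rewrite eq_sym subr_eq -symD ?subrK //.
move=> x; have [xG hx] := hh x; have [xG' hx'] := hh' x; rewrite ma_coefB; split; first exact: gcompB.
apply: le_trans (seminormD _ _ _); rewrite le_min hx /= -scaleN1r.
exact: le_trans hx' (seminormZ _ _ _).
Qed.

Lemma sym_sub_eq0 (tg' : alg_seminorm A RR) (h h' : MA) : nge G tg' 0 h -> nge G tg' 0 h' ->
  sym G tg' h = sym G tg' h' <-> forall x, (x.2%:E < tg' (ma_coef h x - ma_coef h' x)%R)%E.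
Proof.
move=> hh hh'; have hB : nge G tg' 0 (h - h').
  move=> x; have [xG hx] := hh x; have [xG' hx'] := hh' x; rewrite ma_coefB; split; first exact: gcompB.
  apply: le_trans (seminormD _ _ _); rewrite le_min hx /= -scaleN1r.
  exact: le_trans hx' (seminormZ _ _ _).
split=> [E x|H].
  have /(sym_eq0 hB)/(_ x) : sym G tg' (h - h') = 0 by rewrite sym_sub // E subrr.
  by rewrite ma_coefB.
apply/eqP; rewrite -subr_eq0 -sym_sub //; apply/eqP/(sym_eq0 hB) => x.
by rewrite ma_coefB.
Qed.

Lemma gr_mapE (h : MA) : nge G sg 0 h -> gr_map (sym G sg h) = sym G tg h.
Proof.
move=> hh; have hr := nge_dsum (repr (sym G sg h)).
apply/(sym_sub_eq0 (nge_le hr) (nge_le hh)) => x; apply: lt_le_trans (le_st _).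
by apply: (proj1 (sym_sub_eq0 hr hh)); rewrite sym_val reprK.
Qed.

Fact gr_map_additive : zmod_morphism gr_map.
Proof.
move=> u v; have [h hh ->] := sym_ex u; have [h' hh' ->] := sym_ex v.
rewrite -sym_sub // !gr_mapE ?sym_sub //; try exact: nge_le.
move=> x; have [xG hx] := hh x; have [xG' hx'] := hh' x; rewrite ma_coefB; split; first exact: gcompB.
apply: le_trans (seminormD _ _ _); rewrite le_min hx /= -scaleN1r.
exact: le_trans hx' (seminormZ _ _ _).
Qed.

HB.instance Definition _ := GRing.isZmodMorphism.Build (gr G sg) (gr G tg) gr_map gr_map_additive.

Lemma gr_mapM u v : gr_map (u * v) = gr_map u * gr_map v.
Proof.
have [h hh ->] := sym_ex u; have [h' hh' ->] := sym_ex v.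
rewrite -symM // !gr_mapE ?symM //; try exact: nge_le.
by rewrite -[0](addr0 0); exact: ngeM.
Qed.

Lemma nge_scalar (c : k) : nge G sg 0 (ma_monom 0 c%:A).
Proof.
apply: nge_monom => /=; first by rewrite rpredZ ?gcomp1.
by rewrite addr0; exact: seminorm_scalar.
Qed.

Lemma gr_mapZ c u : gr_map (c *: u) = c *: gr_map u.
Proof.
rewrite -[u in LHS]mul1r scalerAl gr_mapM -(sym_scalar G sg c) gr_mapE ?sym_scalar; last exact: nge_scalar.
by rewrite -scalerAl mul1r.
Qed.

End Comparison.

Lemma seminorm_ltM (k : fieldType) (A : comAlgType k) (RR : realType) (sg : alg_seminorm A RR)
    f g (x y : RR) : (x%:E <= sg f)%E -> (y%:E < sg g)%E -> ((x + y)%:E < sg (f * g)%R)%E.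
Proof.
move=> fx gx; apply: lt_le_trans (seminormM _ _ _); rewrite EFinD.
move: fx gx; case: (sg f) => [r| |] //; case: (sg g) => [t| |] //=.
- by rewrite lee_fin !lte_fin; exact: ler_ltD.
- by rewrite !ltry.
- by rewrite !ltry.
- by rewrite !ltry.
Qed.

(** * The homogenization as a minimum of spectral seminorms *)

Section Homogenization.
Variables (k : fieldType) (RR : realType) (A : comAlgType k) (G : grading A).
Variable chi : A -> \bar RR.
Hypothesis inf : forall q : {poly k}, q != 0 -> exists x, q.[x] != 0.
Hypothesis A_reduced : reduced A.
Hypothesis chi_NR : in_NR G chi.
Variables (n : nat) (s : 'I_n -> A) (w : 'I_n -> RR) (sev : {rmorphism mpoly n k -> A}).
Hypothesis pres : presentation G chi s w sev.
Let chiV := NR_vnorm chi_NR.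
Local Notation H := (homogenization_seminorm chiV (NR_superadditive chi_NR)).
Local Notation gr := (gr G H).

Lemma chi_le_hom f : (chi f <= H f)%E.
Proof. by apply: ereal_sup_ubound; exists 1%N => //=; rewrite invr1 mul1e expr1. Qed.

Lemma le_homX f d (c : RR) : (0 < d)%N -> ((d%:R * c)%:E <= chi (f ^+ d))%E -> (c%:E <= H f)%E.
Proof.
move=> d0 h; apply: le_trans (ereal_sup_ubound _); last by exists d.
by rewrite lee_pdivlMl ?ltr0n.
Qed.

Lemma lt_homX f (c : RR) : (c%:E < H f)%E -> exists2 d, (0 < d)%N & ((d%:R * c)%:E <= chi (f ^+ d))%E.
Proof.
move=> /ereal_sup_gt[_ [d /= d0 <-]] h; exists d => //.
by rewrite EFinM -lee_pdivlMl ?ltr0n // ltW.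
Qed.

Lemma hom_root (f : A) (mu : RR) j : (0 < j)%N -> ((j%:R * mu)%:E <= H (f ^+ j)%R)%E -> (mu%:E <= H f)%E.
Proof.
move=> j0 h; apply: ereal_le_real => c; rewrite lte_fin => cmu.
have [|d d0 hd] := @lt_homX (f ^+ j) (j%:R * c).
  by apply: lt_le_trans h; rewrite lte_fin ltr_pM2l ?ltr0n.
apply: (@le_homX _ (j * d)); first by rewrite muln_gt0 j0.
by rewrite exprM natrM -mulrA mulrCA.
Qed.

(* If [v] is congruent to [g i] modulo the prime [P i], the product of the
   [v - g i] vanishes, which is an equation of integral dependence for [v]. *)
Lemma hom_ge_of_primes N (P : nat -> A -> Prop) f (mu : RR) :
    (forall i, hideal G (P i)) -> (forall f, (forall i, (i < N)%N -> P i f) -> f = 0) ->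
    (forall i, (i < N)%N -> (mu%:E < qspec chi (P i) f)%E) -> (mu%:E <= H f)%E.
Proof.
move=> hP P0 hmu.
have [D D0 hD] : exists2 D, (0 < D)%N & forall i, (i < N)%N -> qfilt chi (P i) (D%:R * mu) (f ^+ D).
  (* The claim is made for all multiples of D so that the exponents of the successive primes can be
     multiplied. *)
  have [D D0 hD] : exists2 D, (0 < D)%N &
      forall i j, (i < N)%N -> (0 < j)%N -> qfilt chi (P i) ((j * D)%:R * mu) (f ^+ (j * D)).
    elim: N hmu {P0} => [|N IH] hmu; first by exists 1%N.
    have [i iN|D D0 hD] := IH; first by apply: hmu; exact: ltnW.
    have [mu' mm hg] := lt_qspec (hmu N (leqnn _)).
    have [d d0 hd] := grows_filt (@qfiltW _ _ _ chi (P N)) mm hg.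
    exists (D * d)%N; first by rewrite muln_gt0 D0.
    move=> i j; rewrite ltnS leq_eqVlt => /predU1P[->|iN] j0.
      by rewrite mulnA; apply: hd; rewrite muln_gt0 j0.
    by rewrite (mulnC D) mulnA; apply: hD; rewrite // muln_gt0 j0.
  by exists D => // i iN; have := hD i 1%N iN isT; rewrite mul1n.
have /choice[q hq] : forall i, exists q, (i < N)%N -> P i q /\ ((D%:R * mu)%:E <= chi (f ^+ D + q)%R)%E.
  move=> i; have [iN|Ni] := ltnP i N; last by exists 0.
  by have [q Pq h] := hD i iN; exists q.
apply: (hom_root D0); set v := f ^+ D; set M := D%:R * mu.
rewrite leNgt; apply/negP => vM.
have [nu vnu] : exists nu : RR, H v = nu%:E.
  have [l hl] := chi_real chi_NR v; move: (le_trans hl (chi_le_hom v)) vM.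
  by case: (H v) => [r| |] // _ _; exists r.
have nuM : nu < M by rewrite vnu lte_fin in vM.
(* Each g_i has norm above nu = H v, so the product differs from v^j by an element of norm above j
   nu. At j = N the product is 0, and H (v^N) > N nu contradicts power-multiplicativity. *)
pose g i := v + q i; pose Pr j := \prod_(i < j) (v - g i).
have PrN : Pr N = 0.
  apply: P0 => i iN; rewrite /Pr (bigD1 (Ordinal iN)) //= mulrC; apply: (hidealM (hP i)).
  rewrite /g opprD addrA subrr add0r -mulN1r; apply: (hidealM (hP i)).
  by case: (hq i iN).
have gM i : (i < N)%N -> (nu%:E < H (g i))%E.
  move=> iN; have [_ h] := hq i iN; apply: lt_le_trans (chi_le_hom _).
  by apply: lt_le_trans h; rewrite lte_fin.
have key j : (j <= N)%N -> ((j%:R * nu)%:E <= H (Pr j))%E /\ ((j%:R * nu)%:E < H (v ^+ j - Pr j)%R)%E.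
  elim: j => [|j IH] jN.
    by rewrite /Pr big_ord0 mul0r expr0 subrr (seminorm0 H) (seminorm1 H) ltry.
  have [h1 h2] := IH (ltnW jN).
  have E : Pr j.+1 = Pr j * (v - g j) by rewrite /Pr big_ord_recr.
  have vv : (nu%:E <= H v)%E by rewrite vnu.
  have vg : (nu%:E <= H (v - g j)%R)%E.
    apply: le_trans (seminormD H _ _); rewrite le_min vv /=.
    by rewrite -scaleN1r; apply: le_trans (seminormZ H _ _); exact: ltW (gM j jN).
  have js : j.+1%:R * nu = j%:R * nu + nu by rewrite -addn1 natrD mulrDl mul1r.
  rewrite js E; split.
    by apply: le_trans (seminormM H _ _); rewrite EFinD; exact: leeD.
  have -> : v ^+ j.+1 - Pr j * (v - g j) = v * (v ^+ j - Pr j) + Pr j * g j by rewrite exprS; ring.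
  apply: lt_le_trans (seminormD H _ _); rewrite lt_min; apply/andP; split.
    by rewrite addrC; exact: seminorm_ltM.
  by apply: seminorm_ltM => //; exact: gM.
have [_] := key N (leqnn _); rewrite PrN subr0.
case: (posnP N) => [N0|N0] h.
  by have /eqP := PrN; rewrite /Pr N0 big_ord0 oner_eq0.
have := @sgX_gt k RR A H hom_root v nu N N0 h.
by rewrite vnu ltxx.
Qed.

Theorem hom_noetherian :
  (forall m f, f \in G m -> H f = +oo%E -> f = 0) /\
  forall (X : nat -> gr -> gr) U,
    (forall (i : 'I_n) u, X i u = sym G H (ma_monom (1%N, w i) (s i)) * u) ->
    opsub X n U -> opfg X n U.
Proof.
have hZ : hideal G (fun f : A => f = 0).
  split=> //.
  - by move=> a b -> ->; rewrite addr0.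
  - by move=> a b ->; rewrite mulr0.
  - by move=> m f ->; rewrite raddf0.
have [||N [P [hP P0]]] := prime_decomposition (pres_C pres) (pres_X pres) (@pres_surj _ _ _ _ _ _ _ _ _ pres) hZ.
- by apply/eqP; rewrite oner_eq0.
- by move=> f /A_reduced.
have hPi i : hideal G (P i) by case: (hP i).
have P1 i : ~ P i 1 by case: (hP i).
have Pp i : forall a b, P i (a * b) -> P i a \/ P i b by case: (hP i).
pose tg i := qspec_seminorm chi_NR pres (hPi i) (P1 i).
have core i := prime_core inf (hideal0 (hPi i)) (@hidealD _ _ _ _ (hPi i)) (@hidealM _ _ _ _ (hPi i)) (P1 i)
  (Pp i) (sg := tg i) (qspec_ideal chi_NR (hPi i)) (qspecX chi_NR (hPi i)) (pres_deg1 pres) (w := w)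
  _ (pres_C pres) (pres_X pres) (@pres_surj _ _ _ _ _ _ _ _ _ pres) (qspec_power chi_NR pres (hPi i)).
have {}core i : (forall m f, f \in G m -> tg i f = +oo%E -> P i f) /\
    forall (X : nat -> Defs.gr G (tg i) -> Defs.gr G (tg i)) U,
    (forall (j : 'I_n) u, X j u = sym G (tg i) (ma_monom (1%N, w j) (s j)) * u) ->
    opsub X n U -> opfg X n U.
  by apply: core => i' j; rewrite -(pres_weight pres); exact: (chi_le_qspec chi_NR (hPi i')).
have le_t i f : (H f <= tg i f)%E by exact: (hom_le_qspec chi_NR (hPi i)).
have gen0 j : nge G H 0 (ma_monom (1%N, w j) (s j)).
  apply: nge_monom; first exact: pres_deg1 pres j.
  by rewrite /= addr0 -(pres_weight pres); exact: chi_le_hom.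
split=> [m f fG Hf|X U XE Us].
  apply: P0 => i _; apply: (core i).1 fG _.
  by apply/eqP; rewrite -leye_eq -Hf; exact: le_t.
apply: (@fg_glue _ _ X n N (fun i u => gr_map (tg i) u = 0)) => // [i iN|u Uu Ku].
  split.
    split.
    - exact: raddf0.
    - by move=> u v hu hv; rewrite (raddfD (gr_map (tg i))) /= hu hv addr0.
    - by move=> c u hu; rewrite gr_mapZ ?hu ?scaler0.
    - move=> j u jn hu; rewrite (XE (Ordinal jn)) gr_mapM ?hu ?mulr0 //.
  pose X' (j : nat) (u : Defs.gr G (tg i)) : Defs.gr G (tg i) :=
    if (insub j : option 'I_n) is Some j' then sym G (tg i) (ma_monom (1%N, w j') (s j')) * u else 0.
  have X'E (j : 'I_n) u : X' j u = sym G (tg i) (ma_monom (1%N, w j) (s j)) * u by rewrite /X' valK.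
  apply: (@fg_modulo_kernel _ _ X n _ X' (gr_map (tg i) : {additive gr -> Defs.gr G (tg i)})).
  - by move=> c u; apply: gr_mapZ.
  - move=> j u jn; rewrite (XE (Ordinal jn)) (X'E (Ordinal jn)) /= gr_mapM // gr_mapE //.
  - by move=> U' Us'; apply: (core i).2 Us'.
have [h hh uh] := sym_ex u; rewrite uh; apply/(sym_eq0 hh) => x.
have hlt i : (i < N)%N -> (x.2%:E < tg i (ma_coef h x))%E.
  move=> iN; have := Ku i iN; rewrite uh gr_mapE // => /(sym_eq0 (nge_le (le_t i) hh)).
  exact.
(* [hom_ge_of_primes] gives a weak inequality; finitely many strict ones leave room for a common mu
   above x.2. *)
have [mu xmu hmu] : exists2 mu, x.2 < mu & forall i, (i < N)%N -> (mu%:E < tg i (ma_coef h x))%E.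
  elim: (N) hlt => [|M IH] hlt; first by exists (x.2 + 1); rewrite ?ltrDl.
  have [i iM|mu xmu hmu] := IH; first by apply: hlt; exact: ltnW.
  have [mu' mm _] := lt_qspec (hlt M (leqnn _)).
  have [mu1 xmu1 hmu1] : exists2 mu1, x.2 < mu1 & (mu1%:E < tg M (ma_coef h x))%E.
    have := hlt M (leqnn _); case: (tg M _) => [r| |] //.
      by rewrite lte_fin => xr; exists ((x.2 + r) / 2); rewrite ?lte_fin; lra.
    by move=> _; exists (x.2 + 1); rewrite ?ltrDl ?ltry.
  exists (Num.min mu mu1); first by rewrite lt_min xmu.
  move=> i; rewrite ltnS leq_eqVlt => /predU1P[->|iM].
    by apply: le_lt_trans hmu1; rewrite lee_fin ge_min lexx orbT.
  by apply: le_lt_trans (hmu i iM); rewrite lee_fin ge_min lexx.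
apply: lt_le_trans (_ : (mu%:E <= _)%E); first by rewrite lte_fin.
exact: hom_ge_of_primes hPi P0 hmu.
Qed.

End Homogenization.

(** * Approximation and the main theorem *)

Section MainTheorem.
Variables (k : fieldType) (RR : realType) (A : comAlgType k) (G : grading A).
Variable chi : A -> \bar RR.
Hypothesis inf : forall q : {poly k}, q != 0 -> exists x, q.[x] != 0.
Hypothesis A_reduced : reduced A.
Hypothesis chi_NR : in_NR G chi.
Variables (n : nat) (s : 'I_n -> A) (w : 'I_n -> RR) (sev : {rmorphism mpoly n k -> A}).
Hypothesis pres : presentation G chi s w sev.
Let chiV := NR_vnorm chi_NR.
Local Notation MA := (monoid_algebra (nat * RR)%type A).
Local Notation H := (homogenization_seminorm chiV (NR_superadditive chi_NR)).
Local Notation gr := (gr G H).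
Local Notation sym := (sym G H).
Local Notation nge := (nge G H).

Definition sym_gen (i : 'I_n) : MA := ma_monom (1%N, w i) (s i).

Definition sym_op (i : nat) (u : gr) : gr :=
  if (insub i : option 'I_n) is Some j then sym (sym_gen j) * u else 0.

Lemma sym_opE (i : 'I_n) u : sym_op i u = sym (sym_gen i) * u.
Proof. by rewrite /sym_op valK. Qed.

Lemma nge_sym_gen i : nge 0 (sym_gen i).
Proof.
apply: nge_monom; first exact: pres_deg1 pres i.
by rewrite /= addr0 -(pres_weight pres); exact: (chi_le_hom chi_NR _).
Qed.

Lemma gr_generators : exists g : seq gr, forall u, opspan sym_op n (fun e => e \in g) u.
Proof.
have [_ noeth] := hom_noetherian inf A_reduced chi_NR pres.
have [|g [_ hg]] := noeth sym_op (fun=> True) sym_opE; first by split.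
by exists g => u; exact: hg.
Qed.

Lemma gr_finitely_generated : finitely_generated_algebra gr.
Proof.
have [g hg] := gr_generators.
exists ([seq sym (sym_gen i) | i <- enum 'I_n] ++ g) => S subS u.
apply: (hg u (fun u => u \in S)).
  split=> [|u1 u2|c u1|i u1 iN h]; [exact: rpred0|exact: rpredD|exact: rpredZ|].
  rewrite (sym_opE (Ordinal iN)); apply: rpredM => //; apply: subS.
  by rewrite mem_cat; apply/orP; left; apply: map_f; rewrite mem_enum.
by move=> e eg; apply: subS; rewrite mem_cat eg orbT.
Qed.

(* Every element is, up to an element of larger norm, a combination of finitely
   many homogeneous ones with monomials in the s i as coefficients. *)
Lemma hom_approximation : exists E : seq ((nat * RR) * A),
  (forall t, t \in E -> t.2 \in G t.1.1 /\ (t.1.2%:E <= H t.2)%E /\ t.2 != 0) /\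
  forall W : nat * RR -> A -> Prop,
    (forall x, W x 0) -> (forall x f g, W x f -> W x g -> W x (f + g)) ->
    (forall x (c : k) f, W x f -> W x (c *: f)) -> 
    (forall x i f, W x f -> W (x + (1%N, w i)) (s i * f)) ->
    (forall t, t \in E -> W t.1 t.2) ->
  forall m f (l : RR), f \in G m -> (l%:E <= H f)%E ->
    exists f', [/\ W (m, l) f', f' \in G m & (l%:E < H (f - f')%R)%E].
Proof.
have [g hg] := gr_generators.
have [E [hE gE]] : exists E : seq ((nat * RR) * A),
    (forall t, t \in E -> t.2 \in G t.1.1 /\ (t.1.2%:E <= H t.2)%E /\ t.2 != 0) /\
    forall V : gr -> Prop, V 0 -> (forall u v, V u -> V v -> V (u + v)) ->
      (forall t, t \in E -> V (sym (ma_monom t.1 t.2))) -> forall u, u \in g -> V u.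
  elim: (g) => [|u r [E [hE gE]]]; first by exists [::].
  have [h hh uh] := sym_ex u.
  exists ([seq (x, ma_coef h x) | x <- finsupp h] ++ E); split.
    move=> t; rewrite mem_cat => /orP[/mapP[x xh ->]|/hE//] /=.
    have [hG hx] := hh x; rewrite addr0 in hx; split=> //; split=> //.
    by rewrite mem_finsupp in xh.
  move=> V V0 VD hV u'; rewrite in_cons => /predU1P[->|]; last first.
    by apply: gE => // t tE; apply: hV; rewrite mem_cat tE orbT.
  have hm x : nge 0 (ma_monom x (ma_coef h x)).
    by have [hG hx] := hh x; exact: nge_monom hG hx.
  rewrite uh (ma_expand h) sym_sum // big_seq; apply: (@big_ind _ V) => // x xh.
  by apply: (hV (x, ma_coef h x)); rewrite mem_cat map_f.
exists E; split=> // W W0 WD WZ Ws WE m f l fG fl.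
(* The symbols with a lift whose coefficients satisfy W form a submodule containing the generators.
   The coefficient at (m, l) of such a lift of the symbol of f is the approximation. *)
pose U (u : gr) := exists2 h, nge 0 h /\ (forall x, W x (ma_coef h x)) & u = sym h.
have U0 : U 0.
  by exists 0; [split=> [|x]; [exact: nge0|rewrite ma_coef0]|rewrite sym0].
have UD u v : U u -> U v -> U (u + v).
  move=> [h [hh hW] ->] [h' [hh' hW'] ->]; exists (h + h'); last by rewrite symD.
  by split=> [|x]; [exact: ngeD|rewrite ma_coefD; exact: WD].
have Us : opsub sym_op n U.
  split=> // [c _ [h [hh hW] ->]|i _ iN [h [hh hW] ->]].
    exists (ma_monom 0 c%:A * h); last first.
      rewrite symM ?sym_scalar -?scalerAl ?mul1r //; exact: nge_scalar.
    split=> [|x]; first by have := ngeM (nge_scalar G H c) hh; rewrite addr0.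
    have -> : ma_coef (ma_monom 0 c%:A * h) x = c *: ma_coef h x; last exact: WZ.
    rewrite [in LHS](ma_expand h) mulr_sumr ma_coef_sum.
    rewrite [in RHS](ma_expand h) ma_coef_sum scaler_sumr; apply: eq_bigr => y _.
    by rewrite ma_monomM add0r !ma_monomE -scalerAl mul1r scalerMnr.
  pose i' := Ordinal iN; exists (sym_gen i' * h); last first.
    by rewrite (sym_opE i') symM //; exact: nge_sym_gen.
  split=> [|x]; first by have := ngeM (nge_sym_gen i') hh; rewrite addr0.
  rewrite (ma_expand h) mulr_sumr ma_coef_sum; apply: (@big_ind _ (W x)) => // [a b|y _]; first exact: WD.
  rewrite ma_monomM ma_monomE; case: eqP => [->|_]; last by rewrite mulr0n.
  by rewrite mulr1n addrC; exact: Ws.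
have UE t : t \in E -> U (sym (ma_monom t.1 t.2)).
  move=> tE; have [tG [tl _]] := hE t tE; exists (ma_monom t.1 t.2) => //; split=> [|x].
    by apply: nge_monom; rewrite ?addr0.
  by rewrite ma_monomE; case: eqP => [->|_]; [rewrite mulr1n; exact: WE|rewrite mulr0n].
have hfm : nge 0 (ma_monom (m, l) f) by apply: nge_monom; rewrite //= addr0.
have [h [hh hW] E'] := hg (sym (ma_monom (m, l) f)) U Us (gE U U0 UD UE).
exists (ma_coef h (m, l)); split; [exact: hW|by have [] := hh (m, l)|].
have := proj1 (sym_sub_eq0 hfm hh) E' (m, l).
by rewrite ma_monomE eqxx mulr1n.
Qed.

Lemma gcomp_span_finite m : exists N (b : 'I_N -> A), forall f, f \in G m ->
  exists a : 'I_N -> k, f = \sum_i a i *: b i.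
Proof.
pose ev (i : 'I_#|{: bmultinom n m.+1}|) : bmultinom n m.+1 := enum_val i.
exists _, (fun i => sev (mpolyX k (ev i))) => f /(pres_surj pres)[F hF ->].
exists (fun i => mcoeff (ev i) F).
rewrite {1}(mpolywE (hom_msize hF)) rmorph_sum (reindex ev) /=; last first.
  by apply: onW_bij; exact: enum_val_bij.
apply: eq_bigr => i _; rewrite -mul_mpolyC rmorphM /= (pres_C pres).
by rewrite -scalerAl mul1r.
Qed.

Lemma hom_bounded : exists2 C : RR, 0 < C & forall m f, f \in G m -> (H f <= chi f + C%:E)%E.
Proof.
have [E [hE approx]] := hom_approximation.
(* C bounds the excess of the degree over chi on the finitely many generators. Multiplication by s_i
   raises the degree by w_i and chi by at least as much, so the bound persists. *)
have [C C0 hC] : exists2 C : RR, 0 < C & forall t, t \in E -> ((t.1.2 - C)%:E <= chi t.2)%E.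
  elim: E {hE approx} => [|t E [C C0 hC]]; first by exists 1.
  have [r hr] := chi_real chi_NR t.2.
  exists (Num.max C (t.1.2 - r)); first by rewrite lt_max C0.
  move=> t'; rewrite in_cons => /predU1P[->|/hC h].
    by apply: le_trans hr; rewrite lee_fin lerBlDr -lerBlDl le_max lexx orbT.
  by apply: le_trans h; rewrite lee_fin lerD2l lerN2 le_max lexx.
exists C => // m f fG.
pose W (x : nat * RR) g := ((x.2 - C)%:E <= chi g)%E.
have {}approx := approx W.
have WD x g g' : W x g -> W x g' -> W x (g + g').
  by move=> h h'; apply: le_trans (vnormD chiV _ _); rewrite le_min; apply/andP.
have {}approx m' g l : g \in G m' -> (l%:E <= H g)%E ->
    exists g', [/\ ((l - C)%:E <= chi g')%E, g' \in G m' & (l%:E < H (g - g')%R)%E].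
  apply: (approx _ WD _ _ hC) => [x|x c g'|x i g'].
  - by rewrite /W (vnorm0 chiV) leey.
  - by move=> h; apply: le_trans h (vnormZ_le chiV _ _).
  - move=> h; apply: le_trans (NR_superadditive chi_NR _ _).
    by rewrite (pres_weight pres) /W /= [x.2 + _]addrC -addrA EFinD leeD2l.
apply: contrapT => /negP; rewrite -ltNge => bad.
pose B g := g \in G m /\ (chi g + C%:E < H g)%E.
(* If chi g + C < H g, the approximation g' has chi g' > chi g, so chi (g - g') <= chi g: the
   difference violates the bound too, with larger H. *)
have next g : exists g', B g -> B g' /\ (H g < H g')%E.
  have [[gG gB]|nB] := pselect (B g); last by exists 0.
  have [c ec] : exists c : RR, chi g = c%:E.
    move: gB; have := vnormNy chiV g; case: (chi g) => [c| |] // _; first by exists c.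
    by rewrite ltNge leey.
  have [l el] : exists l : RR, H g = l%:E.
    have g0 : g <> 0 by move=> g0; move: gB; rewrite g0 (vnorm0 chiV) ltNge leey.
    move: (chi_le_hom chi_NR g); rewrite ec; case Hg : (H g) => [l| |] // _; first by exists l.
    by case: g0; exact: (proj1 (hom_noetherian inf A_reduced chi_NR pres) m g gG Hg).
  have [|g' [g'1 g'G g'2]] := approx m g l gG; first by rewrite el.
  exists (g - g') => _; rewrite el; split=> //; split; first exact: gcompB.
  apply: le_lt_trans g'2; rewrite leNgt; apply/negP => h.
  move: gB; rewrite ec el -EFinD lte_fin => gB.
  have : (mine (chi (g - g')%R) (chi g') <= chi g)%E.
    by have := vnormD chiV (g - g') g'; rewrite subrK.
  rewrite ec ge_min; case/orP => h'.
    have := lt_le_trans h (leeD2r C%:E h'); rewrite -EFinD lte_fin; lra.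
  by have := le_trans g'1 h'; rewrite lee_fin; lra.
have /choice[nx hnx] := next; pose x j := iter j nx f.
have Bx j : B (x j) by elim: j => [//|j IH]; have [] := hnx _ IH.
have [N [b hb]] := gcomp_span_finite m.
apply: (@ascending_dependent k A RR H N b x).
- exact: seminorm0.
- exact: seminormZ.
- exact: seminormD.
- by move=> j; have [] := hnx _ (Bx j).
- by move=> j; apply: hb; case: (Bx j).
Qed.

Lemma hc_top N d f : (forall i, (N < i)%N -> hc G i f = 0) ->
  hc G (N * d) (f ^+ d) = hc G N f ^+ d /\ forall i, (N * d < i)%N -> hc G i (f ^+ d) = 0.
Proof.
move=> hN; elim: d => [|d [IH1 IH2]].
  rewrite muln0 !expr0 (hc_id _ (gcomp1 G)); split=> // i.
  by rewrite (hc_id _ (gcomp1 G)) => /gtn_eqF ->.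
have expand m : hc G m (f ^+ d.+1) = \sum_(i < N.+1 | (i <= m)%N) hc G i f * hc G (m - i) (f ^+ d).
  by rewrite exprS; apply: hcM => i; exact: hN.
split=> [|m]; rewrite mulnS.
  rewrite expand (bigD1 ord_max) /= ?leq_addr // addKn IH1 -exprS big1 ?addr0 // => i /andP[_].
  rewrite -val_eqE /= => iN; rewrite IH2 ?mulr0 //.
  by have := ltn_ord i; rewrite ltnS leq_eqVlt (negPf iN) /= => ?; lia.
move=> hm; rewrite expand big1 // => i im; rewrite IH2 ?mulr0 //.
by have := ltn_ord i; lia.
Qed.

(** The top component of f^d is the d-th power of the top component of f, which gives the bound for
    the latter; subtract it and induct on the degree. *)
Lemma hom_component m f : (H f <= H (hc G m f))%E.
Proof.
have [N hN] := hc_bound G f; elim: N f hN => [|N IH] f hN.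
  by rewrite hN // (seminorm0 H) leey.
have top : (H f <= H (hc G N f))%E.
  apply: ereal_le_real => c /(lt_homX)[d d0 h]; apply: (le_homX chi_NR d0).
  apply: le_trans h (le_trans (grading_component chi_NR (N * d) _) _).
  by rewrite (hc_top _ hN).1.
have [->//|mN] := eqVneq m N.
have -> : hc G m f = hc G m (f - hc G N f).
  by rewrite raddfB /= (hc_id _ (hc_in G N f)) (negPf mN) subr0.
apply: le_trans (IH _ _) => [|i].
  by apply: le_trans (seminormD H _ _); rewrite le_min lexx -scaleN1r (le_trans top (seminormZ H _ _)).
rewrite leq_eqVlt => /predU1P[<-|Ni].
  by rewrite raddfB /= (hc_id _ (hc_in G N f)) eqxx subrr.
by rewrite raddfB /= (hc_id _ (hc_in G N f)) hN // (gtn_eqF Ni) subr0.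
Qed.

Lemma hom_grading : grading_compatible G H.
Proof.
move=> N t tG; apply/eqP; rewrite eq_le; apply/andP; split.
  apply: le_bigmin; first exact: leey.
  move=> i _; apply: le_trans (hom_component i _) _.
  by rewrite (hc_uniq _ _ tG) ltn_ord.
elim: N => [|N IH]; first by rewrite !big_ord0 (seminorm0 H).
rewrite !big_ord_recr /=; apply: le_trans (seminormD H _ _).
by rewrite le_min !ge_min IH lexx orbT.
Qed.

Lemma hom_eqy f : H f = +oo%E -> f = 0.
Proof.
move=> Hf; have [N hN] := hc_bound G f; rewrite (hc_expand hN) big1 // => i _.
apply: (proj1 (hom_noetherian inf A_reduced chi_NR pres) i _ (hc_in G i f)).
by apply/eqP; rewrite -leye_eq -Hf; exact: hom_component.
Qed.

Lemma hom_in_NR : in_NR G H.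
Proof.
have [C C0 hC] := hom_bounded; split.
- split=> [f|f|c f c0|f g].
  + by have := vnormNy chiV f; have := chi_le_hom chi_NR f; case: (H f) => //; case: (chi f).
  + by split=> [|->]; [exact: hom_eqy|exact: (seminorm0 H)].
  + apply/eqP; rewrite eq_le (seminormZ H) andbT.
    by rewrite -[f in leRHS](scalerK c0); exact: (seminormZ H).
  + exact: (seminormD H).
- exact: (seminormM H).
- exact: hom_grading.
have [C' [C'0 hC']] := NR_bounded chi_NR; exists (C' + C); split; first exact: addr_gt0.
move=> m f m1 fG f0; have := hC' m f m1 fG f0; have := hC m f fG; have := chi_le_hom chi_NR f.
have m1R : 1 <= m%:R :> RR by rewrite ler1n.
have CmR : C <= C * m%:R by rewrite ler_peMr // ltW.
case: (chi f) => [r| |] //; case: (H f) => [t| |] //; rewrite -?EFinD /= !lee_fin.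
rewrite !ler_norml mulrDl => h1 h2 /andP[h3 h4].
by apply/andP; split; lra.
Qed.

Lemma hom_almost_eq : exists C : RR, 0 < C /\
  forall f : A, (chi f <= H f)%E /\ (H f <= chi f + C%:E)%E.
Proof.
have [C C0 hC] := hom_bounded; exists C; split=> // f; split; first exact: (chi_le_hom chi_NR _).
have [N hN] := hc_bound G f; rewrite -leeBlDr // {2}(hc_expand hN) (NR_grading chi_NR); last first.
  by move=> i; exact: hc_in.
apply: le_bigmin; first exact: leey.
move=> i _; rewrite leeBlDr //; apply: le_trans (hom_component i f) _.
exact/hC/hc_in.
Qed.

Lemma homX_eq f (l : RR) j : H f = l%:E -> (0 < j)%N -> H (f ^+ j) = (j%:R * l)%:E.
Proof.
move=> Hf j0; apply/eqP; rewrite eq_le; apply/andP; split.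
  rewrite leNgt; apply/negP => /(@sgX_gt k RR A H (@hom_root _ _ _ _ _ chi_NR) f l j j0).
  by rewrite Hf ltxx.
case: j j0 => // j _; elim: j => [|j IH]; first by rewrite mul1r expr1 Hf.
rewrite exprS -add1n natrD mulrDl mul1r EFinD.
by apply: le_trans (seminormM H _ _); rewrite Hf leeD.
Qed.

Lemma hom_values (L : zmodClosed RR) m f l : (forall i, w i \in L) -> f \in G m ->
  H f = l%:E -> Qspan L l.
Proof.
move=> wL fG Hf; have [E [hE approx]] := hom_approximation.
(* Since f^j has norm exactly j l, its approximation is nonzero and j l is congruent modulo L to the
   degree of a generator. Two of the exponents 1, ..., [size E] + 1 share a generator, and their
   difference d satisfies d l in L. *)
pose W (x : nat * RR) (g : A) := g = 0 \/ exists2 t, t \in E & x.2 - t.1.2 \in L.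
have {}approx := approx W.
have key j : exists t, (0 < j)%N -> t \in E /\ j%:R * l - t.1.2 \in L.
  have [j0|] := posnP j; first by exists (0, 0); rewrite j0.
  move=> j0; have Hj := homX_eq Hf j0.
  have [|||||||g [Wg _ gl]] := approx _ _ _ _ _ (m * j)%N (f ^+ j) (j%:R * l).
  - by left.
  - by move=> x g g' [->|hg]; [rewrite add0r|right].
  - by move=> x c g [->|hg]; [left; rewrite scaler0|right].
  - move=> x i g [->|[t tE ht]]; [by left; rewrite mulr0|right]; exists t => //=.
    by rewrite addrAC rpredD.
  - by move=> t tE; right; exists t; rewrite // subrr rpred0.
  - exact: gcompX.
  - by rewrite Hj.
  case: Wg => [g0|[t tE ht]]; last by exists t.
  by move: gl; rewrite g0 subr0 Hj ltxx.
have /choice[t ht] := key.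
have : ~~ uniq [seq t i | i <- iota 1 (size E).+1].
  apply/negP => tU; have : (size [seq t i | i <- iota 1 (size E).+1] <= size E)%N.
    apply: uniq_leq_size tU _ => x /mapP[i]; rewrite mem_iota => /andP[i0 _] ->.
    by case: (ht i i0).
  by rewrite size_map size_iota ltnn.
move=> /(uniqPn (t 0%N))[i [j [ij]]]; rewrite size_map size_iota => jE.
have iE := ltn_trans ij jE.
rewrite !(nth_map 0%N) ?size_iota // !nth_iota // !add1n => tij.
have [_ hi] := ht i.+1 isT; have [_ hj] := ht j.+1 isT.
pose d := (j - i)%N; have d0 : d%:R != 0 :> RR by rewrite pnatr_eq0 -lt0n subn_gt0.
have dL : d%:R * l \in L.
  have -> : d%:R * l = (j.+1%:R * l - (t j.+1).1.2) - (i.+1%:R * l - (t i.+1).1.2).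
    by rewrite tij opprB addrA subrK -mulrBl -natrB ?subSS // ltnW.
  exact: rpredB.
exists [:: (d%:R^-1, d%:R * l)]; split; first by rewrite /= dL.
by rewrite big_seq1 /= fmorphV /= ratr_nat mulKf.
Qed.

Lemma hom_in_N (L : zmodClosed RR) : in_N G [set x | x \in L] chi -> in_N G (Qspan L) H.
Proof.
move=> [_ chiL]; split=> [|f]; first exact: hom_in_NR.
have wL i : w i \in L.
  have := chiL (s i); rewrite (pres_weight pres) => -[//|[x Lx [->]]].
  exact: Lx.
have [N hN] := hc_bound G f.
have Hmin := hom_grading N (hc_in G ^~ f); rewrite -(hc_expand hN) in Hmin.
have [Hy|[i Hi]] : H f = +oo%E \/ exists i, H f = H (hc G i f); [|by left|].
  rewrite Hmin; apply: (@big_ind _ (fun x => x = +oo%E \/ exists i, x = H (hc G i f))) => [|x y hx hy|i _].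
  - by left.
  - by rewrite minEle; case: ifP.
  - by right; exists (i : nat).
case E : (H f) => [l| |]; [right; exists l => //|by left|].
  by apply: (hom_values wL (hc_in G i f)); rewrite -Hi.
by have := vnormNy (NR_vnorm hom_in_NR) f; rewrite E.
Qed.

End MainTheorem.

(** If q vanished everywhere, the nonconstant polynomial q X + 1 would have no root. *)
Lemma closed_field_nonroot (k : closedFieldType) (q : {poly k}) : q != 0 -> exists x, q.[x] != 0.
Proof.
move=> q0; apply: contrapT => h.
have /closed_rootP[x] : size (q * 'X + 1) != 1%N.
  by rewrite -[1](@polyC1 k) size_MXaddC (negPf q0) /= eqSS size_poly_eq0.
rewrite /root !hornerE; have -> : q.[x] = 0.
  by apply/eqP; apply: contrapT => /negP qx; apply: h; exists x.
by rewrite mul0r add0r oner_eq0.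
Qed.

Theorem theorem2p3 (k : closedFieldType) (RR : realType) (A : comAlgType k)
    (G : grading A) (chi : A -> \bar RR)
    (A_reduced : reduced A) (chi_NR : in_NR G chi)
    (chi_gen : generated_in_degree_1 G chi) :
  [/\ exists C : RR, 0 < C /\
        forall f : A, (chi f <= homogenization chi f)%E /\
                      (homogenization chi f <= chi f + C%:E)%E,
      finitely_generated_algebra
        (gr G (homogenization_seminorm (NR_vnorm chi_NR)
                                       (NR_superadditive chi_NR)))
    & forall L : zmodClosed RR,
        in_N G [set x | x \in L] chi ->
        in_N G (Qspan L) (homogenization chi)].
Proof.
have [n [s [w [sev pres]]]] := presentation_exists chi_NR chi_gen.
have inf := @closed_field_nonroot k; split.
- exact: (hom_almost_eq inf A_reduced chi_NR pres).
- exact: (gr_finitely_generated inf A_reduced chi_NR pres).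
- by move=> L; exact: (hom_in_N inf A_reduced chi_NR pres).
Qed.
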